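(* Let $f(w)=w+w^2+O(w^3)$ be a holomorphic germ at the origin of $\mathbb{C}$. For integers $n\ge 1$ and $0\le k\le n-1$ let $\varepsilon_{k,n},\sigma_{k,n}\in\mathbb{C}$ satisfy $$\varepsilon_{k,n}=\frac{\pi}{n}+\frac{\pi}{n^2}\sigma_{k,n}+O\Big(\frac{1}{n^{2+\alpha}}\Big)$$ for some $0<\alpha<1$ (with the $O$ uniform in $k$), and assume that the $\sigma_{k,n}$ are uniformly bounded. For $w_0\in\mathcal{B}_f$ set $w_0^{(n)}=w_0$ and $$w_{k+1}^{(n)}=f(w_k^{(n)})+\varepsilon_{k,n}^2,\qquad k=0,\dots,n-1.$$ Then, as $n\to\infty$, $$w_n^{(n)}=L_{u_n}(w_0)+o(1)$$ locally uniformly for $w_0$ in the parabolic basin $\mathcal{B}_f$, where $$u_n=\frac1n\sum_{k=0}^{n-1}\sigma_{k,n}\,G\Big(\frac{k+1}{n}\Big),\qquad G(x)=2\sin^2(\pi x).$$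
   Context: Write $f(w)=w+w^2+aw^3+O(w^4)$. For sufficiently small $r>0$ let $P^\iota=\{|w+r|<r\}$ (attracting petal) and $P^o=\{|w-r|<r\}$ (repelling petal). $P^\iota$ is forward invariant under $f$ and $f^m(w)\to0$ for $w\in P^\iota$. The parabolic basin is $\mathcal{B}_f=\bigcup_{m\ge0}f^{-m}(P^\iota)$. Let $\log$ be the principal branch. The attracting and repelling Fatou coordinates are the (univalent, for $r$ small) holomorphic maps $\phi^\iota:P^\iota\to\mathbb{C}$, $\phi^o:P^o\to\mathbb{C}$ with $\phi^\iota(f(w))=\phi^\iota(w)+1$ and $\phi^o(f(w))=\phi^o(w)+1$ (the latter when $w,f(w)\in P^o$), normalized by $\phi^\iota(w)=-\frac1w+(1-a)\log(-w)+o(1)$ and $\phi^o(w)=-\frac1w+(1-a)\log w+o(1)$ as $w\to0$ in the respective petal. The map $\phi^\iota$ is extended to $\mathcal{B}_f$ by $\phi^\iota(w)=\phi^\iota(f^m(w))-m$ ($m$ large). The inverse $(\phi^o)^{-1}$, defined on a left half-plane, is extended to $\mathbb{C}$ by $(\phi^o)^{-1}(\zeta)=f^m\big((\phi^o)^{-1}(\zeta-m)\big)$ ($m$ large). For $u\in\mathbb{C}$ the Lavaurs map of phase $u$ is $L_u=(\phi^o)^{-1}\circ T_u\circ\phi^\iota$ on $\mathcal{B}_f$, where $T_u(\zeta)=\zeta+u$. Convention: $f$ is understood to be defined on a domain for which these extensions, and in particular the map $(\phi^o)^{-1}$ on all of $\mathbb{C}$, make sense (as is automatic, for instance, if $f$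 is entire). *)

(* Defs.v *)
From Stdlib Require Export Reals.
From Coquelicot Require Export Coquelicot.

Open Scope C_scope.

(** Principal argument, with values in (-PI, PI], and principal logarithm;
    the values at 0 are irrelevant. *)
Definition Carg (z : C) : R :=
  if Rle_dec 0 (Im z) then acos (Re z / Cmod z) else (- acos (Re z / Cmod z))%R.

Definition Clog (z : C) : C := (ln (Cmod z), Carg z).

Definition holomorphic_on (D : C -> Prop) (f : C -> C) : Prop :=
  forall z, D z -> ex_derive (K := C_AbsRing) (V := C_NormedModule) f z.

Definition injective_on (D : C -> Prop) (f : C -> C) : Prop :=
  forall z w, D z -> D w -> f z = f w -> z = w.

Definition univalent_on (D : C -> Prop) (f : C -> C) : Prop :=
  holomorphic_on D f /\ injective_on D f.

(** A map with domain [U] is a total function [f] whose values outside [U] are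
    meaningless; the [m]-th iterate at [w] makes sense when this holds. *)
Definition iter_defined (U : C -> Prop) (f : C -> C) (m : nat) (w : C) : Prop :=
  forall j, (j < m)%nat -> U (Nat.iter j f w).

Definition parabolic_expansion (f : C -> C) (a : C) : Prop :=
  exists M : R, locally (T := C_UniformSpace) (RtoC 0)
    (fun w => (Cmod (f w - (w + w ^ 2 + a * w ^ 3)) <= M * Cmod w ^ 4)%R).

Definition attracting_petal (r : R) (w : C) : Prop := (Cmod (w + r) < r)%R.

Definition repelling_petal (r : R) (w : C) : Prop := (Cmod (w - r) < r)%R.

Definition basin (U : C -> Prop) (f : C -> C) (r : R) (w : C) : Prop :=
  exists m, iter_defined U f m w /\ attracting_petal r (Nat.iter m f w).

Definition attracting_fatou_coordinate
    (f : C -> C) (a : C) (r : R) (phi : C -> C) : Prop :=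
  univalent_on (attracting_petal r) phi /\
  (forall w, attracting_petal r w -> phi (f w) = phi w + 1) /\
  filterlim (fun w => phi w - (- / w + (1 - a) * Clog (- w)))
    (within (attracting_petal r) (locally (T := C_UniformSpace) (RtoC 0)))
    (locally (T := C_UniformSpace) (RtoC 0)).

Definition repelling_fatou_coordinate
    (f : C -> C) (a : C) (r : R) (phi : C -> C) : Prop :=
  univalent_on (repelling_petal r) phi /\
  (forall w, repelling_petal r w -> repelling_petal r (f w) ->
     phi (f w) = phi w + 1) /\
  filterlim (fun w => phi w - (- / w + (1 - a) * Clog w))
    (within (repelling_petal r) (locally (T := C_UniformSpace) (RtoC 0)))
    (locally (T := C_UniformSpace) (RtoC 0)).

Definition is_attracting_extension
    (f : C -> C) (r : R) (phi : C -> C) (w zeta : C) : Prop :=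
  eventually (fun m => attracting_petal r (Nat.iter m f w) /\
                       zeta = phi (Nat.iter m f w) - INR m).

Definition attracting_extension
    (f : C -> C) (r : R) (phi : C -> C) (w : C) : C :=
  iota (T := C_CompleteNormedModule) (is_attracting_extension f r phi w).

(** The inverse of [phi] is used only where [zeta - m] belongs to the image of
    the petal, so no half-plane has to be fixed: for some values of [a] that
    image contains no half-plane, but it contains [zeta - m] for [m] large. *)
Definition is_inverse_extension
    (U : C -> Prop) (f : C -> C) (r : R) (phi : C -> C) (zeta z : C) : Prop :=
  eventually (fun m => exists w,
    repelling_petal r w /\ phi w = zeta - INR m /\
    iter_defined U f m w /\ z = Nat.iter m f w).

Definition inverse_extension
    (U : C -> Prop) (f : C -> C) (r : R) (phi : C -> C) (zeta : C) : C :=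
  iota (T := C_CompleteNormedModule) (is_inverse_extension U f r phi zeta).

Definition lavaurs (U : C -> Prop) (f : C -> C) (r : R) (phi_i phi_o : C -> C)
    (u w : C) : C :=
  inverse_extension U f r phi_o (attracting_extension f r phi_i w + u).

Fixpoint perturbed_orbit (f : C -> C) (e : nat -> C) (w0 : C) (k : nat) : C :=
  match k with
  | O => w0
  | S j => f (perturbed_orbit f e w0 j) + e j ^ 2
  end.

Definition G (x : R) : R := (2 * sin (PI * x) ^ 2)%R.

(** [sum_n s m] has [m + 1] terms. *)
Definition phase (sigma : nat -> nat -> C) (n : nat) : C :=
  / INR n * sum_n (G := C_AbelianMonoid)
              (fun k => sigma k n * G (INR (k + 1) / INR n)) (pred n).

(* Main.v *)
Require Import Defs.
From Stdlib Require Import Lra Lia Psatz Classical ClassicalEpsilon.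

(** Compare the orbit with the real orbit [tau_k = - d cot (pi k / n)],
    [d = tan (pi / n)], of the Moebius map [w |-> (w + d^2) / (1 - w)], which agrees
    with [w + w^2 + d^2] to leading order and crosses the gate in exactly [n] steps.
    Writing [w_k = (tau_k + d^2 y_k) / (1 - tau_k y_k)], the coordinate [y_k] measures
    the lag of [w_k] behind [tau_k], and one step of the perturbed dynamics gives
    [y_(k+1) - y_k = (a - 1) tau_k - a d^2 tau_k / rho_k^2
       + (2 sigma_k / n) sin^2 (pi k / n) + O((1 + |y_k|) rho_k^2) + o(1 / n)],
    where [rho_k = d / sin (pi k / n)].  The first two terms are odd under [k |-> n - k]
    and cancel in the sum from [K] to [n - K], the third produces the phase, and the
    error is small when [K] is large.  For fixed [K] and [n] tending to infinity the
    coordinate at time [K] tends to [- 1 / f^K (w_0) - K], and [1 / w_(n-K)] is close to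
    [K - y_(n-K)], so that the normalizations of the two Fatou coordinates, in which
    [(1 - a) ln K] appears with opposite signs, turn this into
    [phi_o (w_(n-K)) = phi_i (w_0) + u_n - K + o(1)].

    The last [K] steps are controlled by compactness and by the injectivity of [phi_o].
    Points with [phi_o = zeta - j] near [1 / j] are obtained without any inverse function
    theorem: start at a point [x] near [1 / m] with [phi_o (x)] nearly [zeta - m], iterate
    [f] forward [m - j] times, and let [m] tend to infinity. *)

Open Scope R_scope.

(** * Compactness and uniform continuity in the plane *)

(** The gate coordinate is tangent addition in disguise: [w = d tan (arctan (tau / d) + arctan (d
    y))], and the reference Moebius map adds the lag [1], that is the angle [arctan d = PI / n].
    Lags therefore compose exactly, also in the middle of the gate, where [w^2] and [d^2] are
    comparable.

    The obstacle is that the error of one step involves the unknown [y_k]. A bootstrap closes this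
    circle: the drift contributes to [y_k] at most a multiple of [sqrt m], where
    [m = min k (n - k)], and [rho_k <= 4 / m], so the errors are of size [m^(-2) + m^(-3/2)]. Their
    sum is bounded uniformly in [n], and small if the passage starts late.

    There are two cut-offs. The bootstrap starts at a time [J] fixed before the precision is given,
    so that the last [J] steps take place near one compact set. The precision decides [K], at which
    the Fatou coordinates are compared. Between the times [n - K] and [n - J] the functional
    equation of [phi_o] carries the value along, at a cost that vanishes as [n] grows with [K]
    fixed. *)

Lemma Cmod_sub_sym (x y : C) : Cmod (x - y) = Cmod (y - x).
Proof. replace (x - y)%C with (- (y - x))%C by ring. apply Cmod_opp. Qed.

Lemma Cmod_sub_tri (x y z : C) : Cmod (x - z) <= Cmod (x - y) + Cmod (y - z).
Proof. replace (x - z)%C with ((x - y) + (y - z))%C by ring. apply Cmod_triangle. Qed.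

Lemma Cmod_sub_le (x y : C) : Cmod (x - y) <= Cmod x + Cmod y.
Proof. unfold Cminus. rewrite <- (Cmod_opp y). apply Cmod_triangle. Qed.

Lemma Cmod_lower (x y : C) : Cmod x <= Cmod y + Cmod (x - y).
Proof. replace x with (y + (x - y))%C at 1 by ring. apply Cmod_triangle. Qed.

Lemma Cmod_pos_neq (x : C) : 0 < Cmod x -> x <> 0%C.
Proof. apply Cmod_gt_0. Qed.

(** The balls of [C_UniformSpace] are boxes, those of [Cmod] are discs; the factor [sqrt 2] compares
    them. Topological hypotheses are translated into radii through this equivalence. *)
Lemma locally_Cmod (z : C) (P : C -> Prop) :
  locally (T := C_UniformSpace) z P <->
  exists d : R, 0 < d /\ forall w, Cmod (w - z) < d -> P w.
Proof.
  split.
  - intros [e He]. exists e. split; [apply cond_pos|].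
    intros w Hw. apply He. apply C_NormedModule_mixin_compat1. exact Hw.
  - intros [d [Hd H]].
    assert (Hs : 0 < sqrt 2) by (apply sqrt_lt_R0; lra).
    assert (Hp : 0 < d / sqrt 2) by (apply Rdiv_lt_0_compat; lra).
    exists (mkposreal _ Hp). intros w Hw. apply H.
    apply C_NormedModule_mixin_compat2 in Hw. simpl in Hw.
    replace (sqrt 2 * (d / sqrt 2)) with d in Hw by (field; lra). exact Hw.
Qed.

Definition continuous_C (g : C -> C) (z : C) : Prop :=
  forall e, 0 < e -> exists d, 0 < d /\
    forall w, Cmod (w - z) < d -> Cmod (g w - g z) < e.

Lemma holomorphic_continuous (D : C -> Prop) (f : C -> C) (z : C) :
  holomorphic_on D f -> D z -> continuous_C f z.
Proof.
  intros Hf Dz e He.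
  pose proof (ex_derive_continuous (K := C_AbsRing) (V := C_NormedModule) f z (Hf z Dz)) as H.
  assert (Hb : locally (T := C_UniformSpace) (f z) (fun y => Cmod (y - f z) < e)).
  { apply locally_Cmod. exists e. auto. }
  specialize (H _ Hb). 
  (* The source carries the uniform structure of [C_AbsRing], whose balls are the discs of [Cmod] by
     conversion. *)
  change (locally (T := AbsRing_UniformSpace C_AbsRing) z (fun x => Cmod (f x - f z) < e)) in H.
  destruct H as [d Hd]. exists d. split; [apply cond_pos|].
  intros w Hw. apply Hd. exact Hw.
Qed.

(** Compactness in the form of a Lebesgue number, which turns radii chosen point by point into one
    radius without handling finite subcovers. *)
Definition lebesgue_compact (A : C -> Prop) : Prop :=
  forall d : C -> R, (forall x, A x -> 0 < d x) ->
  exists e, 0 < e /\ forall x, A x -> exists c, A c /\ Cmod (x - c) < d c /\ e <= d c.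

(** The set sits in a square, where compactness for gauges is available. At centres outside [A] the
    gauge is a radius at which [A] is missed, so a point of [A] can only be caught by a centre in
    [A]. *)
Lemma bounded_closed_compact (A : C -> Prop) (B : R) :
  (forall x, A x -> Cmod x <= B) ->
  (forall x, ~ A x -> exists d, 0 < d /\ forall y, Cmod (y - x) < d -> ~ A y) ->
  lebesgue_compact A.
Proof.
  intros HB Hcl d Hd.
  assert (Hs : 0 < sqrt 2) by (apply sqrt_lt_R0; lra).
  assert (Hdel : forall x y : R, {e : posreal |
     (A (x, y) -> e * 2 <= d (x, y)) /\
     (~ A (x, y) -> forall z, Cmod (z - (x, y)) < 2 * e -> ~ A z)}).
  { intros x y. apply constructive_indefinite_description.
    destruct (classic (A (x, y))) as [HA | HA].
    - assert (Hp : 0 < d (x, y) / 2) by (specialize (Hd _ HA); lra).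
      exists (mkposreal _ Hp). simpl. split; [lra | tauto].
    - destruct (Hcl _ HA) as [e [He H]].
      assert (Hp : 0 < e / 2) by lra.
      exists (mkposreal _ Hp). simpl. split; [tauto|].
      intros _ z Hz. apply H. lra. }
  pose (delta x y := proj1_sig (Hdel x y)).
  destruct (compactness_value_2d (-B) B (-B) B delta) as [e He].
  exists e. split; [apply cond_pos|].
  intros [x y] Hxy.
  specialize (HB _ Hxy).
  pose proof (Rmax_Cmod (x, y)) as Hm. simpl in Hm.
  assert (Hx : -B <= x <= B).
  { apply Rabs_le_between. eapply Rle_trans; [apply Rmax_l|]. eapply Rle_trans; eauto. }
  assert (Hy : -B <= y <= B).
  { apply Rabs_le_between. eapply Rle_trans; [apply Rmax_r|]. eapply Rle_trans; eauto. }
  (* [compactness_value_2d] yields its centre only under a double negation. *)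
  apply NNPP. intro Hn. apply (He x y Hx Hy). intros [u [v [_ [_ [Hu [Hv Hle]]]]]].
  apply Hn. 
  assert (Hc : Cmod ((x, y) - (u, v)) < 2 * delta u v).
  { eapply Rle_lt_trans; [apply Cmod_2Rmax|]. simpl.
    apply Rle_lt_trans with (2 * Rmax (Rabs (x + - u)) (Rabs (y + - v))).
    - apply Rmult_le_compat_r.
      + eapply Rle_trans; [apply (Rabs_pos (x + - u)) | apply Rmax_l].
      + rewrite <- (sqrt_square 2) at 2 by lra. apply sqrt_le_1_alt. lra.
    - apply Rmult_lt_compat_l; [lra|]. apply Rmax_lub_lt; auto. }
  unfold delta in *. destruct (Hdel u v) as [q [Hq1 Hq2]]. simpl in *.
  destruct (classic (A (u, v))) as [HA | HA].
  - exists (u, v). specialize (Hq1 HA). pose proof (cond_pos q).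
    repeat split; auto; lra.
  - exfalso. exact (Hq2 HA _ Hc Hxy).
Qed.

(** The passage from local to uniform statements. The radius is an argument of [P] because
    conclusions may mention it, and the local hypothesis covers all smaller radii so that the common
    one is admissible. *)
Lemma uniform_on_compact (A : C -> Prop) (P : R -> C -> C -> Prop) :
  lebesgue_compact A ->
  (forall q, A q -> exists d, 0 < d /\ forall x y e, 0 < e <= d ->
      Cmod (x - q) < d -> Cmod (y - q) < d -> P e x y) ->
  exists d, 0 < d /\ forall x y, A x -> Cmod (y - x) < d -> P d x y.
Proof.
  intros HA H.
  assert (Hex : forall q, exists d, A q -> 0 < d /\ forall x y e, 0 < e <= d ->
      Cmod (x - q) < d -> Cmod (y - q) < d -> P e x y).
  { intro q. destruct (classic (A q)) as [Hq | Hq].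
    - destruct (H q Hq) as [d Hd]. exists d. tauto.
    - exists 0. tauto. }
  pose (d q := proj1_sig (constructive_indefinite_description _ (Hex q))).
  assert (Hd : forall q, A q -> 0 < d q /\ forall x y e, 0 < e <= d q ->
      Cmod (x - q) < d q -> Cmod (y - q) < d q -> P e x y)
    by (intro q; exact (proj2_sig (constructive_indefinite_description _ (Hex q)))).
  clearbody d.
  destruct (HA (fun q => d q / 2)) as [e [He Hc]].
  { intros x Hx. destruct (Hd x Hx). lra. }
  exists e. split; [exact He|]. intros x y Ax Hxy.
  destruct (Hc x Ax) as [c [Ac [Hxc Hec]]].
  destruct (Hd c Ac) as [Hpos Hp]. apply Hp; try lra.
  pose proof (Cmod_sub_tri y x c). lra.
Qed.

Lemma uniform_continuity (A D : C -> Prop) (g : C -> C) :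
  lebesgue_compact A -> open (T := C_UniformSpace) D -> 
  (forall x, A x -> D x) -> (forall x, A x -> continuous_C g x) ->
  forall e, 0 < e -> exists d, 0 < d /\
  forall x y, A x -> Cmod (y - x) < d -> D y /\ Cmod (g y - g x) < e.
Proof.
  intros HA HD HAD Hg e He.
  destruct (uniform_on_compact A (fun _ x y => D y /\ Cmod (g y - g x) < e) HA) as [d Hd].
  - intros q Aq.
    destruct (Hg q Aq (e / 2)) as [d1 [Hd1 H1]]; [lra|].
    destruct (proj1 (locally_Cmod _ _) (HD q (HAD q Aq))) as [d2 [Hd2 H2]].
    exists (Rmin d1 d2). split; [apply Rmin_pos; auto|].
    intros x y e' _ Hx Hy. split.
    + apply H2. eapply Rlt_le_trans; [exact Hy | apply Rmin_r].
    + assert (Cmod (g x - g q) < e / 2) by (apply H1; eapply Rlt_le_trans; [exact Hx | apply Rmin_l]).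
      assert (Cmod (g y - g q) < e / 2) by (apply H1; eapply Rlt_le_trans; [exact Hy | apply Rmin_l]).
      pose proof (Cmod_sub_tri (g y) (g q) (g x)). rewrite (Cmod_sub_sym (g q)) in *. lra.
  - exists d. exact Hd.
Qed.

(** Otherwise [Cmod (g x - v)] would be positive, hence bounded below, on the compact set. This
    makes approximate preimages exact. *)
Lemma value_attained (A : C -> Prop) (g : C -> C) (v : C) :
  lebesgue_compact A -> (forall x, A x -> continuous_C g x) ->
  (forall e, 0 < e -> exists x, A x /\ Cmod (g x - v) < e) ->
  exists x, A x /\ g x = v.
Proof.
  intros HA Hg Hv. apply NNPP. intro Hn.
  assert (Hpos : forall x, A x -> 0 < Cmod (g x - v)).
  { intros x Ax. apply Cmod_gt_0. intro E. apply Hn. exists x. split; auto.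
    apply Ceq_minus. exact E. }
  destruct (uniform_on_compact A (fun d x y => d <= Cmod (g x - v)) HA) as [d [Hd H]].
  - intros q Aq. specialize (Hpos q Aq).
    destruct (Hg q Aq (Cmod (g q - v) / 2)) as [d [Hd H]]; [lra|].
    exists (Rmin d (Cmod (g q - v) / 2)). split; [apply Rmin_pos; lra|].
    intros x _ e [_ He] Hx _. 
    specialize (H x (Rlt_le_trans _ _ _ Hx (Rmin_l _ _))).
    pose proof (Rmin_r d (Cmod (g q - v) / 2)).
    pose proof (Cmod_sub_tri (g q) (g x) v). rewrite (Cmod_sub_sym (g q) (g x)) in *. lra.
  - destruct (Hv d Hd) as [x [Ax Hx]].
    specialize (H x x Ax). replace (x - x)%C with (RtoC 0) in H by ring.
    rewrite Cmod_0 in H. specialize (H Hd). lra.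
Qed.

(** The inverse of a continuous injection on a compact set is uniformly continuous. Compactness
    enters twice: in [q] for fixed [p], then in [p]. *)
Lemma uniform_injectivity (A : C -> Prop) (g : C -> C) :
  lebesgue_compact A -> (forall x, A x -> continuous_C g x) -> injective_on A g ->
  forall e, 0 < e -> exists d, 0 < d /\
  forall p q, A p -> A q -> Cmod (g p - g q) < d -> Cmod (p - q) < e.
Proof.
  intros HA Hg Hi e He.
  assert (Hpt : forall p, A p -> exists d, 0 < d /\
     forall q, A q -> Cmod (g q - g p) < d -> Cmod (q - p) < e / 2).
  { intros p Ap.
    destruct (uniform_on_compact A
      (fun d x _ => Cmod (g x - g p) < d -> Cmod (x - p) < e / 2) HA) as [d [Hd H]].
    - intros q Aq. destruct (classic (q = p)) as [-> | Hqp].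
      + exists (e / 2). split; [lra|]. auto.
      + assert (Hpos : 0 < Cmod (g q - g p)).
        { apply Cmod_gt_0. intro E. apply Hqp, Hi; auto. apply Ceq_minus. exact E. }
        destruct (Hg q Aq (Cmod (g q - g p) / 2)) as [d [Hd H]]; [lra|].
        exists (Rmin d (Cmod (g q - g p) / 2)). split; [apply Rmin_pos; lra|].
        intros x _ e' [_ He'] Hx _ Hlt. exfalso.
        specialize (H x (Rlt_le_trans _ _ _ Hx (Rmin_l _ _))).
        pose proof (Rmin_r d (Cmod (g q - g p) / 2)).
        pose proof (Cmod_sub_tri (g q) (g x) (g p)). rewrite (Cmod_sub_sym (g q) (g x)) in *. lra.
    - exists d. split; [exact Hd|]. intros q Aq. apply (H q q Aq).
      replace (q - q)%C with (RtoC 0) by ring. rewrite Cmod_0. exact Hd. }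
  destruct (uniform_on_compact A
    (fun d x _ => forall q, A q -> Cmod (g x - g q) < d -> Cmod (x - q) < e) HA) as [d [Hd H]].
  - intros p Ap. destruct (Hpt p Ap) as [d [Hd H]].
    destruct (Hg p Ap (d / 2)) as [d' [Hd' H']]; [lra|].
    pose (m := Rmin d' (Rmin (d / 2) (e / 2))).
    assert (m <= d') by apply Rmin_l.
    assert (m <= d / 2) by (eapply Rle_trans; [apply Rmin_r | apply Rmin_l]).
    assert (m <= e / 2) by (eapply Rle_trans; [apply Rmin_r | apply Rmin_r]).
    exists m. split; [repeat apply Rmin_pos; lra|].
    intros x _ e' [_ Hle] Hx _ q Aq Hxq.
    assert (Hxp : Cmod (g x - g p) < d / 2) by (apply H'; lra).
    assert (Hqp : Cmod (q - p) < e / 2).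
    { apply H; auto. pose proof (Cmod_sub_tri (g q) (g x) (g p)).
      rewrite (Cmod_sub_sym (g q) (g x)) in *. lra. }
    pose proof (Cmod_sub_tri x p q). rewrite (Cmod_sub_sym p q) in *. lra.
  - exists d. split; [exact Hd|]. intros p q Ap Aq.  apply (H p p Ap); auto.
    replace (p - p)%C with (RtoC 0) by ring. rewrite Cmod_0. exact Hd.
Qed.

(** * One step in the gate coordinate *)

Open Scope C_scope.
(** With [D = d^2], adding a lag [t] to [w] gives [(w + D t) / (1 - w t)], which equals
    [w + (w^2 + D) q] for [t = q / (1 + w q)]. Removing the lag [1] of the reference step leaves
    [g = (t - 1) / (1 + D t)], and this is added to [y]. The Moebius map itself is the case
    [g = 0]. *)
Lemma mobius_step_identity (D tau y q : C) :
  let w := (tau + D * y) / (1 - tau * y) in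
  let g := (q - 1 - w * q) / (1 + (w + D) * q) in
  let y' := (y + g) / (1 - D * y * g) in
  let tau' := (tau + D) / (1 - tau) in
  1 - tau * y <> 0 -> 1 - tau <> 0 -> 1 + (w + D) * q <> 0 -> 1 - D * y * g <> 0 ->
  (w + (w ^ 2 + D) * q) * (1 - tau' * y') = tau' + D * y'.
Proof.
  intros w g y' tau' H1 H2 H3 H4.
  assert (E1 : 1 + (w + D) * q = ((1 - tau * y) + (tau + D * y + D * (1 - tau*y)) * q) / (1 - tau * y)).
  { unfold w. field. exact H1. }
  assert (N1 : (1 - tau * y) + (tau + D * y + D * (1 - tau*y)) * q <> 0).
  { intro E. apply H3. rewrite E1, E. field. exact H1. }
  assert (E2 : g = ((1-tau*y) * (q-1) - (tau+D*y) * q) / ((1 - tau * y) + (tau + D * y + D * (1 - tau*y)) * q)).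
  { unfold g. rewrite E1. unfold w. field. auto. }
  set (N := (1 - tau * y) + (tau + D * y + D * (1 - tau*y)) * q) in *.
  assert (E3 : 1 - D * y * g = (N - D * y * ((1-tau*y) * (q-1) - (tau+D*y) * q)) / N).
  { rewrite E2. field. auto. }
  assert (N2 : N - D * y * ((1-tau*y) * (q-1) - (tau+D*y) * q) <> 0).
  { intro E. apply H4. rewrite E3, E. field. auto. }
  assert (E4 : y' = (y * N + ((1-tau*y) * (q-1) - (tau+D*y) * q)) / (N - D * y * ((1-tau*y) * (q-1) - (tau+D*y) * q))).
  { unfold y'. rewrite E3, E2. field. auto. }
  rewrite E4. unfold tau', w. unfold N in *.
  field. auto.
Qed.

Open Scope R_scope.

Lemma Rabs_le_of_sq (t d r : R) : 0 < r -> r ^ 2 = t ^ 2 + d ^ 2 -> Rabs t <= r.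
Proof. intros. apply Rabs_le. nra. Qed.

Lemma Cmod_RtoC_sq (x : R) : Cmod (RtoC x ^ 2) = x ^ 2.
Proof. rewrite Cmod_pow, Cmod_R. apply pow2_abs. Qed.

Lemma Cmod_div_le (x y : C) (c X : R) :
  0 < c -> c <= Cmod y -> Cmod x <= X -> Cmod (x / y) <= X / c.
Proof.
  intros Hc Hy Hx. rewrite Cmod_div by (apply Cmod_pos_neq; lra).
  unfold Rdiv. apply Rmult_le_compat; auto using Cmod_ge_0.
  - left. apply Rinv_0_lt_compat. lra.
  - apply Rinv_le_contravar; lra.
Qed.

Lemma Cmod_one_sub (x : C) (c : R) : Cmod x <= c -> 1 - c <= Cmod (1 - x) <= 1 + c.
Proof.
  intros H. pose proof (Cmod_sub_le 1 x). pose proof (Cmod_lower 1 (1 - x)).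
  replace (1 - (1 - x))%C with x in * by ring. rewrite Cmod_1 in *. lra.
Qed.

Lemma Cmod_mult_le (x y : C) (X Y : R) :
  Cmod x <= X -> Cmod y <= Y -> Cmod (x * y) <= X * Y.
Proof. intros. rewrite Cmod_mult. apply Rmult_le_compat; auto using Cmod_ge_0. Qed.

Lemma Cmod_plus_le (x y : C) (X Y : R) :
  Cmod x <= X -> Cmod y <= Y -> Cmod (x + y) <= X + Y.
Proof. intros. pose proof (Cmod_triangle x y). lra. Qed.

Lemma Cmod_minus_le (x y : C) (X Y : R) :
  Cmod x <= X -> Cmod y <= Y -> Cmod (x - y) <= X + Y.
Proof. intros. pose proof (Cmod_sub_le x y). lra. Qed.

(** The bounds rest on the closed form [w^2 + d^2 = rho^2 (1 + d^2 y^2) / (1 - tau y)^2], an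
    identity between sums of two squares. The last three measure the cost of replacing [w] by [tau],
    its value at [y = 0]. *)
Lemma step_pieces (d tau rho : R) (y w : C) :
  0 < d -> 0 < rho -> rho ^ 2 = tau ^ 2 + d ^ 2 ->
  rho <= 1 / 4 -> rho * Cmod y <= 1 / 4 ->
  w = ((tau + d ^ 2 * y) / (1 - tau * y))%C ->
  (1 - tau * y <> 0)%C /\ 3 / 4 <= Cmod (1 - tau * y) /\
  Cmod w <= 2 * rho /\ 
  3 / 5 * rho ^ 2 <= Cmod (w ^ 2 + d ^ 2) /\
  Cmod (w - tau) <= 4 / 3 * (Cmod y * rho ^ 2) /\
  Cmod (w / (w ^ 2 + d ^ 2) - tau / rho ^ 2) <= 2 * Cmod y /\
  Cmod (1 / (w ^ 2 + d ^ 2) - 1 / rho ^ 2) <= 4 * (Cmod y / rho).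
Proof.
  intros Hd Hr Hrho Hr4 Hy Hw.
  set (Y := Cmod y) in *. assert (HY : 0 <= Y) by apply Cmod_ge_0.
  assert (Ht : Rabs tau <= rho) by (exact (Rabs_le_of_sq _ _ _ Hr Hrho)).
  assert (Hdr : d <= rho) by nra.
  assert (Hty : Cmod (tau * y) <= 1 / 4).
  { rewrite Cmod_mult, Cmod_R. fold Y. apply Rle_trans with (rho * Y); [|lra].
    apply Rmult_le_compat_r; auto. }
  destruct (Cmod_one_sub _ _ Hty) as [Hb1 Hb2].
  set (b := (1 - tau * y)%C) in *.
  assert (Hb0 : b <> 0%C) by (apply Cmod_pos_neq; lra).
  assert (Hrc : (RtoC rho ^ 2 = tau ^ 2 + d ^ 2)%C).
  { rewrite <- !RtoC_pow, <- RtoC_plus, Hrho. reflexivity. }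
  assert (Hrc0 : (RtoC rho <> 0)%C).
  { intro E. apply RtoC_inj in E. lra. }
  set (k := (1 + d ^ 2 * y ^ 2)%C).
  assert (Hdy : d * Y <= 1 / 4) by nra.
  assert (Hdy0 : 0 <= d * Y) by nra.
  assert (Hry0 : 0 <= rho * Y) by nra.
  assert (Hk : Cmod (d ^ 2 * y ^ 2) <= 1 / 16).
  { rewrite Cmod_mult, Cmod_RtoC_sq, Cmod_pow. fold Y.
    replace (d ^ 2 * Y ^ 2) with ((d * Y) * (d * Y)) by ring. nra. }
  assert (Hk1 : 15 / 16 <= Cmod k).
  { pose proof (Cmod_one_sub (- (d ^ 2 * y ^ 2))%C (1 / 16)) as H.
    rewrite Cmod_opp in H. specialize (H Hk).
    replace (1 - - (d ^ 2 * y ^ 2))%C with k in H by (unfold k; ring). lra. }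
  assert (Hk0 : k <> 0%C) by (apply Cmod_pos_neq; lra).
  assert (Hwb : (w * b = tau + d ^ 2 * y)%C) by (rewrite Hw; field; auto).
  assert (HP : (w ^ 2 + d ^ 2 = rho ^ 2 * k / b ^ 2)%C).
  { rewrite Hw, Hrc. unfold k. fold b. 
    replace ((tau ^ 2 + d ^ 2) * (1 + d ^ 2 * y ^ 2))%C
      with ((tau + d ^ 2 * y) ^ 2 + d ^ 2 * b ^ 2)%C by (unfold b; ring).
    field. auto. }
  assert (Hrm : Cmod (RtoC rho ^ 2) = rho ^ 2) by apply Cmod_RtoC_sq.
  split; [exact Hb0|]. split; [lra|].
  split.
  { rewrite Hw. fold b. eapply Rle_trans.
    - apply (Cmod_div_le _ b (3 / 4) (rho + rho * (rho * Y))); try lra.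
      apply Cmod_plus_le; [rewrite Cmod_R; exact Ht|].
      rewrite Cmod_mult, Cmod_RtoC_sq. fold Y. nra.
    - nra. }
  split.
  { rewrite HP. rewrite Cmod_div, Cmod_mult, Hrm, Cmod_pow by (apply Cpow_nz; auto).
    assert (HB : Cmod b ^ 2 <= 25 / 16) by nra.
    assert (HB' : 0 < Cmod b ^ 2) by nra.
    apply Rmult_le_reg_r with (Cmod b ^ 2); [lra|].
    replace (rho ^ 2 * Cmod k / Cmod b ^ 2 * Cmod b ^ 2) with (rho ^ 2 * Cmod k) by (field; lra).
    assert (0 < rho ^ 2) by nra. nra. }
  split.
  { replace (w - tau)%C with ((y * rho ^ 2) / b)%C.
    - eapply Rle_trans; [apply (Cmod_div_le _ b (3 / 4) (Y * rho ^ 2)); try lra|lra].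
      rewrite Cmod_mult, Hrm. apply Rle_refl.
    - rewrite Hrc, Hw. fold b.
      assert (E : (y * (tau ^ 2 + d ^ 2) = tau + d ^ 2 * y - tau * b)%C) by (unfold b; ring).
      rewrite E. field. exact Hb0. }
  assert (Hd2 : d ^ 2 <= rho ^ 2) by nra.
  assert (H2r : 0 < rho ^ 2) by nra.
  assert (Hden : 15 / 16 * rho ^ 2 <= Cmod (rho ^ 2 * k)).
  { rewrite Cmod_mult, Hrm. nra. }
  split.
  { replace (w / (w ^ 2 + d ^ 2) - tau / rho ^ 2)%C with
      (((d ^ 2 - tau ^ 2) * y - 2 * d ^ 2 * tau * y ^ 2) / (rho ^ 2 * k))%C.
    - eapply Rle_trans; [apply (Cmod_div_le _ _ (15 / 16 * rho ^ 2) (3 / 2 * (rho ^ 2 * Y))); auto; try nra|].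
      + apply Rle_trans with (rho ^ 2 * Y + 1 / 2 * (rho ^ 2 * Y)); [|lra]. apply Cmod_minus_le.
        * rewrite Cmod_mult. fold Y. apply Rmult_le_compat_r; [exact HY|].
          rewrite <- !RtoC_pow, <- RtoC_minus, Cmod_R. apply Rabs_le. nra.
        * rewrite !Cmod_mult, Cmod_RtoC_sq, Cmod_pow, !Cmod_R. fold Y.
          rewrite (Rabs_right 2) by lra.
          apply Rle_trans with (2 * rho ^ 2 * rho * Y ^ 2);
            [|assert (0 <= rho ^ 2 * Y) by (apply Rmult_le_pos; lra);
              replace (2 * rho ^ 2 * rho * Y ^ 2) with (2 * (rho ^ 2 * Y * (rho * Y))) by ring; nra].
          apply Rmult_le_compat_r; [nra|]. apply Rmult_le_compat; try nra. apply Rabs_pos.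
      + replace (3 / 2 * (rho ^ 2 * Y) / (15 / 16 * rho ^ 2)) with (8 / 5 * Y) by (field; lra). lra.
    - rewrite HP, Hw. fold b.
      assert (E : ((d ^ 2 - tau ^ 2) * y - 2 * d ^ 2 * tau * y ^ 2 = (tau + d ^ 2 * y) * b - tau * k)%C)
        by (unfold b, k; ring).
      rewrite E. field. auto. }
  { replace (1 / (w ^ 2 + d ^ 2) - 1 / rho ^ 2)%C with
      ((- (2 * tau * y) + tau ^ 2 * y ^ 2 - d ^ 2 * y ^ 2) / (rho ^ 2 * k))%C.
    - eapply Rle_trans; [apply (Cmod_div_le _ _ (15 / 16 * rho ^ 2) (3 * (rho * Y))); auto; try nra|].
      + apply Rle_trans with (2 * (rho * Y) + (rho * Y) * (rho * Y) + (rho * Y) * (rho * Y)); [|nra].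
        apply Cmod_minus_le; [apply Cmod_plus_le|].
        * rewrite Cmod_opp, !Cmod_mult, !Cmod_R, (Rabs_right 2) by lra. fold Y.
          rewrite Rmult_assoc. apply Rmult_le_compat_l; [lra|]. apply Rmult_le_compat_r; auto.
        * rewrite Cmod_mult, Cmod_RtoC_sq, Cmod_pow. fold Y.
          replace (tau ^ 2 * Y ^ 2) with (tau ^ 2 * (Y * Y)) by ring.
          replace (rho * Y * (rho * Y)) with (rho ^ 2 * (Y * Y)) by ring.
          apply Rmult_le_compat_r; nra.
        * rewrite Cmod_mult, Cmod_RtoC_sq, Cmod_pow. fold Y.
          replace (d ^ 2 * Y ^ 2) with (d ^ 2 * (Y * Y)) by ring.
          replace (rho * Y * (rho * Y)) with (rho ^ 2 * (Y * Y)) by ring.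
          apply Rmult_le_compat_r; nra.
      + replace (3 * (rho * Y) / (15 / 16 * rho ^ 2)) with (16 / 5 * (Y / rho)) by (field; lra).
        assert (0 <= Y / rho) by (apply Rdiv_le_0_compat; lra). lra.
    - rewrite HP.
      assert (E : (- (2 * tau * y) + tau ^ 2 * y ^ 2 - d ^ 2 * y ^ 2 = b ^ 2 - k)%C)
        by (unfold b, k; ring).
      rewrite E. field. auto. }
Qed.

(** [chi] is the relative excess of the added term over [d^2]. When the step is written as
    [w + (w^2 + d^2) (1 + e)], the lag increment is [e - w] to first order, and the asserted main
    term is [e - w] at [y = 0] without the remainder of [f]. The smallness of [rho (1 + |y|)] keeps
    all denominators away from zero. *)
Lemma passage_step (a : C) (M Cx : R) : 0 <= M -> 0 <= Cx ->
  exists c0 A, 0 < c0 <= 1 / 4 /\ 0 < A /\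
  forall (d tau rho : R) (y w fw chi : C),
  0 < d -> 0 < rho -> rho ^ 2 = tau ^ 2 + d ^ 2 -> rho * (1 + Cmod y) <= c0 ->
  w = ((tau + d ^ 2 * y) / (1 - tau * y))%C ->
  Cmod (fw - (w + w ^ 2 + a * w ^ 3)) <= M * Cmod w ^ 4 ->
  Cmod chi <= Cx * d ->
  let tau' := ((tau + d ^ 2) / (1 - tau))%C in
  exists y' : C, (1 - tau' * y' <> 0)%C /\
    (fw + d ^ 2 + d ^ 2 * chi = (tau' + d ^ 2 * y') / (1 - tau' * y'))%C /\
    Cmod (y' - y - ((a - 1) * tau - a * d ^ 2 * (tau / rho ^ 2) + chi * (d ^ 2 / rho ^ 2)))
      <= A * ((1 + Cmod y) * rho ^ 2).
Proof.
  intros HM HCx. 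
  set (Ca := Cmod a). assert (HCa : 0 <= Ca) by apply Cmod_ge_0.
  (* [Ce] and [Cg] will bound [e / rho] and [g / rho]. The factor [27] exceeds
     [2^4 / (3 / 5) = 80 / 3], which comes from [|w| <= 2 rho] and [|w^2 + d^2| >= 3 / 5 rho^2]. *)
  set (Ce := 6 * Ca + 27 * M + 2 * Cx). set (Cg := 2 * Ce + 8).
  assert (HCe : 0 <= Ce) by (unfold Ce; lra).
  assert (HCg : 8 <= Cg) by (unfold Cg; lra).
  exists (/ (32 * (1 + Cg))), (16 * Ce + 24 + 2 * Cg + (Ca + 1) * (4 / 3) + 2 * Ca + 27 * M + 4 * Cx).
  assert (Hc0 : 0 < / (32 * (1 + Cg))) by (apply Rinv_0_lt_compat; lra).
  assert (Hc1 : / (32 * (1 + Cg)) * (32 * (1 + Cg)) = 1) by (field; lra).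
  set (c0 := / (32 * (1 + Cg))) in *.
  split; [nra|]. split; [lra|].
  intros d tau rho y w fw chi Hd Hr Hrho Hy Hw Hf Hchi tau'.
  set (Y := Cmod y) in *. assert (HY : 0 <= Y) by apply Cmod_ge_0.
  assert (HrY0 : 0 <= rho * Y) by nra.
  assert (HrY : rho * Y <= c0) by nra.
  assert (Hr0 : rho <= c0) by nra.
  assert (HcCg : Cg * c0 <= 1 / 32) by nra.
  assert (HcCe : Ce * c0 <= 1 / 64) by (unfold Cg in *; nra).
  assert (Hc3 : c0 <= 1 / 288) by nra.
  destruct (step_pieces d tau rho y w) as [Hb0 [Hb [Hw2 [HP [Hwt [HwP HiP]]]]]]; auto; try (fold Y; lra).
  fold Y in HwP, HiP, Hwt.
  set (P := (w ^ 2 + d ^ 2)%C) in *.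
  assert (H2r : 0 < rho ^ 2) by nra.
  assert (HP0 : P <> 0%C) by (apply Cmod_pos_neq; lra).
  assert (Hdr : d <= rho) by nra.
  assert (Hd2 : d ^ 2 <= rho ^ 2) by nra.
  assert (Hr2r : rho ^ 2 <= rho) by nra.
  assert (HW0 : 0 <= Cmod w) by apply Cmod_ge_0.
  assert (Hrc0 : (RtoC rho <> 0)%C) by (intro E; apply RtoC_inj in E; lra).
  set (rem := (fw - (w + w ^ 2 + a * w ^ 3))%C) in *.
  assert (Hrem : Cmod (rem / P) <= 27 * M * rho ^ 2).
  { eapply Rle_trans; [apply (Cmod_div_le _ _ (3 / 5 * rho ^ 2) (M * (2 * rho) ^ 4)); auto; try lra|].
    - eapply Rle_trans; [exact Hf|]. apply Rmult_le_compat_l; [lra|]. apply pow_incr. lra.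
    - replace (M * (2 * rho) ^ 4 / (3 / 5 * rho ^ 2)) with (80 / 3 * (M * rho ^ 2)) by (field; lra).
      assert (0 <= M * rho ^ 2) by nra. lra. }
  (* The cubic term is divided by [P] through [w^3 = w P - d^2 w], which produces the two drift
     terms. *)
  set (e := (a * w - a * d ^ 2 * (w / P) + rem / P + chi * (d ^ 2 * (1 / P)))%C).
  assert (HeE : (P * e = a * w ^ 3 + rem + d ^ 2 * chi)%C).
  { unfold e. replace (a * w ^ 3)%C with (a * w * P - a * d ^ 2 * w)%C by (unfold P; ring).
    field. exact HP0. }
  assert (HwP1 : Cmod (w / P) <= 10 / 3 * / rho).
  { eapply Rle_trans; [apply (Cmod_div_le _ _ (3 / 5 * rho ^ 2) (2 * rho)); auto; lra|].
    right. field. lra. }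
  assert (HiP1 : Cmod (d ^ 2 * (1 / P)) <= 5 / 3).
  { rewrite Cmod_mult, Cmod_RtoC_sq.
    apply Rle_trans with (d ^ 2 * (1 / (3 / 5 * rho ^ 2))).
    - apply Rmult_le_compat_l; [nra|]. apply Cmod_div_le; try lra. rewrite Cmod_1; lra.
    - apply Rmult_le_reg_r with (3 / 5 * rho ^ 2); [lra|].
      replace (d ^ 2 * (1 / (3 / 5 * rho ^ 2)) * (3 / 5 * rho ^ 2)) with (d ^ 2) by (field; lra). lra. }
  assert (He : Cmod e <= Ce * rho).
  { unfold e. apply Rle_trans with (Ca * (2 * rho) + Ca * (10 / 3 * rho) + 27 * M * rho ^ 2 + Cx * rho * (5 / 3)).
    - apply Cmod_plus_le; [apply Cmod_plus_le; [apply Cmod_minus_le|]|].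
      + apply Cmod_mult_le; [apply Rle_refl | lra].
      + rewrite !Cmod_mult, Cmod_RtoC_sq. fold Ca. rewrite Rmult_assoc.
        apply Rmult_le_compat_l; [lra|].
        apply Rle_trans with (rho ^ 2 * (10 / 3 * / rho)).
        * apply Rmult_le_compat; auto using Cmod_ge_0. nra.
        * right. field. lra.
      + exact Hrem.
      + apply Cmod_mult_le; [|exact HiP1]. nra.
    - unfold Ce. assert (M * rho ^ 2 <= M * rho) by nra.
      assert (0 <= Ca * rho) by nra. assert (0 <= Cx * rho) by nra. lra. }
  set (q := (1 + e)%C).
  assert (He1 : Cmod e <= 1 / 64) by nra.
  assert (Hq : Cmod q <= 65 / 64).
  { unfold q. replace (65/64) with (1 + 1/64) by lra. apply Cmod_plus_le; auto. rewrite Cmod_1; lra. }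
  assert (Hwd : Cmod ((w + d ^ 2) * q) <= 4 * rho).
  { apply Rle_trans with ((2 * rho + rho) * (65 / 64)); [|lra].
    apply Cmod_mult_le; auto. apply Cmod_plus_le; auto. rewrite Cmod_RtoC_sq. lra. }
  assert (Hden1 : 1 / 2 <= Cmod (1 + (w + d ^ 2) * q)).
  { pose proof (Cmod_one_sub (- ((w + d ^ 2) * q))%C (4 * rho)) as H.
    rewrite Cmod_opp in H. specialize (H Hwd).
    replace (1 - - ((w + d ^ 2) * q))%C with (1 + (w + d ^ 2) * q)%C in H by ring. lra. }
  assert (Hden10 : (1 + (w + d ^ 2) * q <> 0)%C) by (apply Cmod_pos_neq; lra).
  set (g := ((q - 1 - w * q) / (1 + (w + d ^ 2) * q))%C).
  assert (Hnum : Cmod (q - 1 - w * q) <= (Ce + 4) * rho).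
  { replace (q - 1)%C with e by (unfold q; ring).
    apply Rle_trans with (Ce * rho + 2 * rho * (65/64)); [|lra].
    apply Cmod_minus_le; auto. apply Cmod_mult_le; auto. }
  assert (Hg : Cmod g <= Cg * rho).
  { unfold g. eapply Rle_trans; [apply (Cmod_div_le _ _ (1 / 2) ((Ce + 4) * rho)); auto; lra|].
    unfold Cg. lra. }
  assert (Hgew : Cmod (g - (e - w)) <= (16 * Ce + 24) * rho ^ 2).
  { replace (g - (e - w))%C with
     ((- (w * e) - (e - w) * ((w + d ^ 2) * q)) / (1 + (w + d ^ 2) * q))%C
     by (unfold g, q in *; field; auto).
    eapply Rle_trans; [apply (Cmod_div_le _ _ (1 / 2) (2 * rho * (Ce * rho) + (Ce * rho + 2 * rho) * (4 * rho))); auto; try lra|].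
    - apply Cmod_minus_le; [rewrite Cmod_opp|]; apply Cmod_mult_le; auto. apply Cmod_minus_le; auto.
    - assert (0 <= Ce * rho ^ 2) by nra.
      replace ((2 * rho * (Ce * rho) + (Ce * rho + 2 * rho) * (4 * rho)) / (1 / 2)) with
       (12 * (Ce * rho ^ 2) + 16 * rho ^ 2) by field. lra. }
  assert (Hg1 : Cmod g <= 1 / 32) by nra.
  assert (Hdyg : Cmod (d ^ 2 * y * g) <= 1 / 2).
  { rewrite !Cmod_mult, Cmod_RtoC_sq. fold Y.
    apply Rle_trans with (1 * (1/32)); [|lra]. apply Rmult_le_compat; auto using Cmod_ge_0.
    - apply Rmult_le_pos; nra.
    - apply Rle_trans with (rho ^ 2 * Y); [apply Rmult_le_compat_r; lra|].
      replace (rho ^ 2 * Y) with (rho * (rho * Y)) by ring. nra. }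
  destruct (Cmod_one_sub _ _ Hdyg) as [Hden2 _].
  assert (Hden20 : (1 - d ^ 2 * y * g <> 0)%C) by (apply Cmod_pos_neq; lra).
  set (y' := ((y + g) / (1 - d ^ 2 * y * g))%C).
  assert (Hyg : Cmod (y' - y - g) <= 2 * Cg * (Y * rho ^ 2)).
  { replace (y' - y - g)%C with ((g * d ^ 2 * y * (y + g)) / (1 - d ^ 2 * y * g))%C
      by (unfold y'; field; auto).
    eapply Rle_trans; [apply (Cmod_div_le _ _ (1 / 2) (Cg * rho * rho ^ 2 * Y * (Y + Cg * rho))); auto; try lra|].
    - apply Cmod_mult_le; [apply Cmod_mult_le; [apply Cmod_mult_le|]|]; auto; try apply Rle_refl.
      + rewrite Cmod_RtoC_sq. exact Hd2.
      + apply Cmod_plus_le; auto. apply Rle_refl.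
    - replace (Cg * rho * rho ^ 2 * Y * (Y + Cg * rho) / (1 / 2)) with
       (2 * Cg * (Y * rho ^ 2) * (rho * Y + Cg * rho * rho)) by field.
      rewrite <- (Rmult_1_r (2 * Cg * (Y * rho ^ 2))) at 2.
      apply Rmult_le_compat_l; [|nra].
      apply Rmult_le_pos; [lra|]. apply Rmult_le_pos; lra. }
  assert (Ht : Rabs tau <= rho) by (exact (Rabs_le_of_sq _ _ _ Hr Hrho)).
  assert (Hty : Cmod (RtoC tau) <= 1 / 4) by (rewrite Cmod_R; lra).
  destruct (Cmod_one_sub _ _ Hty) as [Hden3 _].
  assert (Hden30 : (1 - tau <> 0)%C) by (apply Cmod_pos_neq; lra).
  assert (Htau' : Cmod tau' <= 3 * rho).
  { unfold tau'. eapply Rle_trans; [apply (Cmod_div_le _ _ (3 / 4) (2 * rho)); try lra|lra].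
    replace (2 * rho) with (rho + rho) by ring. apply Cmod_plus_le; [rewrite Cmod_R; auto|].
    rewrite Cmod_RtoC_sq. lra. }
  assert (Hy' : Cmod y' <= Y + Cg * rho + 2 * Cg * (Y * rho ^ 2)).
  { replace y' with (y + g + (y' - y - g))%C by ring.
    apply Cmod_plus_le; auto. apply Cmod_plus_le; auto. apply Rle_refl. }
  assert (Hty' : Cmod (tau' * y') <= 1 / 2).
  { apply Rle_trans with (3 * rho * (Y + Cg * rho + 2 * Cg * (Y * rho ^ 2))).
    - apply Cmod_mult_le; auto.
    - assert (H0 : 0 <= Cg * rho) by (apply Rmult_le_pos; lra).
      assert (H1 : Cg * rho <= 1 / 32).
      { apply Rle_trans with (Cg * c0); auto. apply Rmult_le_compat_l; lra. }
      assert (H2 : 0 <= Cg * rho * rho) by (apply Rmult_le_pos; lra).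
      assert (H3 : Cg * rho * rho <= 1 / 32).
      { rewrite <- (Rmult_1_r (1 / 32)). apply Rmult_le_compat; lra. }
      assert (H4 : Cg * rho * rho * (rho * Y) <= 1 / 32).
      { rewrite <- (Rmult_1_r (1 / 32)). apply Rmult_le_compat; lra. }
      replace (3 * rho * (Y + Cg * rho + 2 * Cg * (Y * rho ^ 2))) with
        (3 * (rho * Y) + 3 * (Cg * rho * rho) + 6 * (Cg * rho * rho * (rho * Y))) by ring. lra. }
  destruct (Cmod_one_sub _ _ Hty') as [Hden4 _].
  assert (Hden40 : (1 - tau' * y' <> 0)%C) by (apply Cmod_pos_neq; lra).
  exists y'. split; [exact Hden40|]. split.
  - pose proof (mobius_step_identity (d ^ 2)%C tau y q) as Hid. cbv zeta in Hid.
    rewrite <- Hw in Hid. fold P in Hid. fold g in Hid. fold y' tau' in Hid.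
    rewrite <- Hid by auto.
    assert (E : (fw + d ^ 2 + d ^ 2 * chi = w + P * q)%C).
    { unfold q. replace (P * (1 + e))%C with (P + P * e)%C by ring. rewrite HeE. unfold P, rem. ring. }
    rewrite E. field. exact Hden40.
  (* Three sources of error: the nonlinearity of adding lags, the second-order part of [g], and the
     change from [w] to [tau] together with the remainder of [f]. *)
  - replace (y' - y - ((a - 1) * tau - a * d ^ 2 * (tau / rho ^ 2) + chi * (d ^ 2 / rho ^ 2)))%C
     with ((y' - y - g) + (g - (e - w)) + ((a - 1) * (w - tau)
            - a * d ^ 2 * (w / P - tau / rho ^ 2) + rem / P
            + chi * d ^ 2 * (1 / P - 1 / rho ^ 2)))%C
     by (unfold e; field; auto).
    apply Rle_trans with (2 * Cg * (Y * rho ^ 2) + (16 * Ce + 24) * rho ^ 2 +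
      ((Ca + 1) * (4 / 3 * (Y * rho ^ 2)) + Ca * rho ^ 2 * (2 * Y) + 27 * M * rho ^ 2
        + Cx * rho * rho ^ 2 * (4 * (Y / rho)))).
    + apply Cmod_plus_le; [apply Cmod_plus_le; auto|].
      apply Cmod_plus_le; [apply Cmod_plus_le; auto; apply Cmod_minus_le|].
      * apply Cmod_mult_le; auto. apply Cmod_minus_le; [apply Rle_refl | rewrite Cmod_1; lra].
      * apply Cmod_mult_le; auto. apply Cmod_mult_le; [apply Rle_refl | rewrite Cmod_RtoC_sq; auto].
      * apply Cmod_mult_le; auto. apply Cmod_mult_le; [|rewrite Cmod_RtoC_sq; auto].
        eapply Rle_trans; [exact Hchi|]. apply Rmult_le_compat_l; auto.
    + replace (Cx * rho * rho ^ 2 * (4 * (Y / rho))) with (4 * Cx * (Y * rho ^ 2)) by (field; lra).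
      assert (HYr : 0 <= Y * rho ^ 2) by (apply Rmult_le_pos; lra).
      set (u := Y * rho ^ 2) in *. set (v := rho ^ 2) in *.
      replace ((1 + Y) * v) with (v + u) by (unfold u, v; ring).
      replace (Ca * v * (2 * Y)) with (2 * (Ca * u)) by (unfold u, v; ring).
      assert (0 <= Cg * v) by (apply Rmult_le_pos; lra).
      assert (0 <= Ce * u) by (apply Rmult_le_pos; lra).
      assert (0 <= Ca * v) by (apply Rmult_le_pos; lra).
      assert (0 <= M * u) by (apply Rmult_le_pos; lra).
      assert (0 <= Cx * v) by (apply Rmult_le_pos; lra). lra.
Qed.

(** * The reference orbit *)

Lemma eventually_div_lt (c e : R) : 0 < e -> eventually (fun n => c / INR n < e).
Proof.
  intros He. exists (S (Z.to_nat (up (Rabs c / e)))). intros n Hn.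
  assert (Hup : Rabs c / e < INR n).
  { destruct (archimed (Rabs c / e)) as [H _]. eapply Rlt_le_trans; [apply H|].
    rewrite INR_IZR_INZ. apply IZR_le. lia. }
  assert (0 <= Rabs c / e) by (apply Rdiv_le_0_compat; [apply Rabs_pos | lra]).
  apply Rmult_lt_reg_r with (INR n); [lra|].
  replace (c / INR n * INR n) with c by (field; lra).
  apply Rmult_lt_compat_l with (r := e) in Hup; [|lra].
  replace (e * (Rabs c / e)) with (Rabs c) in Hup by (field; lra).
  pose proof (Rle_abs c). lra.
Qed.

Lemma eventually_inv_Rpower (c e alpha : R) :
  0 < alpha -> 0 < e -> eventually (fun n => c / Rpower (INR n) alpha < e).
Proof.
  intros Ha He.
  set (X := Rabs c / e + 1).
  assert (HX : 0 < X).
  { assert (0 <= Rabs c / e) by (apply Rdiv_le_0_compat; [apply Rabs_pos | lra]). unfold X. lra. }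
  destruct (eventually_div_lt 1 (/ Rpower X (/ alpha))) as [N HN].
  { apply Rinv_0_lt_compat, exp_pos. }
  exists (S N). intros n Hn. specialize (HN n ltac:(lia)).
  assert (Hn0 : 0 < INR n) by (apply lt_0_INR; lia).
  assert (Hlt : Rpower X (/ alpha) < INR n).
  { apply Rinv_lt_cancel; [exact Hn0|]. unfold Rdiv in HN. lra. }
  assert (HXn : X < Rpower (INR n) alpha).
  { rewrite <- (Rpower_1 X) by exact HX. replace 1 with (/ alpha * alpha) by (field; lra).
    rewrite <- Rpower_mult. apply Rlt_Rpower_l; [exact Ha|]. split; [apply exp_pos | exact Hlt]. }
  apply Rmult_lt_reg_r with (Rpower (INR n) alpha); [lra|].
  replace (c / Rpower (INR n) alpha * Rpower (INR n) alpha) with c by (field; lra).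
  apply Rmult_lt_compat_l with (r := e) in HXn; [|lra].
  unfold X in HXn. replace (e * (Rabs c / e + 1)) with (Rabs c + e) in HXn by (field; lra).
  pose proof (Rle_abs c). lra.
Qed.

Lemma cos_lower (x : R) : 1 - x ^ 2 / 2 <= cos x.
Proof.
  assert (H : forall t, 0 <= t -> 1 - t ^ 2 / 2 <= cos t).
  { intros t Ht. replace t with (2 * (t / 2)) at 2 by field. rewrite cos_2a_sin.
    assert (Hs : Rabs (sin (t / 2)) <= t / 2).
    { destruct (Req_dec t 0) as [-> | Hne].
      - replace (0 / 2) with 0 by field. rewrite sin_0, Rabs_R0. lra.
      - destruct (Rle_dec (t / 2) 1) as [H1 | H1].
        + assert (0 <= sin (t / 2)).
          { apply sin_ge_0; [lra|]. pose proof PI2_1. lra. }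
          rewrite Rabs_right by lra. left. apply sin_lt_x. lra.
        + pose proof (SIN_bound (t / 2)). apply Rabs_le. lra. }
    apply Rabs_le_between in Hs. nra. }
  destruct (Rle_dec 0 x) as [Hx | Hx]; [auto|].
  rewrite <- cos_neg. replace (x ^ 2) with ((- x) ^ 2) by ring. apply H. lra.
Qed.

Lemma x_cos_le_sin (x : R) : 0 <= x <= PI -> x * cos x <= sin x.
Proof.
  intros [H0 Hpi]. destruct (Req_dec x 0) as [-> | Hne].
  - rewrite sin_0. lra.
  - destruct (MVT_cor2 (fun t => sin t - t * cos t) (fun t => t * sin t) 0 x) as [c [Hc1 Hc2]].
    + lra.
    + intros c _. replace (c * sin c) with (cos c - (1 * cos c + c * (- sin c))) by ring.
      apply derivable_pt_lim_minus; [apply derivable_pt_lim_sin|].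
      apply (derivable_pt_lim_mult (fun t => t) cos); [apply derivable_pt_lim_id | apply derivable_pt_lim_cos].
    + rewrite sin_0 in Hc1. assert (0 <= sin c) by (apply sin_ge_0; lra).
      assert (0 <= c * sin c * (x - 0)) by (repeat apply Rmult_le_pos; lra). lra.
Qed.

Lemma sin_half_lower (x : R) : 0 <= x <= PI / 2 -> x / 2 <= sin x.
Proof.
  intros Hx. replace x with (2 * (x / 2)) at 2 by field. rewrite sin_2a.
  pose proof (x_cos_le_sin (x / 2)) as H. 
  assert (Hc : 0 <= cos (x / 2)) by (apply cos_ge_0; lra).
  assert (Hcc : 1 / 2 <= cos (x / 2) * cos (x / 2)).
  { assert (0 <= cos x) by (apply cos_ge_0; lra).
    replace x with (2 * (x / 2)) in H0 by field. rewrite cos_2a_cos in H0. lra. }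
  assert (x / 2 * cos (x / 2) * cos (x / 2) <= sin (x / 2) * cos (x / 2)).
  { apply Rmult_le_compat_r; auto. apply H. lra. }
  assert (x / 2 * (1 / 2) <= x / 2 * (cos (x / 2) * cos (x / 2))).
  { apply Rmult_le_compat_l; lra. }
  lra.
Qed.

Lemma sin_sq_lipschitz (x y : R) : Rabs (sin x ^ 2 - sin y ^ 2) <= 2 * Rabs (x - y).
Proof.
  assert (H : Rabs (sin x - sin y) <= Rabs (x - y)).
  { rewrite form4, !Rabs_mult, (Rabs_right 2) by lra.
    assert (Hs : forall t, Rabs (sin t) <= Rabs t).
    { assert (Hp : forall t, 0 <= t -> Rabs (sin t) <= t).
      { intros t Ht. destruct (Req_dec t 0) as [-> | Hne]; [rewrite sin_0, Rabs_R0; lra|].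
        destruct (Rle_dec t 1) as [H1 | H1].
        - assert (0 <= sin t) by (apply sin_ge_0; [lra|]; pose proof PI2_1; lra).
          rewrite Rabs_right by lra. left. apply sin_lt_x. lra.
        - pose proof (SIN_bound t). apply Rabs_le. lra. }
      intros t. destruct (Rle_dec 0 t).
      - rewrite (Rabs_right t) by lra. auto.
      - rewrite (Rabs_left t) by lra. rewrite <- (Rabs_Ropp (sin t)), <- sin_neg. apply Hp. lra. }
    specialize (Hs ((x - y) / 2)). unfold Rdiv in Hs at 2.
    rewrite (Rabs_mult (x - y)), (Rabs_right (/ 2)) in Hs by lra.
    assert (Rabs (cos ((x + y) / 2)) <= 1).
    { apply Rabs_le. apply COS_bound. }
    assert (2 * Rabs (cos ((x + y) / 2)) * Rabs (sin ((x - y) / 2)) <= 2 * 1 * (Rabs (x - y) * / 2)).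
    { apply Rmult_le_compat; auto using Rabs_pos; [|lra].
      apply Rmult_le_pos; [lra | apply Rabs_pos]. }
    lra. }
  replace (sin x ^ 2 - sin y ^ 2) with ((sin x + sin y) * (sin x - sin y)) by ring.
  rewrite Rabs_mult. apply Rmult_le_compat; auto using Rabs_pos.
  apply Rabs_le. pose proof (SIN_bound x). pose proof (SIN_bound y). lra.
Qed.

(** With [tan (PI / n)] instead of [PI / n] the recurrence [gate_point_succ] is exact. *)
Definition gate_width (n : nat) : R := tan (PI / INR n).
(** Bracketed as the argument of the sine in [G], so that [G] at [(k + 1) / n] is twice the squared
    sine of the angle at [S k] by conversion. *)
Definition gate_angle (n k : nat) : R := PI * (INR k / INR n).
Definition gate_point (n k : nat) : R :=
  - gate_width n * (cos (gate_angle n k) / sin (gate_angle n k)).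
Definition gate_scale (n k : nat) : R := gate_width n / sin (gate_angle n k).

Lemma INR_ge_3 (n : nat) : (3 <= n)%nat -> 3 <= INR n.
Proof. intros H. apply le_INR in H. simpl in H. lra. Qed.

Lemma gate_mesh_bounds (n : nat) : (3 <= n)%nat -> 0 < PI / INR n <= PI / 3.
Proof.
  intros Hn. apply INR_ge_3 in Hn. pose proof PI_RGT_0. split.
  - apply Rdiv_lt_0_compat; lra.
  - apply Rmult_le_compat_l; [lra|]. apply Rinv_le_contravar; lra.
Qed.

(** The cubic bound on [tan x - x] makes [d^2] and [(PI / n)^2] agree up to a relative error
    [O(1 / n^2)], negligible against the terms of order [1 / n] that build the phase. This is why
    [d] may replace [PI / n]. *)
Lemma gate_width_bounds (n : nat) : (3 <= n)%nat ->
  PI / INR n <= gate_width n <= 2 * (PI / INR n) /\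
  gate_width n - PI / INR n <= (PI / INR n) ^ 3.
Proof.
  intros Hn. destruct (gate_mesh_bounds n Hn) as [H0 H3]. set (x := PI / INR n) in *.
  pose proof PI_RGT_0.
  assert (Hc : 1 / 2 <= cos x).
  { rewrite <- cos_PI3. apply cos_decr_1; lra. }
  pose proof (x_cos_le_sin x ltac:(lra)) as Hs. pose proof (sin_lt_x x H0) as Hs2.
  unfold gate_width. fold x. unfold tan.
  assert (Hu : sin x / cos x <= x / cos x).
  { apply Rmult_le_compat_r; [left; apply Rinv_0_lt_compat; lra | lra]. }
  split; [split|].
  - apply Rmult_le_reg_r with (cos x); [lra|].
    replace (sin x / cos x * cos x) with (sin x) by (field; lra). lra.
  - eapply Rle_trans; [exact Hu|]. apply Rmult_le_reg_r with (cos x); [lra|].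
    replace (x / cos x * cos x) with x by (field; lra). nra.
  - assert (x / cos x <= x + x ^ 3).
    { apply Rmult_le_reg_r with (cos x); [lra|].
      replace (x / cos x * cos x) with x by (field; lra).
      pose proof (cos_lower x) as Hcl.
      assert (1 <= (1 + x ^ 2) * cos x).
      { assert (0 <= x ^ 2) by nra.
        assert (x ^ 2 * (1 / 2) <= x ^ 2 * cos x) by (apply Rmult_le_compat_l; lra). lra. }
      replace ((x + x ^ 3) * cos x) with (x * ((1 + x ^ 2) * cos x)) by ring. nra. }
    lra.
Qed.

Lemma gate_angle_bounds (n k : nat) : (0 < k < n)%nat -> 0 < gate_angle n k < PI.
Proof.
  intros [Hk Hkn]. pose proof PI_RGT_0. unfold gate_angle.
  apply lt_INR in Hkn. apply lt_INR in Hk. simpl in Hk.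
  assert (Hn : 0 < INR n) by lra.
  assert (0 < INR k / INR n) by (apply Rdiv_lt_0_compat; lra).
  assert (INR k / INR n < 1).
  { apply Rmult_lt_reg_r with (INR n); [lra|].
    replace (INR k / INR n * INR n) with (INR k) by (field; lra). lra. }
  nra.
Qed.

Lemma gate_sin_pos (n k : nat) : (0 < k < n)%nat -> 0 < sin (gate_angle n k).
Proof. intros H. apply gate_angle_bounds in H. apply sin_gt_0; lra. Qed.

Lemma gate_width_pos (n : nat) : (3 <= n)%nat -> 0 < gate_width n.
Proof.
  intros H. destruct (gate_mesh_bounds n H). destruct (gate_width_bounds n H) as [[] _]. lra.
Qed.

Lemma gate_scale_pos (n k : nat) : (3 <= n)%nat -> (0 < k < n)%nat -> 0 < gate_scale n k.
Proof. intros. apply Rdiv_lt_0_compat; auto using gate_width_pos, gate_sin_pos. Qed.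

Lemma gate_scale_sq (n k : nat) : (0 < k < n)%nat ->
  gate_scale n k ^ 2 = gate_point n k ^ 2 + gate_width n ^ 2.
Proof.
  intros H. apply gate_sin_pos in H. unfold gate_scale, gate_point.
  set (s := sin _) in *. set (c := cos _).
  assert (E : s ^ 2 + c ^ 2 = 1).
  { pose proof (sin2_cos2 (gate_angle n k)) as E. unfold Rsqr in E. fold s c in E. lra. }
  replace ((gate_width n / s) ^ 2) with (gate_width n ^ 2 * (s ^ 2 + c ^ 2) / s ^ 2)
    by (rewrite E; field; lra).
  field. lra.
Qed.

Lemma gate_angle_succ (n k : nat) : gate_angle n (S k) = gate_angle n k + PI / INR n.
Proof. unfold gate_angle. rewrite S_INR. unfold Rdiv. ring. Qed.

(** By the addition formulas the reference map advances the angle by [arctan d = PI / n]. The bound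
    [S k < n] keeps the next sine positive. *)
Lemma gate_point_succ (n k : nat) : (3 <= n)%nat -> (0 < k)%nat -> (S k < n)%nat ->
  1 - gate_point n k <> 0 /\
  gate_point n (S k) = (gate_point n k + gate_width n ^ 2) / (1 - gate_point n k).
Proof.
  intros Hn Hk Hkn.
  pose proof (gate_sin_pos n k ltac:(lia)) as Hs.
  pose proof (gate_sin_pos n (S k) ltac:(lia)) as Hs'.
  unfold gate_point, gate_width, tan. rewrite gate_angle_succ in *.
  destruct (gate_mesh_bounds n Hn) as [H0 H3]. set (x := PI / INR n) in *.
  set (t := gate_angle n k) in *. pose proof PI_RGT_0.
  assert (Hc : 1 / 2 <= cos x).
  { rewrite <- cos_PI3. apply cos_decr_1; lra. }
  rewrite sin_plus in *. rewrite cos_plus.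
  set (s := sin t) in *. set (c := cos t) in *. set (S' := sin x) in *. set (C' := cos x) in *.
  assert (E : 1 - - (S' / C') * (c / s) = (s * C' + c * S') / (s * C')) by (field; lra).
  split.
  - rewrite E. apply Rgt_not_eq, Rdiv_lt_0_compat; auto. apply Rmult_lt_0_compat; lra.
  - rewrite E. field. lra.
Qed.

Lemma gate_angle_reflect (n k : nat) : (k <= n)%nat -> (0 < n)%nat ->
  gate_angle n (n - k) = PI - gate_angle n k.
Proof.
  intros Hk Hn. unfold gate_angle. rewrite minus_INR by auto.
  apply lt_INR in Hn. simpl in Hn. field. lra.
Qed.

Lemma gate_point_reflect (n k : nat) : (0 < k < n)%nat ->
  gate_point n (n - k) = - gate_point n k.
Proof.
  intros H. pose proof (gate_sin_pos _ _ H). unfold gate_point.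
  rewrite gate_angle_reflect by lia. rewrite cos_minus, sin_minus, cos_PI, sin_PI.
  field. repeat split; lra.
Qed.

Lemma gate_scale_reflect (n k : nat) : (0 < k < n)%nat ->
  gate_scale n (n - k) = gate_scale n k.
Proof.
  intros H. pose proof (gate_sin_pos _ _ H). unfold gate_scale.
  rewrite gate_angle_reflect by lia. rewrite sin_minus, cos_PI, sin_PI.
  f_equal. ring.
Qed.

Lemma gate_scale_le_half (n k : nat) : (3 <= n)%nat -> (0 < k)%nat -> (2 * k <= n)%nat ->
  gate_scale n k <= 4 / INR k.
Proof.
  intros Hn Hk H2. destruct (gate_width_bounds n Hn) as [[_ Hd] _].
  pose proof (INR_ge_3 n Hn) as Hn3.
  assert (Hk0 : 0 < INR k) by (apply lt_0_INR; lia).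
  assert (Hkn : 2 * INR k <= INR n).
  { apply le_INR in H2. rewrite mult_INR in H2. simpl in H2. lra. }
  pose proof PI_RGT_0.
  assert (Hang : gate_angle n k = INR k * (PI / INR n)) by (unfold gate_angle; field; lra).
  set (x := PI / INR n) in *.
  assert (Hx : 0 < x) by (apply Rdiv_lt_0_compat; lra).
  assert (Hnx : INR n * x = PI) by (unfold x; field; lra).
  assert (Hs : INR k * x / 2 <= sin (gate_angle n k)).
  { rewrite Hang. apply sin_half_lower. split; [nra|]. nra. }
  assert (Hkx : 0 < INR k * x) by (apply Rmult_lt_0_compat; lra).
  unfold gate_scale.
  apply Rle_trans with (2 * x / (INR k * x / 2)).
  - apply Rmult_le_compat; auto.
    + left. apply gate_width_pos; auto.
    + left. apply Rinv_0_lt_compat. lra.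
    + apply Rinv_le_contravar; lra.
  - right. field. repeat split; lra.
Qed.

Lemma gate_scale_le (n k : nat) : (3 <= n)%nat -> (0 < k < n)%nat ->
  gate_scale n k <= 4 / INR (Nat.min k (n - k)).
Proof.
  intros Hn Hk. destruct (Nat.le_gt_cases (2 * k) n) as [H | H].
  - rewrite Nat.min_l by lia. apply gate_scale_le_half; lia.
  - rewrite Nat.min_r by lia. rewrite <- gate_scale_reflect by lia.
    apply gate_scale_le_half; lia.
Qed.

Lemma gate_width_scale (n k : nat) : (3 <= n)%nat -> (0 < k < n)%nat ->
  gate_width n ^ 2 / gate_scale n k ^ 2 = sin (gate_angle n k) ^ 2.
Proof.
  intros Hn Hk. pose proof (gate_sin_pos n k Hk). pose proof (gate_width_pos n Hn).
  unfold gate_scale. field. split; lra.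
Qed.

(** The limit [- 1 / K] is an orbit of [w / (1 - w)], the reference map with [d = 0]. Bounds on
    [x cot x] from both sides give the rate. *)
Lemma gate_point_limit (K : nat) (e : R) : (0 < K)%nat -> 0 < e ->
  eventually (fun n => Rabs (gate_point n K + / INR K) < e).
Proof.
  intros HK He. pose proof PI_RGT_0 as HPI.
  assert (HK0 : 1 <= INR K) by (apply (le_INR 1); lia).
  set (c := PI ^ 2 * (1 + INR K ^ 2)).
  destruct (eventually_div_lt c e He) as [N1 HN1].
  exists (N1 + 3 + 2 * K)%nat. intros n Hn. specialize (HN1 n ltac:(lia)).
  pose proof (INR_ge_3 n ltac:(lia)) as Hn3.
  destruct (gate_width_bounds n ltac:(lia)) as [[Hd1 Hd2] Hd3].
  pose proof (gate_sin_pos n K ltac:(lia)) as Hs.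
  pose proof (gate_angle_bounds n K ltac:(lia)) as Ha.
  assert (HKn : 2 * INR K <= INR n).
  { assert (H2 : (2 * K <= n)%nat) by lia. apply le_INR in H2. rewrite mult_INR in H2. simpl in H2. lra. }
  assert (Hang : gate_angle n K = INR K * (PI / INR n)) by (unfold gate_angle; field; lra).
  set (x := PI / INR n) in *. set (t := gate_angle n K) in *.
  assert (Hx : 0 < x) by (apply Rdiv_lt_0_compat; lra).
  assert (Hnx : INR n * x = PI) by (unfold x; field; lra).
  assert (Ht2 : t <= PI / 2) by (rewrite Hang; nra).
  assert (Hcc : 0 <= cos t) by (apply cos_ge_0; lra).
  unfold gate_point. fold t.
  set (r := cos t / sin t).
  assert (Hr1 : r <= / t).
  { unfold r. apply Rmult_le_reg_r with (sin t * t); [nra|].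
    replace (cos t / sin t * (sin t * t)) with (t * cos t) by (field; lra).
    replace (/ t * (sin t * t)) with (sin t) by (field; lra).
    apply x_cos_le_sin. lra. }
  assert (Hr2 : (1 - t ^ 2 / 2) / t <= r).
  { unfold r. apply Rmult_le_reg_r with (sin t * t); [nra|].
    replace (cos t / sin t * (sin t * t)) with (t * cos t) by (field; lra).
    replace ((1 - t ^ 2 / 2) / t * (sin t * t)) with ((1 - t ^ 2 / 2) * sin t) by (field; lra).
    pose proof (cos_lower t). pose proof (sin_lt_x t ltac:(lra)).
    apply Rle_trans with (cos t * sin t); [apply Rmult_le_compat_r; lra|].
    rewrite (Rmult_comm t). apply Rmult_le_compat_l; lra. }
  assert (Hr0 : 0 <= r) by (apply Rdiv_le_0_compat; lra).
  assert (Hrt : r <= / (INR K * x)) by (rewrite <- Hang; exact Hr1).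
  assert (Hup : gate_width n * r <= / INR K + x ^ 2).
  { apply Rle_trans with ((x + x ^ 3) * / (INR K * x)).
    - apply Rmult_le_compat; lra.
    - replace ((x + x ^ 3) * / (INR K * x)) with (/ INR K + x ^ 2 * / INR K) by (field; lra).
      assert (/ INR K <= 1) by (rewrite <- Rinv_1; apply Rinv_le_contravar; lra). nra. }
  assert (Hlo : / INR K - x ^ 2 * INR K <= gate_width n * r).
  { apply Rle_trans with (x * r); [|apply Rmult_le_compat_r; lra].
    apply Rle_trans with (x * ((1 - t ^ 2 / 2) / t)); [|apply Rmult_le_compat_l; lra].
    rewrite Hang.
    replace (x * ((1 - (INR K * x) ^ 2 / 2) / (INR K * x))) with (/ INR K - x ^ 2 * INR K / 2) by (field; lra).
    assert (0 <= x ^ 2 * INR K) by nra. lra. }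
  assert (Hx2 : x ^ 2 * (1 + INR K ^ 2) <= c / INR n).
  { unfold c. apply Rmult_le_reg_r with (INR n); [lra|].
    replace (PI ^ 2 * (1 + INR K ^ 2) / INR n * INR n) with ((INR n * x) ^ 2 * (1 + INR K ^ 2)) by (rewrite Hnx; field; lra).
    assert (0 <= x ^ 2 * (1 + INR K ^ 2)) by nra. 
    replace ((INR n * x) ^ 2 * (1 + INR K ^ 2)) with (x ^ 2 * (1 + INR K ^ 2) * (INR n * INR n)) by ring.
    apply Rmult_le_compat_l; nra. }
  assert (x ^ 2 * INR K <= x ^ 2 * (1 + INR K ^ 2)) by (apply Rmult_le_compat_l; nra).
  assert (x ^ 2 <= x ^ 2 * (1 + INR K ^ 2)) by nra.
  replace (- gate_width n * r + / INR K) with (/ INR K - gate_width n * r) by ring.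
  apply Rabs_lt_between. lra.
Qed.

(** With [x = PI / n], [s = sigma / n] and [r] the given error, [eps = x (1 + s) + r]. In the square
    only the term linear in [s] is kept: relative to [d^2], the terms with [s^2] and [x^2 - d^2] are
    [O(1 / n^2)] and those with [r] are [O(1 / n^(1 + alpha))]. *)
Lemma perturbation_size (eps sigma : nat -> nat -> C) (alpha M1 M : R) :
  0 < alpha -> 0 <= M1 -> 0 <= M ->
  eventually (fun n => forall k, (k < n)%nat ->
     Cmod (eps k n - (PI / INR n + PI / INR n ^ 2 * sigma k n)) <= M1 / Rpower (INR n) (2 + alpha)) ->
  (forall n k, (1 <= n)%nat -> (k < n)%nat -> Cmod (sigma k n) <= M) ->
  exists Cc, 0 <= Cc /\ eventually (fun n => forall k, (k < n)%nat ->
    Cmod (eps k n ^ 2 / gate_width n ^ 2 - 1 - 2 * sigma k n / INR n)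
      <= (Cc / INR n + Cc / Rpower (INR n) alpha) / INR n).
Proof.
  intros Ha HM1 HM [N HN] Hs.
  exists (48 * (1 + 2 * M) + M ^ 2 + (1 + M) * M1 + M1 ^ 2). split; [nra|].
  exists (N + 3)%nat. intros n Hn k Hk.
  specialize (HN n ltac:(lia) k Hk). specialize (Hs n k ltac:(lia) Hk).
  pose proof (INR_ge_3 n ltac:(lia)) as Hn3.
  destruct (gate_width_bounds n ltac:(lia)) as [[Hd1 Hd2] Hd3].
  pose proof (gate_width_pos n ltac:(lia)) as Hd0.
  pose proof PI_RGT_0. pose proof PI_4. pose proof PI2_1.
  set (d := gate_width n) in *. set (N' := INR n) in *.
  set (x := PI / N') in *. set (b := Rpower N' alpha).
  assert (Hb : 1 <= b).
  { unfold b. rewrite <- (Rpower_O N') by lra. apply Rle_Rpower; lra. }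
  assert (HNx : N' * x = PI) by (unfold x; field; lra).
  assert (Hx0 : 0 < x) by (apply Rdiv_lt_0_compat; lra).
  assert (Hp : Rpower N' (2 + alpha) = N' ^ 2 * b).
  { unfold b. rewrite Rpower_plus. f_equal.
    rewrite <- Rpower_pow by lra. reflexivity. }
  rewrite Hp in HN.
  assert (HNc : RtoC N' <> 0%C) by (intro E; apply RtoC_inj in E; lra).
  assert (Hxc : RtoC x = (PI / N')%C) by (unfold x; rewrite RtoC_div by lra; reflexivity).
  assert (Hdc : RtoC d <> 0%C) by (intro E; apply RtoC_inj in E; lra).
  set (s := (sigma k n / N')%C).
  assert (HsM : Cmod s <= M / N').
  { unfold s. apply Cmod_div_le; try lra. rewrite Cmod_R, Rabs_right; lra. }
  set (r := (eps k n - (PI / N' + PI / N' ^ 2 * sigma k n))%C) in *.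
  assert (He : eps k n = (x * (1 + s) + r)%C).
  { unfold r, s. rewrite Hxc. field. auto. }
  replace (eps k n ^ 2 / d ^ 2 - 1 - 2 * sigma k n / N')%C
    with (((x ^ 2 - d ^ 2) * (1 + 2 * s) + x ^ 2 * (s ^ 2) + 2 * x * (1 + s) * r + r * r) / d ^ 2)%C
    by (rewrite He; unfold s; field; auto).
  assert (HMN : 0 <= M / N') by (apply Rdiv_le_0_compat; lra).
  assert (HMN1 : M / N' <= M).
  { apply Rmult_le_reg_r with N'; [lra|]. unfold Rdiv. rewrite Rmult_assoc, Rinv_l by lra. nra. }
  assert (H1s : Cmod (1 + s) <= 1 + M) by (apply Cmod_plus_le; [rewrite Cmod_1|]; lra).
  assert (H12s : Cmod (1 + 2 * s) <= 1 + 2 * M).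
  { apply Cmod_plus_le; [rewrite Cmod_1; lra|]. apply Cmod_mult_le; [rewrite Cmod_R, Rabs_right; lra | lra]. }
  assert (Hr : Cmod r <= x * (M1 / (2 * N' * b))).
  { eapply Rle_trans; [exact HN|]. apply Rle_trans with (2 / N' * (M1 / (2 * N' * b))).
    - right. field. split; lra.
    - apply Rmult_le_compat_r.
      + apply Rdiv_le_0_compat; [lra|]. nra.
      + unfold x. apply Rmult_le_compat_r; [left; apply Rinv_0_lt_compat|]; lra. }
  set (q := M1 / (2 * N' * b)) in *.
  assert (Hq0 : 0 <= q) by (apply Rdiv_le_0_compat; [lra|nra]).
  assert (Hxd : Cmod (RtoC x ^ 2 - RtoC d ^ 2) <= 3 * x ^ 4).
  { rewrite <- !RtoC_pow, <- RtoC_minus, Cmod_R, <- Rabs_Ropp, Rabs_right.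
    - replace (- (x ^ 2 - d ^ 2)) with ((d - x) * (d + x)) by ring.
      replace (3 * x ^ 4) with (x ^ 3 * (3 * x)) by ring. apply Rmult_le_compat; lra.
    - nra. }
  assert (Hx2 : 0 < x ^ 2) by nra.
  eapply Rle_trans.
  - apply (Cmod_div_le _ _ (x ^ 2) (3 * x ^ 4 * (1 + 2 * M) + x ^ 2 * (M / N') ^ 2
      + 2 * x * (1 + M) * (x * q) + (x * q) * (x * q))); auto.
    + rewrite Cmod_RtoC_sq. apply pow_incr. lra.
    + apply Cmod_plus_le; [apply Cmod_plus_le; [apply Cmod_plus_le|]|].
      * apply Cmod_mult_le; auto.
      * rewrite Cmod_mult, Cmod_RtoC_sq, Cmod_pow. apply Rmult_le_compat_l; [lra|].
        apply pow_incr. split; [apply Cmod_ge_0 | lra].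
      * apply Cmod_mult_le; auto. apply Cmod_mult_le; auto. rewrite Cmod_mult, !Cmod_R, !Rabs_right by lra. lra.
      * apply Cmod_mult_le; auto.
  - replace ((3 * x ^ 4 * (1 + 2 * M) + x ^ 2 * (M / N') ^ 2
      + 2 * x * (1 + M) * (x * q) + (x * q) * (x * q)) / x ^ 2)
      with (3 * (1 + 2 * M) * x ^ 2 + (M / N') ^ 2 + 2 * (1 + M) * q + q ^ 2) by (field; lra).
    assert (HiN : 0 < / N' <= 1).
    { split; [apply Rinv_0_lt_compat; lra|]. rewrite <- Rinv_1. apply Rinv_le_contravar; lra. }
    assert (Hib : 0 < / b <= 1).
    { split; [apply Rinv_0_lt_compat; lra|]. rewrite <- Rinv_1. apply Rinv_le_contravar; lra. }
    assert (E1 : x ^ 2 <= 16 * (/ N' * / N')).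
    { unfold x, Rdiv. replace ((PI * / N') ^ 2) with (PI ^ 2 * (/ N' * / N')) by ring.
      apply Rmult_le_compat_r; nra. }
    assert (E2 : q = M1 / 2 * (/ N' * / b)) by (unfold q; field; split; lra).
    assert (E3 : (M / N') ^ 2 = M ^ 2 * (/ N' * / N')) by (field; lra).
    rewrite E3.
    replace ((((48 * (1 + 2 * M) + M ^ 2 + (1 + M) * M1 + M1 ^ 2) / N' +
     (48 * (1 + 2 * M) + M ^ 2 + (1 + M) * M1 + M1 ^ 2) / b) / N')) with
     ((48 * (1 + 2 * M) + M ^ 2 + (1 + M) * M1 + M1 ^ 2) * (/ N' * / N') +
      (48 * (1 + 2 * M) + M ^ 2 + (1 + M) * M1 + M1 ^ 2) * (/ N' * / b)) by (field; lra).
    set (u := / N' * / N') in *. set (v := / N' * / b) in *.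
    assert (Hu : 0 < u) by (apply Rmult_lt_0_compat; lra).
    assert (Hv : 0 < v) by (apply Rmult_lt_0_compat; lra).
    assert (Hv1 : v <= 1) by (unfold v; rewrite <- (Rmult_1_r 1); apply Rmult_le_compat; lra).
    rewrite E2.
    assert ((M1 / 2 * v) ^ 2 <= M1 ^ 2 * v).
    { replace ((M1 / 2 * v) ^ 2) with (M1 ^ 2 * v * (v / 4)) by field.
      rewrite <- (Rmult_1_r (M1 ^ 2 * v)) at 2. apply Rmult_le_compat_l; [|lra].
      apply Rmult_le_pos; [apply pow2_ge_0|lra]. }
    assert (F1 : 3 * (1 + 2 * M) * x ^ 2 <= 48 * (1 + 2 * M) * u).
    { replace (48 * (1 + 2 * M) * u) with (3 * (1 + 2 * M) * (16 * u)) by ring.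
      apply Rmult_le_compat_l; lra. }
    assert (0 <= M1 ^ 2) by apply pow2_ge_0. assert (0 <= M ^ 2) by apply pow2_ge_0.
    assert (0 <= (1 + M) * M1) by (apply Rmult_le_pos; lra).
    assert (0 <= (48 * (1 + 2 * M) + M ^ 2) * v) by (apply Rmult_le_pos; lra).
    assert (0 <= ((1 + M) * M1 + M1 ^ 2) * u) by (apply Rmult_le_pos; lra).
    lra.
Qed.

(** * Telescoping bounds, odd sums and the drift *)

(** [Q] is a discrete primitive of the bounds on the increments; sums of errors are estimated by
    supplying such a [Q]. *)
Lemma telescope (u : nat -> C) (Q : nat -> R) (p q : nat) :
  (p <= q)%nat ->
  (forall j, (p <= j < q)%nat -> Cmod (u (S j) - u j) <= Q (S j) - Q j) ->
  Cmod (u q - u p) <= Q q - Q p.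
Proof.
  intros Hpq. induction Hpq as [|q Hpq IH]; intros H.
  - replace (u p - u p)%C with (RtoC 0) by ring. rewrite Cmod_0. lra.
  - specialize (IH ltac:(intros; apply H; lia)). specialize (H q ltac:(lia)).
    pose proof (Cmod_sub_tri (u (S q)) (u q) (u p)). lra.
Qed.

(** The sum over [j < k]: a difference is a sum over a half-open interval, and the empty sum is
    available. *)
Fixpoint csum (F : nat -> C) (k : nat) : C :=
  match k with O => 0%C | S j => (csum F j + F j)%C end.

Lemma csum_bound (F : nat -> C) (b : R) (p q : nat) :
  (p <= q)%nat -> (forall j, (p <= j < q)%nat -> Cmod (F j) <= b) ->
  Cmod (csum F q - csum F p) <= INR (q - p) * b.
Proof.
  intros Hpq H. rewrite minus_INR by auto.
  replace ((INR q - INR p) * b) with (INR q * b - INR p * b) by ring.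
  apply (telescope (csum F) (fun j => INR j * b)); auto.
  intros j Hj. cbn [csum]. rewrite S_INR. specialize (H j Hj).
  replace (csum F j + F j - csum F j)%C with (F j) by ring. lra.
Qed.

(** The terms with [p <= j <= n - p] cancel in pairs [j], [n - j]. The induction removes both end
    terms, so it runs on their number [m] and descends by two. *)
Lemma csum_odd (F : nat -> C) (n : nat) :
  (forall j, (0 < j < n)%nat -> F (n - j)%nat = (- F j)%C) ->
  forall m p, (m = n + 1 - 2 * p)%nat -> (0 < p)%nat -> (2 * p <= n + 1)%nat ->
  csum F (n + 1 - p) = csum F p.
Proof.
  intros HF. induction m as [m IH] using (well_founded_induction Wf_nat.lt_wf).
  intros p Hm Hp Hpn.
  destruct m as [|[|m]].
  - replace (n + 1 - p)%nat with p by lia. reflexivity.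
  (* One term is left, at the fixed point [p = n - p], where oddness forces the value zero. *)
  - replace (n + 1 - p)%nat with (S p) by lia. simpl.
    assert (E : F p = (- F p)%C).
    { rewrite <- HF by lia. f_equal. lia. }
    assert (F p = 0%C).
    { replace (F p) with ((F p + F p) / 2)%C by field. rewrite E at 1. field. }
    rewrite H. ring.
  - replace (n + 1 - p)%nat with (S (n + 1 - S p)) by lia. cbn [csum].
    rewrite (IH m) by lia. cbn [csum]. 
    replace (n + 1 - S p)%nat with (n - p)%nat by lia. rewrite HF by lia. ring.
Qed.

(** A square root stands in for the logarithm as primitive of [1 / x]. Its growth is still harmless,
    since [sqrt k / k^2] is summable, and the estimate stays algebraic. *)
Lemma sqrt_step (x : R) : 2 <= x -> / x <= 2 * sqrt (x + 1) - 2 * sqrt x.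
Proof.
  intros Hx. 
  pose proof (sqrt_sqrt x ltac:(lra)) as E1. pose proof (sqrt_sqrt (x + 1) ltac:(lra)) as E2.
  pose proof (sqrt_pos x). pose proof (sqrt_pos (x + 1)).
  set (s := sqrt x) in *. set (t := sqrt (x + 1)) in *.
  assert (s < t) by nra. assert (1 < s) by nra.
  assert (Hst : (t - s) * (t + s) = 1) by lra.
  assert (Hts : t + s <= 2 * x) by nra.
  apply Rmult_le_reg_r with x; [lra|]. rewrite Rinv_l by lra. 
  apply Rle_trans with ((t - s) * (2 * x)); [|lra]. rewrite <- Hst. apply Rmult_le_compat_l; lra.
Qed.

Lemma inv_step (x : R) : 2 <= x -> / (x * x) <= / (x - 1) - / x.
Proof.
  intros Hx. replace (/ (x - 1) - / x) with (/ ((x - 1) * x)) by (field; lra).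
  apply Rinv_le_contravar; nra.
Qed.

Lemma inv_sqrt_step (x : R) : 2 <= x ->
  / (x * sqrt x) <= 2 * / sqrt (x - 1) - 2 * / sqrt x.
Proof.
  intros Hx.
  pose proof (sqrt_sqrt x ltac:(lra)) as E1. pose proof (sqrt_sqrt (x - 1) ltac:(lra)) as E2.
  assert (0 < sqrt x) by (apply sqrt_lt_R0; lra).
  assert (0 < sqrt (x - 1)) by (apply sqrt_lt_R0; lra).
  set (t := sqrt x) in *. set (s := sqrt (x - 1)) in *.
  assert (s < t) by nra.
  assert (Hst : (t - s) * (t + s) = 1) by lra.
  rewrite <- E1.
  replace (2 * / s - 2 * / t) with (2 * (t - s) * / (s * t)) by (field; lra).
  apply Rmult_le_reg_r with ((t * t * t) * (s * (t + s))).
  - repeat apply Rmult_lt_0_compat; lra.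
  - replace (/ (t * t * t) * (t * t * t * (s * (t + s)))) with (s * (t + s)) by (field; lra).
    replace (2 * (t - s) * / (s * t) * (t * t * t * (s * (t + s)))) with (2 * (t * t) * ((t - s) * (t + s))) by (field; lra).
    rewrite Hst. nra.
Qed.

Lemma phase_csum (sigma : nat -> nat -> C) (n : nat) : (0 < n)%nat ->
  phase sigma n = csum (fun k => / INR n * (sigma k n * G (INR (k + 1) / INR n)))%C n.
Proof.
  intros Hn. unfold phase. destruct n as [|n]; [lia|]. cbn [pred].
  set (N' := INR (S n)).
  assert (H : forall m F, (/ N' * sum_n (G := C_AbelianMonoid) F m)%C = csum (fun k => / N' * F k)%C (S m)).
  { induction m; intros F.
    - rewrite sum_O. simpl. ring.
    - rewrite sum_Sn. cbn [csum] in *. rewrite <- IHm.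
      change (plus (G := C_AbelianMonoid)) with Cplus. ring. }
  apply H.
Qed.

Lemma mobius_inverse (d tau : R) (y w : C) :
  0 < d -> (1 - tau * y <> 0)%C -> w = ((tau + d ^ 2 * y) / (1 - tau * y))%C ->
  y = ((w - tau) / (d ^ 2 + tau * w))%C.
Proof.
  intros Hd Hb ->.
  assert (Hdt : (RtoC d ^ 2 + RtoC tau ^ 2 <> 0)%C).
  { rewrite <- !RtoC_pow, <- RtoC_plus. intro E. apply RtoC_inj in E. nra. }
  assert (E : (d ^ 2 + tau * ((tau + d ^ 2 * y) / (1 - tau * y)) = (d ^ 2 + tau ^ 2) / (1 - tau * y))%C)
    by (field; auto).
  rewrite E. field. auto.
Qed.

(** The part of the lag increment that does not involve [chi]. Near the ends it is only known to be
    of size [1 / k], which is not summable, so a bound on its size is not enough and oddness must do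
    the rest. *)
Definition gate_drift (a : C) (n k : nat) : C :=
  ((a - 1) * gate_point n k
   - a * gate_width n ^ 2 * (gate_point n k / gate_scale n k ^ 2))%C.

Lemma gate_drift_reflect (a : C) (n k : nat) : (0 < k < n)%nat ->
  gate_drift a n (n - k) = (- gate_drift a n k)%C.
Proof.
  intros H. unfold gate_drift. rewrite gate_point_reflect, gate_scale_reflect by auto.
  rewrite RtoC_opp. unfold Cdiv. ring.
Qed.

Lemma gate_drift_bound (a : C) (n k : nat) : (3 <= n)%nat -> (0 < k < n)%nat ->
  Cmod (gate_drift a n k) <= 4 * (2 * Cmod a + 1) / INR (Nat.min k (n - k)).
Proof.
  intros Hn Hk. 
  pose proof (gate_scale_pos n k Hn Hk) as Hr. pose proof (gate_scale_sq n k Hk) as Hsq.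
  pose proof (gate_scale_le n k Hn Hk) as Hle. pose proof (gate_width_pos n Hn) as Hd.
  unfold gate_drift.
  set (r := gate_scale n k) in *. set (t := gate_point n k) in *. set (d := gate_width n) in *.
  assert (Ht : Rabs t <= r) by (exact (Rabs_le_of_sq _ _ _ Hr Hsq)).
  assert (Hm : 0 < INR (Nat.min k (n - k))) by (apply lt_0_INR; lia).
  pose proof (Cmod_ge_0 a) as Ha.
  apply Rle_trans with ((Cmod a + 1) * r + Cmod a * r ^ 2 * (r / r ^ 2)).
  - apply Cmod_minus_le.
    + apply Cmod_mult_le; [|rewrite Cmod_R; auto]. apply Cmod_minus_le; [apply Rle_refl | rewrite Cmod_1; lra].
    + apply Cmod_mult_le; [apply Cmod_mult_le; [apply Rle_refl|]|].
      * rewrite Cmod_RtoC_sq. nra.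
      * apply Cmod_div_le; [nra | rewrite Cmod_RtoC_sq; lra | rewrite Cmod_R; auto].
  - replace ((Cmod a + 1) * r + Cmod a * r ^ 2 * (r / r ^ 2)) with ((2 * Cmod a + 1) * r) by (field; lra).
    unfold Rdiv. replace (4 * (2 * Cmod a + 1) * / INR (Nat.min k (n - k)))
      with ((2 * Cmod a + 1) * (4 / INR (Nat.min k (n - k)))) by (field; lra).
    apply Rmult_le_compat_l; lra.
Qed.

Lemma csum_sqrt_bound (F : nat -> C) (B : R) (J k : nat) :
  (2 <= J)%nat -> (J <= k)%nat -> 0 <= B ->
  (forall j, (J <= j < k)%nat -> Cmod (F j) <= B / INR j) ->
  Cmod (csum F k - csum F J) <= 2 * B * sqrt (INR k).
Proof.
  intros HJ Hk HB H.
  apply Rle_trans with (2 * B * sqrt (INR k) - 2 * B * sqrt (INR J)).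
  - apply (telescope (csum F) (fun j => 2 * B * sqrt (INR j))); auto.
    intros j Hj. cbn [csum]. replace (csum F j + F j - csum F j)%C with (F j) by ring.
    eapply Rle_trans; [apply H; auto|]. rewrite S_INR.
    assert (H2 : 2 <= INR j) by (apply (le_INR 2); lia).
    pose proof (sqrt_step (INR j) H2) as Hs.
    apply Rmult_le_compat_l with (r := B) in Hs; [|lra]. unfold Rdiv. lra.
  - assert (0 <= 2 * B * sqrt (INR J)) by (apply Rmult_le_pos; [lra | apply sqrt_pos]). lra.
Qed.

(** Past the middle, oddness identifies the sum up to [k] with the sum up to [n + 1 - k], so only
    the distance to the nearer end matters. The added [1] absorbs the shift from [n - k] to
    [n + 1 - k]. *)
Lemma csum_drift_bound (a : C) (n J k : nat) :
  (3 <= n)%nat -> (2 <= J)%nat -> (J <= k <= n - J)%nat ->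
  Cmod (csum (gate_drift a n) k - csum (gate_drift a n) J)
    <= 8 * (2 * Cmod a + 1) * (sqrt (INR (Nat.min k (n - k))) + 1).
Proof.
  intros Hn HJ Hk. pose proof (Cmod_ge_0 a) as Ha.
  assert (Hb : forall q, (J <= q)%nat -> (2 * q <= n + 1)%nat ->
    Cmod (csum (gate_drift a n) q - csum (gate_drift a n) J) <= 2 * (4 * (2 * Cmod a + 1)) * sqrt (INR q)).
  { intros q Hq Hqn. apply csum_sqrt_bound; auto; [lra|].
    intros j Hj. pose proof (gate_drift_bound a n j Hn ltac:(lia)) as H.
    rewrite Nat.min_l in H by lia. exact H. }
  destruct (Nat.le_gt_cases (2 * k) n) as [H2 | H2].
  - rewrite Nat.min_l by lia. specialize (Hb k ltac:(lia) ltac:(lia)). lra.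
  - rewrite Nat.min_r by lia.
    replace k with (n + 1 - (n + 1 - k))%nat at 1 by lia.
    rewrite (csum_odd (gate_drift a n) n) with (m := (n + 1 - 2 * (n + 1 - k))%nat); try lia.
    2: { intros j Hj. apply gate_drift_reflect; auto. }
    specialize (Hb (n + 1 - k)%nat ltac:(lia) ltac:(lia)).
    eapply Rle_trans; [exact Hb|].
    replace (n + 1 - k)%nat with (S (n - k)) by lia. rewrite S_INR.
    assert (Hs : sqrt (INR (n - k) + 1) <= sqrt (INR (n - k)) + 1).
    { assert (0 <= INR (n - k)) by apply pos_INR.
      pose proof (sqrt_pos (INR (n - k))). pose proof (sqrt_sqrt (INR (n - k)) H).
      rewrite <- (sqrt_square (sqrt (INR (n - k)) + 1)) by lra. apply sqrt_le_1_alt. nra. }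
    nra.
Qed.

(** A discrete primitive dominating [A / m^2 + B / m^(3/2)], where [m = min j (n - j)]. It adds an
    increasing primitive for each end: both increments are nonnegative, and the one of the nearer
    end already suffices. *)
Definition gate_potential (A B : R) (n j : nat) : R :=
  A * (/ INR (n - j) - / (INR j - 1)) + B * (2 * / sqrt (INR (n - j)) - 2 * / sqrt (INR j - 1)).

Lemma gate_potential_step (A B : R) (n j : nat) :
  0 <= A -> 0 <= B -> (2 <= j)%nat -> (S (S j) <= n)%nat ->
  let m := INR (Nat.min j (n - j)) in
  A * / (m * m) + B * / (m * sqrt m) <= gate_potential A B n (S j) - gate_potential A B n j.
Proof.
  intros HA HB Hj Hn m. unfold gate_potential.
  assert (H2 : 2 <= INR j) by (apply (le_INR 2); lia).
  assert (H2' : 2 <= INR (n - j)) by (apply (le_INR 2); lia).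
  rewrite S_INR. replace (INR (n - S j)) with (INR (n - j) - 1).
  2: { replace (n - j)%nat with (S (n - S j)) by lia. rewrite S_INR. ring. }
  replace (INR j + 1 - 1) with (INR j) by ring.
  pose proof (inv_step _ H2) as I1. pose proof (inv_step _ H2') as I2.
  pose proof (inv_sqrt_step _ H2) as I3. pose proof (inv_sqrt_step _ H2') as I4.
  assert (P1 : 0 < / (INR j * INR j)) by (apply Rinv_0_lt_compat; nra).
  assert (P2 : 0 < / (INR (n - j) * INR (n - j))) by (apply Rinv_0_lt_compat; nra).
  assert (P3 : 0 < / (INR j * sqrt (INR j))).
  { apply Rinv_0_lt_compat, Rmult_lt_0_compat; [lra | apply sqrt_lt_R0; lra]. }
  assert (P4 : 0 < / (INR (n - j) * sqrt (INR (n - j)))).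
  { apply Rinv_0_lt_compat, Rmult_lt_0_compat; [lra | apply sqrt_lt_R0; lra]. }
  set (X := INR j) in *. set (Z := INR (n - j)) in *.
  assert (Hm : / (m * m) <= (/ (Z - 1) - / Z) + (/ (X - 1) - / X) /\
               / (m * sqrt m) <= (2 * / sqrt (Z - 1) - 2 * / sqrt Z) + (2 * / sqrt (X - 1) - 2 * / sqrt X)).
  { unfold m. destruct (Nat.min_spec j (n - j)) as [[_ ->] | [_ ->]]; fold X Z; lra. }
  destruct Hm as [Hm1 Hm2].
  apply Rmult_le_compat_l with (r := A) in Hm1; auto.
  apply Rmult_le_compat_l with (r := B) in Hm2; auto. lra.
Qed.

(** Only the tails at [K] remain, uniformly in [n]; hence the error accumulated between [K] and
    [n - K] is small for large [K]. *)
Lemma gate_potential_total (A B : R) (n K k : nat) :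
  0 <= A -> 0 <= B -> (2 <= K)%nat -> (K <= k <= n - K)%nat ->
  gate_potential A B n k - gate_potential A B n K
    <= 2 * A / (INR K - 1) + 4 * B / sqrt (INR K - 1).
Proof.
  intros HA HB HK Hk. unfold gate_potential.
  assert (H2 : 2 <= INR K) by (apply (le_INR 2); lia).
  assert (Hk2 : INR K <= INR k) by (apply le_INR; lia).
  assert (Hnk : INR K <= INR (n - k)) by (apply le_INR; lia).
  assert (HnK : INR K <= INR (n - K)) by (apply le_INR; lia).
  assert (S0 : 0 < sqrt (INR K - 1)) by (apply sqrt_lt_R0; lra).
  assert (S1 : sqrt (INR K - 1) <= sqrt (INR (n - k))) by (apply sqrt_le_1_alt; lra).
  assert (S2 : 0 < sqrt (INR k - 1)) by (apply sqrt_lt_R0; lra).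
  assert (S3 : 0 < sqrt (INR (n - K))) by (apply sqrt_lt_R0; lra).
  assert (I1 : / INR (n - k) <= / (INR K - 1)) by (apply Rinv_le_contravar; lra).
  assert (I2 : 0 < / (INR k - 1)) by (apply Rinv_0_lt_compat; lra).
  assert (I3 : 0 < / INR (n - K)) by (apply Rinv_0_lt_compat; lra).
  assert (I4 : / sqrt (INR (n - k)) <= / sqrt (INR K - 1)) by (apply Rinv_le_contravar; lra).
  assert (I5 : 0 < / sqrt (INR k - 1)) by (apply Rinv_0_lt_compat; lra).
  assert (I6 : 0 < / sqrt (INR (n - K))) by (apply Rinv_0_lt_compat; lra).
  unfold Rdiv.
  set (u1 := / INR (n - k)) in *. set (u2 := / (INR K - 1)) in *. set (u3 := / (INR k - 1)) in *.
  set (u4 := / INR (n - K)) in *. set (v1 := / sqrt (INR (n - k))) in *.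
  set (v2 := / sqrt (INR K - 1)) in *. set (v3 := / sqrt (INR k - 1)) in *.
  set (v4 := / sqrt (INR (n - K))) in *.
  assert (A * (u1 - u3 - u4 + u2) <= A * (2 * u2)) by (apply Rmult_le_compat_l; lra).
  assert (B * (v1 - v3 - v4 + v2) <= B * (2 * v2)) by (apply Rmult_le_compat_l; lra).
  lra.
Qed.

(** * Passage through the gate *)

Lemma nat_above (X : R) : exists N : nat, forall n, (N <= n)%nat -> X < INR n.
Proof.
  exists (S (Z.to_nat (up X))). intros n Hn.
  destruct (archimed X) as [H _]. eapply Rlt_le_trans; [apply H|].
  rewrite INR_IZR_INZ. apply IZR_le. lia.
Qed.

Lemma le_sqrt (x y : R) : 0 <= x -> x ^ 2 <= y -> x <= sqrt y.
Proof. intros Hx H. rewrite <- (sqrt_pow2 x Hx). apply sqrt_le_1_alt. exact H. Qed.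

(** A relation and a function are kept side by side: [gate_coord] is total and meaningless when its
    denominator vanishes, while [gate_rel] certifies a genuine pair of point and lag. *)
Definition gate_rel (n k : nat) (w y : C) : Prop :=
  (1 - gate_point n k * y <> 0)%C /\
  w = ((gate_point n k + gate_width n ^ 2 * y) / (1 - gate_point n k * y))%C.

Definition gate_coord (n k : nat) (w : C) : C :=
  ((w - gate_point n k) / (gate_width n ^ 2 + gate_point n k * w))%C.

Lemma gate_rel_coord (n k : nat) (w y : C) : (3 <= n)%nat ->
  gate_rel n k w y -> y = gate_coord n k w.
Proof. intros Hn [H1 H2]. apply mobius_inverse; auto using gate_width_pos. Qed.

(** A bootstrap on [u], the lag with drift and forcing subtracted. While [|y k| <= Yb k], the error
    of a step is at most an increment of the potential; the potential grows by at most [1] in all,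
    and this restores the bound on [y]. Since [c1], [A] and [J1] do not depend on [J] and [Y0], the
    time [K] can be increased with [J] fixed. *)
Lemma gate_passage (f : C -> C) (a : C) (rr M Ms : R) (eps sigma : nat -> nat -> C) (e : nat -> R) :
  0 < rr -> 0 <= M -> 0 <= Ms ->
  (forall w, Cmod w < rr -> Cmod (f w - (w + w ^ 2 + a * w ^ 3)) <= M * Cmod w ^ 4) ->
  (forall n k, (1 <= n)%nat -> (k < n)%nat -> Cmod (sigma k n) <= Ms) ->
  (forall x, 0 < x -> eventually (fun n => e n < x)) ->
  eventually (fun n => forall k, (k < n)%nat ->
    Cmod (eps k n ^ 2 / gate_width n ^ 2 - 1 - 2 * sigma k n / INR n) <= e n / INR n) ->
  exists c1 A (J1 : nat), 0 < c1 /\ 0 < A /\ forall J Y0, (J1 <= J)%nat -> 0 <= Y0 ->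
    1 + Y0 <= c1 * INR J -> eventually (fun n => forall w : nat -> C,
    (forall k, (J <= k < n - J)%nat -> w (S k) = (f (w k) + eps k n ^ 2)%C) ->
    forall y0, gate_rel n J (w J) y0 -> Cmod y0 <= Y0 ->
    (forall k, (J <= k <= n - J)%nat ->
       gate_rel n k (w k) (gate_coord n k (w k)) /\
       Cmod (gate_coord n k (w k)) <= Y0 + A * (1 + sqrt (INR (Nat.min k (n - k)))) /\
       Cmod (w k) < rr) /\
    forall K, (J <= K)%nat -> (2 * K <= n)%nat ->
      Cmod (gate_coord n (n - K) (w (n - K)%nat) - gate_coord n K (w K) - phase sigma n)
        <= A * (1 + Y0) / (INR K - 1) + A / sqrt (INR K - 1) + A * INR K / INR n + e n).
Proof.
  intros Hrr HM HMs Hf Hsig He0 [N0 Heps].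
  destruct (passage_step a M (2 * Ms + 1) HM ltac:(lra)) as [c0 [A0 [[Hc0 Hc04] [HA0 Hstep]]]].
  pose proof (Cmod_ge_0 a) as Ha.
  (* [B / m] bounds the drift at distance [m] from the nearer end. [L] collects the constant part
     [2 B] of the summed drift, the total forcing [2 Ms + 1] and an allowance [1] for all errors. *)
  set (B := 4 * (2 * Cmod a + 1)). assert (HB : 4 <= B) by (unfold B; lra).
  set (L := 2 * B + 2 * Ms + 2). assert (HL : 0 < L) by (unfold L; lra).
  (* Each summand serves one condition on [J]: the smallness required by the step, a total error of
     at most [1], orbit points within [rr] of zero, and [J >= 2]. *)
  set (X := 2 + 16 * L / c0 + 128 * A0 * L + (16 * B / c0) ^ 2 + (256 * A0 * B) ^ 2 + 9 / rr).
  destruct (nat_above (X + 1)) as [J1 HJ1].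
  assert (HX1 : 0 <= 16 * L / c0) by (apply Rdiv_le_0_compat; lra).
  assert (HX2 : 0 <= 128 * A0 * L) by (apply Rmult_le_pos; lra).
  assert (HX3 : 0 <= (16 * B / c0) ^ 2) by apply pow2_ge_0.
  assert (HX4 : 0 <= (256 * A0 * B) ^ 2) by apply pow2_ge_0.
  assert (HX5 : 0 <= 9 / rr) by (apply Rdiv_le_0_compat; lra).
  exists (Rmin (c0 / 16) (/ (256 * A0))), (32 * A0 * (1 + L) + 128 * A0 * B + B + L + 16 * Ms + 4 * Ms + 1), J1.
  assert (Hi : 0 < / (256 * A0)) by (apply Rinv_0_lt_compat; lra).
  assert (HAB : 0 < A0 * B) by (apply Rmult_lt_0_compat; lra).
  assert (HAL : 0 < A0 * L) by (apply Rmult_lt_0_compat; lra).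
  split; [apply Rmin_pos; lra|].
  split; [lra|].
  intros J Y0 HJ HY0 HcJ.
  specialize (HJ1 J HJ).
  assert (HJr : 0 < INR J - 1) by (unfold X in HJ1; lra).
  assert (HY0a : 1 + Y0 <= c0 / 16 * INR J).
  { eapply Rle_trans; [exact HcJ|]. apply Rmult_le_compat_r; [lra | apply Rmin_l]. }
  assert (HY0b : A0 * (1 + Y0) <= INR J / 256).
  { apply Rle_trans with (A0 * (/ (256 * A0) * INR J)).
    - apply Rmult_le_compat_l; [lra|]. eapply Rle_trans; [exact HcJ|].
      apply Rmult_le_compat_r; [lra | apply Rmin_r].
    - right. field. lra. }
  assert (HsJ : 0 < sqrt (INR J - 1)) by (apply sqrt_lt_R0; lra).
  assert (HsJ1 : 16 * B / c0 <= sqrt (INR J - 1)).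
  { apply le_sqrt; [apply Rdiv_le_0_compat; lra|]. unfold X in HJ1. lra. }
  assert (HsJ2 : 256 * A0 * B <= sqrt (INR J - 1)).
  { apply le_sqrt; [lra|]. unfold X in HJ1. lra. }
  assert (HJ2 : (2 <= J)%nat).
  { apply INR_le. simpl. unfold X in HJ1. lra. }
  (* Chosen so that [A0 (1 + Y1 + 2 B sqrt m) (4 / m)^2] is exactly [QA / m^2 + QB / (m sqrt m)]. *)
  set (Y1 := Y0 + L). 
  set (QA := 16 * A0 * (1 + Y1)). set (QB := 16 * A0 * (2 * B)).
  assert (HQA : 0 <= QA).
  { unfold QA, Y1. apply Rmult_le_pos; lra. }
  assert (HQB : 0 <= QB) by (unfold QB; lra).
  assert (HQtot : 2 * QA / (INR J - 1) + 4 * QB / sqrt (INR J - 1) <= 1).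
  { assert (T1 : 2 * QA / (INR J - 1) <= 1 / 2).
    { apply Rmult_le_reg_r with (INR J - 1); [lra|].
      replace (2 * QA / (INR J - 1) * (INR J - 1)) with (2 * QA) by (field; lra).
      unfold QA, Y1. replace (2 * (16 * A0 * (1 + (Y0 + L)))) with (32 * (A0 * (1 + Y0)) + 32 * (A0 * L)) by ring.
      unfold X in HJ1. lra. }
    assert (T2 : 4 * QB / sqrt (INR J - 1) <= 1 / 2).
    { apply Rmult_le_reg_r with (sqrt (INR J - 1)); [lra|].
      replace (4 * QB / sqrt (INR J - 1) * sqrt (INR J - 1)) with (4 * QB) by (field; lra).
      unfold QB. lra. }
    lra. }
  destruct (He0 1 ltac:(lra)) as [N1 He1].
  exists (N0 + N1 + 2 * J + 3)%nat. intros n Hn w Hw y0 Hy0 Hy0b.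
  specialize (Heps n ltac:(lia)). specialize (He1 n ltac:(lia)).
  specialize (fun k => Hsig n k ltac:(lia)).
  assert (Hn3 : (3 <= n)%nat) by lia.
  pose proof (gate_width_pos n Hn3) as Hd0.
  pose proof (INR_ge_3 n Hn3) as HnR.
  pose proof (gate_width_bounds n Hn3) as [[Hdlo Hdhi] _].
  pose proof PI_RGT_0. pose proof PI2_1 as HPI2. pose proof PI_4 as HPI4.
  assert (HiN : 0 < / INR n) by (apply Rinv_0_lt_compat; lra).
  assert (HdN : / INR n <= gate_width n).
  { eapply Rle_trans; [|exact Hdlo]. unfold Rdiv. rewrite <- (Rmult_1_l (/ INR n)) at 1.
    apply Rmult_le_compat_r; lra. }
  set (d := gate_width n) in *.
  assert (Hdc : RtoC d <> 0%C) by (intro E; apply RtoC_inj in E; lra).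
  set (chi := fun k => (eps k n ^ 2 / d ^ 2 - 1)%C).
  assert (Hchi1 : forall k, (k < n)%nat -> Cmod (chi k) <= (2 * Ms + 1) * / INR n).
  { intros k Hk. specialize (Heps k Hk). specialize (Hsig k Hk). fold d in Heps. fold (chi k) in Heps.
    replace (chi k) with ((chi k - 2 * sigma k n / INR n) + 2 * sigma k n / INR n)%C by ring.
    replace ((2 * Ms + 1) * / INR n) with (1 * / INR n + 2 * Ms / INR n) by (field; lra).
    apply Cmod_plus_le.
    - eapply Rle_trans; [exact Heps|]. apply Rmult_le_compat_r; lra.
    - apply Cmod_div_le; [lra | rewrite Cmod_R, Rabs_right; lra |].
      apply Cmod_mult_le; auto. rewrite Cmod_R, Rabs_right; lra. }
  assert (Hchi2 : forall k, (k < n)%nat -> Cmod (chi k) <= (2 * Ms + 1) * d).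
  { intros k Hk. eapply Rle_trans; [apply Hchi1; auto|]. apply Rmult_le_compat_l; lra. }
  set (y := fun k => gate_coord n k (w k)).
  (* The squared sine is [d^2 / rho^2], the factor of [chi] in the one-step formula. *)
  set (Xs := fun k => (chi k * sin (gate_angle n k) ^ 2)%C).
  assert (HXs : forall k, (k < n)%nat -> Cmod (Xs k) <= (2 * Ms + 1) * / INR n).
  { intros k Hk. unfold Xs. rewrite <- (Rmult_1_r ((2 * Ms + 1) * / INR n)).
    apply Cmod_mult_le; auto. rewrite Cmod_RtoC_sq. pose proof (SIN_bound (gate_angle n k)). nra. }
  set (u := fun k => (y k - csum (gate_drift a n) k - csum Xs k)%C).
  set (Q := gate_potential QA QB n).
  set (Yb := fun k => Y1 + 2 * B * sqrt (INR (Nat.min k (n - k)))).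
  assert (Hm : forall k, (J <= k <= n - J)%nat -> INR J <= INR (Nat.min k (n - k))).
  { intros k Hk. apply le_INR. lia. }
  assert (Hbd : forall k, (J <= k <= n - J)%nat -> Cmod (u k - u J) <= Q k - Q J -> Cmod (y J) <= Y0 -> Cmod (y k) <= Yb k).
  { intros k Hk Hu HyJ.
    pose proof (csum_drift_bound a n J k Hn3 HJ2 Hk) as HS.
    assert (HXk : Cmod (csum Xs k - csum Xs J) <= 2 * Ms + 1).
    { eapply Rle_trans; [apply (csum_bound Xs ((2 * Ms + 1) * / INR n)); [lia|]|].
      - intros j Hj. apply HXs. lia.
      - rewrite <- Rmult_assoc. apply Rmult_le_reg_r with (INR n); [lra|].
        rewrite Rmult_assoc, Rinv_l, Rmult_1_r by lra. rewrite Rmult_comm. apply Rmult_le_compat_l; [lra|].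
        apply le_INR. lia. }
    pose proof (gate_potential_total QA QB n J k HQA HQB HJ2 Hk) as HQ. fold Q in HQ.
    replace (y k) with (y J + (csum (gate_drift a n) k - csum (gate_drift a n) J)
       + (csum Xs k - csum Xs J) + (u k - u J))%C by (unfold u; ring).
    apply Rle_trans with (Y0 + 8 * (2 * Cmod a + 1) * (sqrt (INR (Nat.min k (n - k))) + 1) + (2 * Ms + 1) + 1).
    - apply Cmod_plus_le; [apply Cmod_plus_le; [apply Cmod_plus_le|]|]; auto. lra.
    - unfold Yb, Y1, L, B. lra. }
  assert (Hsc : forall k, (J <= k <= n - J)%nat -> Cmod (y k) <= Yb k -> gate_scale n k * (1 + Cmod (y k)) <= c0).
  { intros k Hk Hyk. pose proof (gate_scale_le n k Hn3 ltac:(lia)) as Hr.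
    pose proof (gate_scale_pos n k Hn3 ltac:(lia)) as Hr0.
    specialize (Hm k Hk). unfold Yb in Hyk. set (m := INR (Nat.min k (n - k))) in *.
    assert (Hm0 : 0 < m) by lra.
    assert (Hsm : 0 < sqrt m) by (apply sqrt_lt_R0; lra).
    assert (HsJm : sqrt (INR J - 1) <= sqrt m) by (apply sqrt_le_1_alt; lra).
    apply Rle_trans with (4 / m * (1 + (Y1 + 2 * B * sqrt m))).
    { apply Rmult_le_compat; try lra. pose proof (Cmod_ge_0 (y k)). lra. }
    assert (T1 : 4 * (1 + Y1) / m <= c0 / 2).
    { apply Rmult_le_reg_r with m; [lra|].
      replace (4 * (1 + Y1) / m * m) with (4 * (1 + Y1)) by (field; lra).
      apply Rle_trans with (c0 / 2 * INR J); [|apply Rmult_le_compat_l; lra].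
      assert (16 * L <= c0 * INR J).
      { replace (16 * L) with (c0 * (16 * L / c0)) by (field; lra). apply Rmult_le_compat_l; [lra|].
        unfold X in HJ1. lra. }
      unfold Y1. lra. }
    assert (T2 : 8 * B / sqrt m <= c0 / 2).
    { apply Rmult_le_reg_r with (sqrt m); [lra|].
      replace (8 * B / sqrt m * sqrt m) with (8 * B) by (field; lra).
      replace (8 * B) with (c0 / 2 * (16 * B / c0)) by (field; lra). apply Rmult_le_compat_l; lra. }
    replace (4 / m * (1 + (Y1 + 2 * B * sqrt m))) with (4 * (1 + Y1) / m + 8 * B / sqrt m).
    - lra.
    - rewrite <- (sqrt_sqrt m) at 1 3 by lra. field. lra. }
  assert (Hwk : forall k, (J <= k <= n - J)%nat -> gate_rel n k (w k) (y k) -> Cmod (y k) <= Yb k -> Cmod (w k) < rr).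
  { intros k Hk [Hg1 Hg2] Hyk. specialize (Hsc k Hk Hyk).
    pose proof (gate_scale_le n k Hn3 ltac:(lia)) as Hr.
    pose proof (gate_scale_pos n k Hn3 ltac:(lia)) as Hr0.
    assert (HY : 0 <= Cmod (y k)) by apply Cmod_ge_0.
    assert (HrY : 0 <= gate_scale n k * Cmod (y k)) by (apply Rmult_le_pos; lra).
    destruct (step_pieces d (gate_point n k) (gate_scale n k) (y k) (w k)) as [_ [_ [H2 _]]]; auto; try lra.
    { apply gate_scale_sq. lia. }
    specialize (Hm k Hk). set (m := INR (Nat.min k (n - k))) in *.
    assert (4 / m < rr / 2).
    { apply Rmult_lt_reg_r with m; [lra|]. replace (4 / m * m) with 4 by (field; lra).
      apply Rlt_le_trans with (rr / 2 * (9 / rr)).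
      - replace (rr / 2 * (9 / rr)) with (9 / 2) by (field; lra). lra.
      - apply Rmult_le_compat_l; [lra|]. unfold X in HJ1. lra. }
    lra. }
  assert (Hst : forall k, (J <= k < n - J)%nat -> gate_rel n k (w k) (y k) -> Cmod (y k) <= Yb k ->
     gate_rel n (S k) (w (S k)) (y (S k)) /\ Cmod (u (S k) - u k) <= Q (S k) - Q k).
  { intros k Hk Hg Hyk. 
    pose proof (Hsc k ltac:(lia) Hyk) as Hs. pose proof (Hwk k ltac:(lia) Hg Hyk) as Hwr.
    destruct Hg as [Hg1 Hg2].
    destruct (Hstep d (gate_point n k) (gate_scale n k) (y k) (w k) (f (w k)) (chi k)) as [y' [H1 [H2 H3]]]; auto.
    { apply gate_scale_pos; auto. lia. }
    { apply gate_scale_sq. lia. }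
    { apply Hchi2. lia. }
    destruct (gate_point_succ n k Hn3 ltac:(lia) ltac:(lia)) as [Hp1 Hp2]. fold d in Hp2.
    assert (Hpc : ((gate_point n k + d ^ 2) / (1 - gate_point n k))%C = RtoC (gate_point n (S k))).
    { rewrite Hp2, RtoC_div, RtoC_plus, RtoC_minus, RtoC_pow by auto. reflexivity. }
    rewrite Hpc in H1, H2.
    assert (Hws : w (S k) = (f (w k) + d ^ 2 + d ^ 2 * chi k)%C).
    { rewrite Hw by auto. unfold chi. field. auto. }
    assert (Hrel : gate_rel n (S k) (w (S k)) y') by (split; [auto | rewrite Hws; exact H2]).
    assert (Hy' : y' = y (S k)) by (apply gate_rel_coord; auto).
    rewrite Hy' in *. split; [exact Hrel|].
    replace (u (S k) - u k)%C with
      (y (S k) - y k - ((a - 1) * gate_point n k - a * d ^ 2 * (gate_point n k / gate_scale n k ^ 2)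
         + chi k * (d ^ 2 / gate_scale n k ^ 2)))%C.
    2: { assert (Hsin : (RtoC d ^ 2 / gate_scale n k ^ 2)%C = (sin (gate_angle n k) ^ 2)%C).
         { rewrite <- !RtoC_pow, <- RtoC_div.
           - f_equal. apply gate_width_scale; auto. lia.
           - pose proof (gate_scale_pos n k Hn3 ltac:(lia)). nra. }
         rewrite Hsin. unfold u, Xs. cbn [csum]. unfold gate_drift. fold d. ring. }
    eapply Rle_trans; [exact H3|].
    pose proof (gate_potential_step QA QB n k HQA HQB ltac:(lia) ltac:(lia)) as HQ. cbv zeta in HQ. fold Q in HQ.
    eapply Rle_trans; [|exact HQ].
    pose proof (gate_scale_le n k Hn3 ltac:(lia)) as Hr.
    pose proof (gate_scale_pos n k Hn3 ltac:(lia)) as Hr0.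
    specialize (Hm k ltac:(lia)). unfold Yb in Hyk. set (m := INR (Nat.min k (n - k))) in *.
    assert (Hm0 : 0 < m) by lra.
    assert (Hsm : 0 < sqrt m) by (apply sqrt_lt_R0; lra).
    apply Rle_trans with (A0 * ((1 + (Y1 + 2 * B * sqrt m)) * (4 / m) ^ 2)).
    { apply Rmult_le_compat_l; [lra|]. apply Rmult_le_compat.
      - pose proof (Cmod_ge_0 (y k)). lra.
      - apply pow2_ge_0.
      - lra.
      - apply pow_incr. lra. }
    right. unfold QA, QB. set (s := sqrt m) in *.
    assert (Hss : m = s * s) by (unfold s; rewrite sqrt_sqrt; lra).
    rewrite Hss. field. lra. }
  assert (HyJ : Cmod (y J) <= Y0).
  { unfold y. rewrite <- (gate_rel_coord n J (w J) y0 Hn3 Hy0). exact Hy0b. }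
  (* The bootstrap proper: the bound on [u k] gives the bound on [y k], which permits the step to
     [S k]. *)
  assert (Hall : forall k, (J <= k)%nat -> (k <= n - J)%nat ->
     gate_rel n k (w k) (y k) /\ Cmod (u k - u J) <= Q k - Q J).
  { intros k Hk. induction Hk as [|k Hk IH]; intros Hkn.
    - split.
      + unfold y. rewrite <- (gate_rel_coord n J (w J) y0 Hn3 Hy0). exact Hy0.
      + replace (u J - u J)%C with (RtoC 0) by ring. rewrite Cmod_0. lra.
    - destruct (IH ltac:(lia)) as [Hg Hu].
      destruct (Hst k ltac:(lia) Hg (Hbd k ltac:(lia) Hu HyJ)) as [Hg' Hu']. split; [exact Hg'|].
      pose proof (Cmod_sub_tri (u (S k)) (u k) (u J)). lra. }
  split.
  - intros k Hk. destruct (Hall k ltac:(lia) ltac:(lia)) as [Hg Hu].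
    pose proof (Hbd k Hk Hu HyJ) as Hyk. split; [exact Hg|]. split; [|apply Hwk; auto].
    fold (y k). eapply Rle_trans; [exact Hyk|]. unfold Yb, Y1.
    pose proof (sqrt_pos (INR (Nat.min k (n - k)))).
    assert ((B + L) * sqrt (INR (Nat.min k (n - k))) <= (32 * A0 * (1 + L) + 128 * A0 * B + B + L + 16 * Ms + 4 * Ms + 1) * sqrt (INR (Nat.min k (n - k)))) by (apply Rmult_le_compat_r; lra).
    assert (B * sqrt (INR (Nat.min k (n - k))) <= L * sqrt (INR (Nat.min k (n - k)))).
    { apply Rmult_le_compat_r; auto. unfold L. lra. }
    lra.
  - intros K HK HKn.
    assert (HuK : Cmod (u (n - K)%nat - u K) <= Q (n - K)%nat - Q K).
    { apply (telescope u Q); [lia|]. intros j Hj.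
      destruct (Hall j ltac:(lia) ltac:(lia)) as [Hg Hu].
      apply Hst; auto; [lia|]. apply Hbd; auto. lia. }
    pose proof (gate_potential_total QA QB n K (n - K) HQA HQB ltac:(lia) ltac:(lia)) as HQ. fold Q in HQ.
    assert (HKr : INR J <= INR K) by (apply le_INR; lia).
    (* The odd sum over [K <= j <= n - K] vanishes but has one term more than the half-open
       interval; that term, at [n - K], is of size [1 / K]. *)
    assert (HD : Cmod (csum (gate_drift a n) (n - K) - csum (gate_drift a n) K) <= B / INR K).
    { assert (E : csum (gate_drift a n) (n + 1 - K) = csum (gate_drift a n) K).
      { apply csum_odd with (m := (n + 1 - 2 * K)%nat); try lia.
        intros j Hj. apply gate_drift_reflect. auto. }
      rewrite <- E. replace (n + 1 - K)%nat with (S (n - K)) by lia. cbn [csum].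
      replace (csum (gate_drift a n) (n - K) - (csum (gate_drift a n) (n - K) + gate_drift a n (n - K)))%C
        with (- gate_drift a n (n - K))%C by ring.
      rewrite Cmod_opp. pose proof (gate_drift_bound a n (n - K) Hn3 ltac:(lia)) as Hb.
      rewrite Nat.min_r in Hb by lia. replace (n - (n - K))%nat with K in Hb by lia. exact Hb. }
    set (ph := fun k => (/ INR n * (sigma k n * G (INR (k + 1) / INR n)))%C).
    assert (Hph : phase sigma n = csum ph n) by (apply phase_csum; lia).
    assert (HG : forall k, G (INR (k + 1) / INR n) = 2 * sin (gate_angle n (S k)) ^ 2).
    { intro k. unfold G, gate_angle. replace (k + 1)%nat with (S k) by lia. reflexivity. }
    assert (HNc : RtoC (INR n) <> 0%C) by (intro E; apply RtoC_inj in E; lra).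
    assert (Hphb : forall k, (k < n)%nat -> Cmod (ph k) <= 2 * Ms * / INR n).
    { intros k Hk. unfold ph. rewrite HG. rewrite <- RtoC_inv by lra.
      replace (2 * Ms * / INR n) with (/ INR n * (Ms * 2)) by ring.
      apply Cmod_mult_le; [rewrite Cmod_R, Rabs_right; lra|]. apply Cmod_mult_le; auto.
      rewrite Cmod_R. pose proof (SIN_bound (gate_angle n (S k))). rewrite Rabs_right; nra. }
    (* Two discrepancies: [chi] against [2 sigma / n], and the angle at [k] against the angle at
       [k + 1], where [G] is evaluated. The Lipschitz bound on the squared sine makes the second
       [O(1 / n^2)]. *)
    assert (HXp : forall k, (k < n)%nat -> Cmod (Xs k - ph k) <= (e n + 16 * Ms / INR n) * / INR n).
    { intros k Hk. 
      replace (Xs k - ph k)%C with ((chi k - 2 * sigma k n / INR n) * (sin (gate_angle n k) ^ 2)%R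
        + 2 * sigma k n / INR n * (sin (gate_angle n k) ^ 2 - sin (gate_angle n (S k)) ^ 2)%R)%C.
      2: { unfold Xs, ph. rewrite HG, RtoC_minus, RtoC_mult, !RtoC_pow. field. auto. }
      replace ((e n + 16 * Ms / INR n) * / INR n) with (e n / INR n * 1 + 2 * Ms / INR n * (8 / INR n)) by (field; lra).
      apply Cmod_plus_le; apply Cmod_mult_le.
      - apply (Heps k Hk).
      - rewrite Cmod_R. pose proof (SIN_bound (gate_angle n k)). rewrite Rabs_right; nra.
      - apply Cmod_div_le; [lra | rewrite Cmod_R, Rabs_right; lra |].
        apply Cmod_mult_le; auto. rewrite Cmod_R, Rabs_right; lra.
      - rewrite Cmod_R. eapply Rle_trans; [apply sin_sq_lipschitz|].
        rewrite gate_angle_succ. rewrite <- Rabs_Ropp.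
        replace (- (gate_angle n k - (gate_angle n k + PI / INR n))) with (PI / INR n) by ring.
        rewrite Rabs_right by (apply Rle_ge, Rdiv_le_0_compat; lra).
        apply Rmult_le_reg_r with (INR n); [lra|].
        replace (2 * (PI / INR n) * INR n) with (2 * PI) by (field; lra).
        replace (8 / INR n * INR n) with 8 by (field; lra). lra. }
    assert (HnKr : 0 <= INR (n - K - K) <= INR n) by (split; [apply pos_INR | apply le_INR; lia]).
    (* Read off from the bound that [e n] provides at [k = 0]. *)
    assert (Hen : 0 <= e n).
    { specialize (Heps 0%nat ltac:(lia)). pose proof (Cmod_ge_0 (eps 0%nat n ^ 2 / d ^ 2 - 1 - 2 * sigma 0%nat n / INR n)) as H0.
      assert (Hx : 0 <= e n / INR n) by (fold d in Heps; lra).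
      apply Rmult_le_compat_r with (r := INR n) in Hx; [|lra].
      replace (e n / INR n * INR n) with (e n) in Hx by (field; lra). lra. }
    assert (H16 : 0 <= 16 * Ms / INR n) by (apply Rdiv_le_0_compat; lra).
    assert (Hmid : Cmod (csum Xs (n - K) - csum Xs K - (csum ph (n - K) - csum ph K)) <= e n + 16 * Ms / INR n).
    { replace (csum Xs (n - K) - csum Xs K - (csum ph (n - K) - csum ph K))%C with
       ((fun j => csum Xs j - csum ph j) (n - K)%nat - (fun j => csum Xs j - csum ph j) K)%C by (cbv beta; ring).
      eapply Rle_trans.
      - apply (telescope (fun j => csum Xs j - csum ph j)%C (fun j => INR j * ((e n + 16 * Ms / INR n) * / INR n))); [lia|].
        intros j Hj. cbn [csum]. rewrite S_INR.
        replace (csum Xs j + Xs j - (csum ph j + ph j) - (csum Xs j - csum ph j))%C with (Xs j - ph j)%C by ring.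
        specialize (HXp j ltac:(lia)). lra.
      - rewrite <- Rmult_minus_distr_r. rewrite <- minus_INR by lia.
        apply Rle_trans with (INR n * ((e n + 16 * Ms / INR n) * / INR n)).
        + apply Rmult_le_compat_r; [|lra]. apply Rmult_le_pos; lra.
        + right. field. lra. }
    (* The phase also contains the first [K] and the last [K] indices, whose terms are of size
       [1 / n]. *)
    assert (Hlo : Cmod (csum ph K - csum ph 0) <= INR K * (2 * Ms * / INR n)).
    { replace (INR K) with (INR (K - 0)) by (f_equal; lia). apply csum_bound; [lia|].
      intros j Hj. apply Hphb. lia. }
    assert (Hhi : Cmod (csum ph n - csum ph (n - K)) <= INR K * (2 * Ms * / INR n)).
    { replace K with (n - (n - K))%nat at 2 by lia. apply csum_bound; [lia|].
      intros j Hj. apply Hphb. lia. }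
    fold (y (n - K)%nat). fold (y K). rewrite Hph.
    replace (y (n - K)%nat - y K - csum ph n)%C with
     ((u (n - K)%nat - u K) + (csum (gate_drift a n) (n - K) - csum (gate_drift a n) K)
       + (csum Xs (n - K) - csum Xs K - (csum ph (n - K) - csum ph K))
       - (csum ph K - csum ph 0) - (csum ph n - csum ph (n - K)))%C
     by (unfold u; simpl; ring).
    eapply Rle_trans.
    { apply Cmod_minus_le; [apply Cmod_minus_le; [apply Cmod_plus_le; [apply Cmod_plus_le|]|]|];
      [eapply Rle_trans; [exact HuK | exact HQ] | exact HD | exact Hmid | exact Hlo | exact Hhi]. }
    assert (HK1 : 0 < INR K - 1) by lra.
    assert (HsK : 0 < sqrt (INR K - 1)) by (apply sqrt_lt_R0; lra).
    set (v1 := / (INR K - 1)). assert (Hv1 : 0 < v1) by (apply Rinv_0_lt_compat; lra).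
    set (v2 := / sqrt (INR K - 1)). assert (Hv2 : 0 < v2) by (apply Rinv_0_lt_compat; lra).
    set (v3 := INR K * / INR n). 
    assert (Hv3 : 0 <= v3) by (apply Rmult_le_pos; lra).
    set (v4 := / INR n) in *.
    assert (Hv43 : v4 <= v3).
    { unfold v3. rewrite <- (Rmult_1_l v4) at 1. apply Rmult_le_compat_r; lra. }
    assert (HBK : B / INR K <= B * v1).
    { apply Rmult_le_compat_l; [lra|]. apply Rinv_le_contravar; lra. }
    set (AA := 32 * A0 * (1 + L) + 128 * A0 * B + B + L + 16 * Ms + 4 * Ms + 1).
    replace (2 * QA / (INR K - 1)) with (32 * A0 * (1 + Y1) * v1) by (unfold QA, v1; field; lra).
    replace (4 * QB / sqrt (INR K - 1)) with (128 * A0 * B * v2) by (unfold QB, v2; field; lra).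
    replace (16 * Ms / INR n) with (16 * Ms * v4) by (unfold v4; field; lra).
    replace (INR K * (2 * Ms * v4)) with (2 * Ms * v3) by (unfold v3; ring).
    replace (AA * (1 + Y0) / (INR K - 1)) with (AA * (1 + Y0) * v1) by (unfold v1; field; lra).
    replace (AA / sqrt (INR K - 1)) with (AA * v2) by (unfold v2; field; lra).
    replace (AA * INR K / INR n) with (AA * v3) by (unfold v3, v4; field; lra).
    assert (F1 : (32 * A0 * (1 + Y1) + B) * v1 <= AA * (1 + Y0) * v1).
    { apply Rmult_le_compat_r; [lra|]. unfold AA, Y1.
      replace (32 * A0 * (1 + (Y0 + L)) + B) with (32 * A0 * (1 + Y0) + 32 * (A0 * L) + B) by ring.
      assert (0 <= A0 * L * Y0) by (apply Rmult_le_pos; lra).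
      assert (0 <= A0 * B * Y0) by (apply Rmult_le_pos; lra).
      assert (0 <= B * Y0) by (apply Rmult_le_pos; lra).
      assert (0 <= L * Y0) by (apply Rmult_le_pos; lra).
      assert (0 <= Ms * Y0) by (apply Rmult_le_pos; lra). lra. }
    assert (F2 : 128 * A0 * B * v2 <= AA * v2) by (apply Rmult_le_compat_r; unfold AA; lra).
    assert (F3 : (16 * Ms + 4 * Ms) * v3 <= AA * v3) by (apply Rmult_le_compat_r; unfold AA; lra).
    assert (F4 : 16 * Ms * v4 <= 16 * Ms * v3) by (apply Rmult_le_compat_l; lra).
    lra.
Qed.

(** * Logarithm, petals and Fatou coordinates *)

Lemma Clog_scale (K : R) (w : C) : 0 < K -> w <> 0%C ->
  Clog (K * w) = (RtoC (ln K) + Clog w)%C.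
Proof.
  intros HK Hw. assert (Hm : 0 < Cmod w) by (apply Cmod_gt_0; auto).
  assert (Hc : Cmod (K * w) = K * Cmod w) by (rewrite Cmod_mult, Cmod_R, Rabs_right; lra).
  assert (Hre : Re (K * w) = K * Re w) by (destruct w; unfold Re; simpl; ring).
  assert (Him : Im (K * w) = K * Im w) by (destruct w; unfold Im; simpl; ring).
  unfold Clog. rewrite Hc, ln_mult by auto.
  assert (Ha : Carg (K * w) = Carg w).
  { unfold Carg. rewrite Hc, Hre, Him.
    replace (K * Re w / (K * Cmod w)) with (Re w / Cmod w) by (field; lra).
    destruct (Rle_dec 0 (K * Im w)), (Rle_dec 0 (Im w)); auto; exfalso; nra. }
  rewrite Ha. unfold Cplus, RtoC. simpl. f_equal. ring.
Qed.

Lemma Cmod_pair_le (x y : R) : Cmod (x, y) <= Rabs x + Rabs y.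
Proof.
  unfold Cmod. simpl. rewrite <- (sqrt_square (Rabs x + Rabs y)).
  - apply sqrt_le_1_alt. pose proof (Rabs_pos x). pose proof (Rabs_pos y).
    pose proof (Rsqr_abs x) as E1. pose proof (Rsqr_abs y) as E2. unfold Rsqr in *. nra.
  - pose proof (Rabs_pos x). pose proof (Rabs_pos y). lra.
Qed.

Lemma Re_div_Cmod_bound (z : C) : z <> 0%C -> -1 <= Re z / Cmod z <= 1.
Proof.
  intros Hz. assert (Hm : 0 < Cmod z) by (apply Cmod_gt_0; auto).
  pose proof (re_le_Cmod z) as H. apply Rabs_le_between in H.
  split; apply Rmult_le_reg_r with (Cmod z); auto;
    replace (Re z / Cmod z * Cmod z) with (Re z) by (field; lra); lra.
Qed.

Lemma Carg_le_acos (z : C) : Rabs (Carg z) = acos (Re z / Cmod z).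
Proof.
  unfold Carg. pose proof (acos_bound (Re z / Cmod z)).
  destruct (Rle_dec 0 (Im z)); [|rewrite Rabs_Ropp]; apply Rabs_right; lra.
Qed.

(** Continuity at [1] is the only continuity of the logarithm that is used: [Clog_scale] moves the
    relevant points there. *)
Lemma Clog_near_1 (e : R) : 0 < e -> exists d, 0 < d /\
  forall z, Cmod (z - 1) < d -> Cmod (Clog z) < e.
Proof.
  intros He. pose proof PI_RGT_0.
  set (e1 := Rmin (e / 2) 1). assert (He1 : 0 < e1) by (apply Rmin_pos; lra).
  assert (He1' : e1 <= 1) by apply Rmin_r.
  assert (He1'' : e1 <= e / 2) by apply Rmin_l.
  pose proof PI2_1.
  assert (Hcos : cos e1 < 1).
  { rewrite <- cos_0. apply cos_decreasing_1; lra. }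
  set (d := Rmin (1 / 2) (Rmin (e / 8) ((1 - cos e1) / 4))).
  assert (D1 : d <= 1 / 2) by apply Rmin_l.
  assert (D2 : d <= e / 8) by (eapply Rle_trans; [apply Rmin_r | apply Rmin_l]).
  assert (D3 : d <= (1 - cos e1) / 4) by (eapply Rle_trans; [apply Rmin_r | apply Rmin_r]).
  assert (D0 : 0 < d) by (repeat apply Rmin_pos; lra).
  exists d. split; [exact D0|]. intros z Hz.
  pose proof (Cmod_lower z 1) as U1. pose proof (Cmod_lower 1 z) as U2.
  rewrite (Cmod_sub_sym 1 z) in U2. rewrite Cmod_1 in *.
  assert (Hre : 1 - d <= Re z).
  { pose proof (re_le_Cmod (z - 1)) as Hr. destruct z as [x y]. unfold Re in *. simpl in *.
    apply Rabs_le_between in Hr. lra. }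
  assert (Hz0 : z <> 0%C) by (apply Cmod_pos_neq; lra).
  unfold Clog. eapply Rle_lt_trans; [apply Cmod_pair_le|].
  rewrite Carg_le_acos.
  assert (Hln : Rabs (ln (Cmod z)) <= 2 * d).
  { apply Rabs_le. split.
    - rewrite <- (Ropp_involutive (ln (Cmod z))). apply Ropp_le_contravar.
      rewrite <- ln_Rinv by lra.
      assert (Hi : / Cmod z <= 1 + 2 * d).
      { apply Rmult_le_reg_r with (Cmod z); [lra|]. rewrite Rinv_l by lra. nra. }
      apply Rle_trans with (ln (1 + 2 * d)).
      + apply ln_le; [apply Rinv_0_lt_compat; lra | auto].
      + rewrite <- (ln_exp (2 * d)) at 2. apply ln_le; [lra|]. left. apply exp_ineq1. lra.
    - apply Rle_trans with (ln (1 + 2 * d)).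
      + apply ln_le; lra.
      + rewrite <- (ln_exp (2 * d)) at 2. apply ln_le; [lra|]. left. apply exp_ineq1. lra. }
  assert (Hac : acos (Re z / Cmod z) < e1).
  { apply Rnot_le_lt. intro Hle.
    pose proof (acos_bound (Re z / Cmod z)) as Hb.
    assert (Hc : cos (acos (Re z / Cmod z)) <= cos e1) by (apply cos_decr_1; lra).
    rewrite cos_acos in Hc by (apply Re_div_Cmod_bound; auto).
    assert (1 - 2 * d <= Re z / Cmod z).
    { apply Rmult_le_reg_r with (Cmod z); [lra|].
      replace (Re z / Cmod z * Cmod z) with (Re z) by (field; lra). nra. }
    lra. }
  lra.
Qed.

(** From [ln s <= s] at [s = k1 / |w|]: any slope [k1] can be reached at the price of the constant
    [ln k1], which the other half of [kappa / |w|] absorbs together with the argument. *)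
Lemma Clog_sublinear (A kappa : R) : 0 <= A -> 0 < kappa -> exists d, 0 < d /\
  forall w : C, w <> 0%C -> Cmod w < d -> A * Cmod (Clog w) + A <= kappa * / Cmod w.
Proof.
  intros HA Hk. pose proof PI_RGT_0.
  set (k1 := kappa / (2 * (A + 1))).
  assert (Hk1 : 0 < k1) by (apply Rdiv_lt_0_compat; lra).
  set (B := A * (Rabs (ln k1) + PI) + A).
  assert (HB : 0 <= B).
  { unfold B. pose proof (Rabs_pos (ln k1)). assert (0 <= A * (Rabs (ln k1) + PI)) by (apply Rmult_le_pos; lra). lra. }
  exists (Rmin 1 (kappa / (2 * (B + 1)))). split.
  { apply Rmin_pos; [lra|]. apply Rdiv_lt_0_compat; lra. }
  intros w Hw0 Hwd.
  assert (Hm : 0 < Cmod w) by (apply Cmod_gt_0; auto).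
  assert (H1 : Cmod w < 1) by (eapply Rlt_le_trans; [exact Hwd | apply Rmin_l]).
  assert (H2 : Cmod w < kappa / (2 * (B + 1))) by (eapply Rlt_le_trans; [exact Hwd | apply Rmin_r]).
  set (t := / Cmod w) in *. assert (Ht : 1 < t) by (unfold t; rewrite <- Rinv_1; apply Rinv_lt_contravar; lra).
  assert (HBt : B + 1 <= kappa / 2 * t).
  { apply Rmult_le_reg_r with (Cmod w); [lra|]. unfold t. rewrite Rmult_assoc, Rinv_l by lra.
    apply Rmult_lt_compat_r with (r := B + 1) in H2; [|lra].
    replace (kappa / (2 * (B + 1)) * (B + 1)) with (kappa / 2) in H2 by (field; lra). lra. }
  assert (Hln : Rabs (ln (Cmod w)) <= k1 * t + Rabs (ln k1)).
  { assert (Hneg : ln (Cmod w) <= 0) by (rewrite <- ln_1; apply ln_le; lra).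
    assert (Hl : - ln (Cmod w) <= k1 * t - ln k1).
    { rewrite <- ln_Rinv by lra. fold t.
      assert (Hs : ln (k1 * t) <= k1 * t).
      { rewrite <- (ln_exp (k1 * t)) at 2. apply ln_le; [nra|]. left.
        assert (0 < k1 * t) by nra. pose proof (exp_ineq1 (k1 * t)). lra. }
      rewrite ln_mult in Hs by lra. lra. }
    rewrite Rabs_left1 by auto. pose proof (Rle_abs (- ln k1)). rewrite Rabs_Ropp in *. lra. }
  assert (HC : Cmod (Clog w) <= k1 * t + Rabs (ln k1) + PI).
  { unfold Clog. eapply Rle_trans; [apply Cmod_pair_le|]. rewrite Carg_le_acos.
    pose proof (acos_bound (Re w / Cmod w)). lra. }
  apply Rmult_le_compat_l with (r := A) in HC; auto.
  assert (Hak : A * (k1 * t) <= kappa / 2 * t).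
  { replace (A * (k1 * t)) with (A * k1 * t) by ring. apply Rmult_le_compat_r; [lra|].
    unfold k1. apply Rmult_le_reg_r with (A + 1); [lra|].
    replace (A * (kappa / (2 * (A + 1))) * (A + 1)) with (A * (kappa / 2)) by (field; lra). nra. }
  unfold B in HBt. lra.
Qed.

Lemma Cmod_lt_iff (z : C) (r : R) : 0 < r -> (Cmod z < r <-> fst z ^ 2 + snd z ^ 2 < r ^ 2).
Proof.
  intros Hr. unfold Cmod.
  assert (H0 : 0 <= fst z ^ 2 + snd z ^ 2) by nra.
  split; intros H.
  - pose proof (sqrt_sqrt _ H0). pose proof (sqrt_pos (fst z ^ 2 + snd z ^ 2)). nra.
  - rewrite <- (sqrt_pow2 r) by lra. apply sqrt_lt_1_alt. lra.
Qed.

Lemma Re_inv (w : C) : Re (/ w) = fst w / (fst w ^ 2 + snd w ^ 2).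
Proof. reflexivity. Qed.

Lemma C_neq_0_sq (w : C) : w <> 0%C <-> 0 < fst w ^ 2 + snd w ^ 2.
Proof.
  split; intros H.
  - apply Cmod_gt_0 in H. unfold Cmod in H. 
    destruct (Rle_lt_dec (fst w ^ 2 + snd w ^ 2) 0) as [H1 | H1]; [|exact H1].
    rewrite sqrt_neg_0 in H by auto. lra.
  - intros ->. simpl in H. lra.
Qed.

(** Inversion carries a disc whose boundary passes through [0] to a half-plane, so the dynamics in
    the petals can be read from [Re (1 / w)]. *)
Lemma attracting_petal_iff (r : R) (w : C) : 0 < r ->
  (attracting_petal r w <-> w <> 0%C /\ Re (/ w) < - / (2 * r)).
Proof.
  intros Hr. unfold attracting_petal. rewrite Cmod_lt_iff by auto. rewrite C_neq_0_sq, Re_inv.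
  destruct w as [x y]. simpl fst. simpl snd.
  assert (Hi : 0 < / (2 * r)) by (apply Rinv_0_lt_compat; lra).
  assert (E : 2 * r * / (2 * r) = 1) by (field; lra).
  split.
  - intros H. assert (Hp : 0 < x ^ 2 + y ^ 2) by nra. split; [exact Hp|].
    apply Rmult_lt_reg_r with (2 * r * (x ^ 2 + y ^ 2)); [nra|].
    replace (x / (x ^ 2 + y ^ 2) * (2 * r * (x ^ 2 + y ^ 2))) with (2 * r * x) by (field; lra).
    replace (- / (2 * r) * (2 * r * (x ^ 2 + y ^ 2))) with (- (x ^ 2 + y ^ 2)) by (field; lra). nra.
  - intros [Hp H]. 
    apply Rmult_lt_compat_r with (r := 2 * r * (x ^ 2 + y ^ 2)) in H; [|nra].
    replace (x / (x ^ 2 + y ^ 2) * (2 * r * (x ^ 2 + y ^ 2))) with (2 * r * x) in H by (field; lra).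
    replace (- / (2 * r) * (2 * r * (x ^ 2 + y ^ 2))) with (- (x ^ 2 + y ^ 2)) in H by (field; lra). nra.
Qed.

Lemma repelling_petal_iff (r : R) (w : C) : 0 < r ->
  (repelling_petal r w <-> w <> 0%C /\ / (2 * r) < Re (/ w)).
Proof.
  intros Hr.
  assert (E : repelling_petal r w <-> attracting_petal r (- w)).
  { unfold repelling_petal, attracting_petal.
    replace (- w + r)%C with (- (w - r))%C by ring. rewrite Cmod_opp. tauto. }
  rewrite E, attracting_petal_iff by auto.
  assert (E2 : Re (/ - w) = - Re (/ w)).
  { rewrite !Re_inv. destruct w as [x y]. simpl fst. simpl snd. unfold Rdiv.
    replace ((- x) ^ 2 + (- y) ^ 2) with (x ^ 2 + y ^ 2) by ring. ring. }
  rewrite E2. split; intros [H1 H2]; split; try lra; intro H; apply H1.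
  - rewrite H. ring.
  - replace w with (- - w)%C by ring. rewrite H. ring.
Qed.

Lemma Cmod_petal_lt (r : R) (w : C) : attracting_petal r w \/ repelling_petal r w -> Cmod w < 2 * r.
Proof.
  unfold attracting_petal, repelling_petal. intros [H | H].
  - assert (Hr : 0 < r) by (pose proof (Cmod_ge_0 (w + r)); lra).
    pose proof (Cmod_sub_le (w + r) r) as T. replace (w + r - r)%C with w in T by ring.
    rewrite Cmod_R, Rabs_right in T by lra. lra.
  - assert (Hr : 0 < r) by (pose proof (Cmod_ge_0 (w - r)); lra).
    pose proof (Cmod_triangle (w - r) r) as T. replace (w - r + r)%C with w in T by ring.
    rewrite Cmod_R, Rabs_right in T by lra. lra.
Qed.

Lemma disc_open (c : C) (r : R) : open (T := C_UniformSpace) (fun w => Cmod (w - c) < r).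
Proof.
  intros z Hz. apply locally_Cmod. exists (r - Cmod (z - c)). split; [lra|].
  intros w Hw. pose proof (Cmod_sub_tri w z c). lra.
Qed.

Lemma repelling_petal_open (r : R) : open (T := C_UniformSpace) (repelling_petal r).
Proof. apply disc_open. Qed.

Lemma attracting_petal_open (r : R) : open (T := C_UniformSpace) (attracting_petal r).
Proof.
  intros z Hz. unfold attracting_petal in *.
  apply locally_Cmod. exists (r - Cmod (z + r)). split; [lra|].
  intros w Hw. pose proof (Cmod_triangle (w - z) (z + r)) as T.
  replace (w - z + (z + r))%C with (w + r)%C in T by ring. lra.
Qed.

Lemma within_limit (D : C -> Prop) (g : C -> C) :
  filterlim g (within D (locally (T := C_UniformSpace) (RtoC 0)))
    (locally (T := C_UniformSpace) (RtoC 0)) ->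
  forall e, 0 < e -> exists d, 0 < d /\
    forall w, D w -> Cmod w < d -> Cmod (g w) < e.
Proof.
  intros H e He.
  assert (Hl : locally (T := C_UniformSpace) (RtoC 0) (fun y => Cmod y < e)).
  { apply locally_Cmod. exists e. split; [exact He|]. intros w Hw.
    replace (w - 0)%C with w in Hw by ring. exact Hw. }
  specialize (H _ Hl). apply (proj1 (locally_Cmod _ _)) in H.
  destruct H as [d [Hd H]]. exists d. split; [exact Hd|]. intros w Dw Hw. apply H; auto.
  replace (w - 0)%C with w by ring. exact Hw.
Qed.

(** Since [f w = w (1 + s)] with [s = w + O(w^2)], the coordinate [1 / w] decreases by
    [s / (w (1 + s)) = 1 + O(w)]. *)
Lemma inverse_coordinate_step (f : C -> C) (a : C) (rr M : R) :
  0 < rr -> 0 <= M ->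
  (forall w, Cmod w < rr -> Cmod (f w - (w + w ^ 2 + a * w ^ 3)) <= M * Cmod w ^ 4) ->
  exists rho C0, 0 < rho /\ 0 < C0 /\ forall w : C, w <> 0%C -> Cmod w < rho ->
    f w <> 0%C /\ Cmod (/ f w - / w + 1) <= C0 * Cmod w.
Proof.
  intros Hrr HM Hf. pose proof (Cmod_ge_0 a) as Ha. set (Cb := Cmod a + M).
  assert (HCb : 0 <= Cb) by (unfold Cb; lra).
  assert (Hi : 0 < / (4 * (1 + Cb))) by (apply Rinv_0_lt_compat; lra).
  exists (Rmin rr (/ (4 * (1 + Cb)))), (2 * (2 * Cb + 1)).
  split; [apply Rmin_pos; lra|]. split; [lra|].
  intros w Hw0 Hw.
  assert (H1 : Cmod w < rr) by (eapply Rlt_le_trans; [exact Hw | apply Rmin_l]).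
  assert (H2 : Cmod w < / (4 * (1 + Cb))) by (eapply Rlt_le_trans; [exact Hw | apply Rmin_r]).
  assert (Hm : 0 < Cmod w) by (apply Cmod_gt_0; auto).
  specialize (Hf w H1). set (m := Cmod w) in *.
  assert (H3 : m * (4 * (1 + Cb)) < 1).
  { apply Rmult_lt_compat_r with (r := 4 * (1 + Cb)) in H2; [|lra]. rewrite Rinv_l in H2 by lra. exact H2. }
  assert (H4 : m <= 1 / 4) by nra.
  set (b := ((f w - (w + w ^ 2 + a * w ^ 3)) / w + a * w ^ 2)%C).
  assert (Hb : Cmod b <= Cb * m ^ 2).
  { unfold b. apply Rle_trans with (M * m ^ 4 / m + Cmod a * m ^ 2).
    - apply Cmod_plus_le.
      + apply Cmod_div_le; auto. apply Rle_refl.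
      + rewrite Cmod_mult, Cmod_pow. apply Rle_refl.
    - replace (M * m ^ 4 / m) with (M * m ^ 2 * m) by (field; lra). unfold Cb.
      assert (M * m ^ 2 * m <= M * m ^ 2 * 1) by (apply Rmult_le_compat_l; [apply Rmult_le_pos; nra | lra]). lra. }
  assert (Hfw : f w = (w * (1 + (w + b)))%C) by (unfold b; field; auto).
  assert (Hs : Cmod (w + b) <= 1 / 2).
  { eapply Rle_trans; [apply Cmod_triangle|]. fold m.
    assert (Cb * m ^ 2 <= 1 / 4) by (replace (Cb * m ^ 2) with (m * Cb * m) by ring; nra). lra. }
  assert (Hs2 : Cmod (w + b) <= m + Cb * m ^ 2) by (eapply Rle_trans; [apply Cmod_triangle|]; fold m; lra).
  set (s := (w + b)%C) in *.
  assert (H1s : 1 / 2 <= Cmod (1 + s)).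
  { pose proof (Cmod_one_sub (- s)%C (1 / 2)) as T. rewrite Cmod_opp in T. specialize (T Hs).
    replace (1 - - s)%C with (1 + s)%C in T by ring. lra. }
  assert (H1s0 : (1 + s <> 0)%C) by (apply Cmod_pos_neq; lra).
  split.
  - rewrite Hfw. apply Cmult_neq_0; auto.
  - rewrite Hfw. replace (/ (w * (1 + s)) - / w + 1)%C with ((w * s - b) / ((1 + s) * w))%C
      by (unfold s in *; field; auto).
    eapply Rle_trans.
    + apply (Cmod_div_le _ _ (1 / 2 * m) (m * (m + Cb * m ^ 2) + Cb * m ^ 2)).
      * nra.
      * rewrite Cmod_mult. fold m. apply Rmult_le_compat_r; lra.
      * apply Cmod_minus_le; auto. apply Cmod_mult_le; auto. apply Rle_refl.
    + replace ((m * (m + Cb * m ^ 2) + Cb * m ^ 2) / (1 / 2 * m)) with (2 * m * (1 + Cb * m + Cb)) by (field; lra).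
      replace (2 * (2 * Cb + 1) * m) with (2 * m * (1 + Cb * 1 + Cb)) by ring.
      apply Rmult_le_compat_l; [lra|]. assert (Cb * m <= Cb * 1) by (apply Rmult_le_compat_l; lra). lra.
Qed.

Lemma iota_unique (P : C -> Prop) (z : C) :
  P z -> (forall x y, P x -> P y -> x = y) -> iota (T := C_CompleteNormedModule) P = z.
Proof.
  intros Hz Hu. 
  assert (Hp : P (iota (T := C_CompleteNormedModule) P)).
  { apply (iota_correct (V := C_CompleteNormedModule)). exists z. split; [exact Hz|].
    intros x Hx. apply Hu; auto. }
  apply Hu; auto.
Qed.

(** By the functional equation [phi (f^k w) - k] no longer changes once the orbit is in the
    petal. *)
Lemma attracting_extension_eq (f : C -> C) (r : R) (phi : C -> C) (w : C) (m : nat) :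
  (forall k, (m <= k)%nat -> attracting_petal r (Nat.iter k f w)) ->
  (forall w, attracting_petal r w -> phi (f w) = (phi w + 1)%C) ->
  forall k, (m <= k)%nat -> attracting_extension f r phi w = (phi (Nat.iter k f w) - INR k)%C.
Proof.
  intros Hp Hphi k Hk.
  assert (Hs : forall j, (k <= j)%nat -> (phi (Nat.iter j f w) - INR j)%C = (phi (Nat.iter k f w) - INR k)%C).
  { intros j Hj. induction Hj as [|j Hj IH]; [reflexivity|].
    simpl Nat.iter. rewrite Hphi by (apply Hp; lia). rewrite <- IH, S_INR, RtoC_plus. ring. }
  apply iota_unique.
  - exists k. intros j Hj. split; [apply Hp; lia|]. symmetry. apply Hs. exact Hj.
  - intros x y [N1 H1] [N2 H2]. destruct (H1 (N1 + N2)%nat ltac:(lia)) as [_ ->].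
    destruct (H2 (N1 + N2)%nat ltac:(lia)) as [_ ->]. reflexivity.
Qed.

(** Two candidates are compared at one late index, where injectivity of [phi] makes their petal
    points equal. *)
Lemma inverse_extension_eq (U : C -> Prop) (f : C -> C) (r : R) (phi : C -> C) (zeta z : C) :
  injective_on (repelling_petal r) phi ->
  is_inverse_extension U f r phi zeta z -> inverse_extension U f r phi zeta = z.
Proof.
  intros Hi Hz. apply iota_unique; [exact Hz|].
  intros x y [N1 H1] [N2 H2].
  destruct (H1 (N1 + N2)%nat ltac:(lia)) as [p [Hp [Ep [_ ->]]]].
  destruct (H2 (N1 + N2)%nat ltac:(lia)) as [q [Hq [Eq [_ ->]]]].
  f_equal. apply Hi; auto. congruence.
Qed.

Lemma perturbed_orbit_zero (f : C -> C) (w : C) (m : nat) :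
  perturbed_orbit f (fun _ => 0%C) w m = Nat.iter m f w.
Proof. induction m as [|m IH]; [reflexivity|]. simpl. rewrite IH. ring. Qed.

Lemma perturbed_orbit_add (f : C -> C) (e : nat -> C) (w : C) (m j : nat) :
  perturbed_orbit f e w (m + j) = perturbed_orbit f (fun i => e (m + i)%nat) (perturbed_orbit f e w m) j.
Proof.
  induction j as [|j IH].
  - rewrite Nat.add_0_r. reflexivity.
  - rewrite Nat.add_succ_r. simpl. rewrite IH. reflexivity.
Qed.

(** Continuity over a fixed number of steps, jointly in the starting point and the perturbation.
    With [e = 0] it gives the continuity of the iterates themselves. *)
Lemma perturbed_orbit_continuity (U : C -> Prop) (f : C -> C) (m : nat) (q : C) :
  open (T := C_UniformSpace) U -> holomorphic_on U f -> iter_defined U f m q ->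
  forall eta, 0 < eta -> exists d, 0 < d /\ forall w e, Cmod (w - q) < d ->
    (forall j, (j < m)%nat -> Cmod (e j ^ 2) < d) ->
    (forall j, (j < m)%nat -> U (perturbed_orbit f e w j)) /\
    Cmod (perturbed_orbit f e w m - Nat.iter m f q) < eta.
Proof.
  intros HU Hf. induction m as [|m IH]; intros Hq eta Heta.
  - exists eta. split; [exact Heta|]. intros w e Hw _. split; [lia|]. exact Hw.
  - assert (Um : U (Nat.iter m f q)) by (apply Hq; lia).
    destruct (holomorphic_continuous U f _ Hf Um (eta / 2)) as [d1 [Hd1 H1]]; [lra|].
    destruct (proj1 (locally_Cmod _ _) (HU _ Um)) as [d2 [Hd2 H2]].
    destruct (IH ltac:(intros j Hj; apply Hq; lia) (Rmin d1 d2)) as [d3 [Hd3 H3]].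
    { apply Rmin_pos; auto. }
    exists (Rmin d3 (eta / 2)). split; [apply Rmin_pos; lra|].
    intros w e Hw He.
    destruct (H3 w e) as [H4 H5].
    { eapply Rlt_le_trans; [exact Hw | apply Rmin_l]. }
    { intros j Hj. eapply Rlt_le_trans; [apply He; lia | apply Rmin_l]. }
    split.
    + intros j Hj. destruct (Nat.eq_dec j m) as [-> | Hne]; [|apply H4; lia].
      apply H2. eapply Rlt_le_trans; [exact H5 | apply Rmin_r].
    + simpl. specialize (H1 _ (Rlt_le_trans _ _ _ H5 (Rmin_l _ _))).
      assert (Hem : Cmod (e m ^ 2) < eta / 2) by (eapply Rlt_le_trans; [apply He; lia | apply Rmin_r]).
      pose proof (Cmod_triangle (f (perturbed_orbit f e w m) - f (Nat.iter m f q)) (e m ^ 2)) as T.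
      replace (f (perturbed_orbit f e w m) - f (Nat.iter m f q) + e m ^ 2)%C
        with (f (perturbed_orbit f e w m) + e m ^ 2 - f (Nat.iter m f q))%C in T by ring.
      simpl Cpow in *. lra.
Qed.

Lemma perturbed_orbit_uniform (U A : C -> Prop) (f : C -> C) (m : nat) :
  open (T := C_UniformSpace) U -> holomorphic_on U f -> lebesgue_compact A ->
  (forall q, A q -> iter_defined U f m q) ->
  forall eta, 0 < eta -> exists d, 0 < d /\ forall q w e, A q -> Cmod (w - q) < d ->
    (forall j, (j < m)%nat -> Cmod (e j ^ 2) < d) ->
    (forall j, (j < m)%nat -> U (perturbed_orbit f e w j)) /\
    Cmod (perturbed_orbit f e w m - Nat.iter m f q) < eta.
Proof.
  intros HU Hf HA Hq eta Heta.
  destruct (uniform_on_compact A (fun d q w => forall e,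
    (forall j, (j < m)%nat -> Cmod (e j ^ 2) < d) ->
    (forall j, (j < m)%nat -> U (perturbed_orbit f e w j)) /\
    Cmod (perturbed_orbit f e w m - Nat.iter m f q) < eta) HA) as [d [Hd H]].
  - intros c Ac.
    destruct (perturbed_orbit_continuity U f m c HU Hf (Hq c Ac) (eta / 2)) as [d [Hd H]]; [lra|].
    exists d. split; [exact Hd|]. intros q w e' He' Hqc Hwc e He.
    destruct (H w e Hwc) as [H1 H2].
    { intros j Hj. specialize (He j Hj). lra. }
    destruct (H q (fun _ => 0%C) Hqc) as [_ H3].
    { intros j Hj. simpl. rewrite Cmult_0_l, Cmod_0. exact Hd. }
    rewrite perturbed_orbit_zero in H3. split; [exact H1|].
    pose proof (Cmod_sub_tri (perturbed_orbit f e w m) (Nat.iter m f c) (Nat.iter m f q)) as T.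
    rewrite (Cmod_sub_sym (Nat.iter m f c) (Nat.iter m f q)) in T. lra.
  - exists d. split; [exact Hd|]. intros q w e Aq Hw. apply (H q w Aq Hw).
Qed.

(** * Asymptotics of the Fatou coordinates *)

(** The sign [s], equal to [-1] or [1] in the applications, lets one argument serve both petals,
    whose normalizations contain the logarithms of [-w] and [w]. *)
Lemma fatou_sublinear (D : C -> Prop) (phi : C -> C) (a s : C) :
  (forall w, D w -> w <> 0%C) -> Cmod s = 1 ->
  (forall e, 0 < e -> exists d, 0 < d /\ forall w, D w -> Cmod w < d ->
     Cmod (phi w - (- / w + (1 - a) * Clog (s * w))) < e) ->
  forall kappa, 0 < kappa -> exists d, 0 < d /\ forall w, D w -> Cmod w < d ->
    Cmod (phi w + / w) <= kappa * / Cmod w.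
Proof.
  intros HD Hs Has kappa Hk.
  destruct (Has 1 ltac:(lra)) as [d1 [Hd1 H1]].
  set (A := 1 + Cmod (1 - a)). pose proof (Cmod_ge_0 (1 - a)) as Ha.
  destruct (Clog_sublinear A kappa ltac:(unfold A; lra) Hk) as [d2 [Hd2 H2]].
  exists (Rmin d1 d2). split; [apply Rmin_pos; auto|].
  intros w Dw Hw.
  specialize (H1 w Dw (Rlt_le_trans _ _ _ Hw (Rmin_l _ _))).
  assert (Hsw : Cmod (s * w) = Cmod w) by (rewrite Cmod_mult, Hs; ring).
  assert (Hw0 : 0 < Cmod w) by (apply Cmod_gt_0; auto).
  assert (Hsw0 : (s * w)%C <> 0%C) by (apply Cmod_pos_neq; lra).
  specialize (H2 (s * w)%C Hsw0). rewrite Hsw in H2.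
  specialize (H2 (Rlt_le_trans _ _ _ Hw (Rmin_r _ _))).
  replace (phi w + / w)%C with ((phi w - (- / w + (1 - a) * Clog (s * w))) + (1 - a) * Clog (s * w))%C by ring.
  eapply Rle_trans; [apply Cmod_triangle|]. rewrite (Cmod_mult (1 - a)).
  pose proof (Cmod_ge_0 (Clog (s * w))).
  assert (Cmod (1 - a) * Cmod (Clog (s * w)) <= A * Cmod (Clog (s * w))).
  { apply Rmult_le_compat_r; unfold A; lra. }
  unfold A in *. lra.
Qed.

(** The last condition puts [K s w] close to [1], so that [Clog (s w)] is close to [- ln K]. *)
Lemma fatou_log_asymptotics (D : C -> Prop) (phi : C -> C) (a s : C) :
  (forall w, D w -> w <> 0%C) -> Cmod s = 1 ->
  (forall e, 0 < e -> exists d, 0 < d /\ forall w, D w -> Cmod w < d ->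
     Cmod (phi w - (- / w + (1 - a) * Clog (s * w))) < e) ->
  forall eta, 0 < eta -> exists d kappa, 0 < d /\ 0 < kappa /\
  forall w K, D w -> Cmod w < d -> 0 < K -> Cmod (/ (s * w) - K) <= kappa * K ->
    Cmod (phi w + / w + (1 - a) * ln K) < eta.
Proof.
  intros HD Hs Has eta Heta.
  destruct (Has (eta / 2) ltac:(lra)) as [d1 [Hd1 H1]].
  pose proof (Cmod_ge_0 (1 - a)) as Ha.
  destruct (Clog_near_1 (eta / (2 * (1 + Cmod (1 - a))))) as [d2 [Hd2 H2]].
  { apply Rdiv_lt_0_compat; lra. }
  exists d1, (Rmin (1 / 2) (d2 / 4)). split; [exact Hd1|]. split; [apply Rmin_pos; lra|].
  intros w K Dw Hw HK Hwk. set (kappa := Rmin (1 / 2) (d2 / 4)) in *.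
  assert (Hk1 : kappa <= 1 / 2) by apply Rmin_l. assert (Hk2 : kappa <= d2 / 4) by apply Rmin_r.
  assert (Hw0 : 0 < Cmod w) by (apply Cmod_gt_0; auto).
  assert (Hsw : Cmod (s * w) = Cmod w) by (rewrite Cmod_mult, Hs; ring).
  assert (Hsw0 : (s * w)%C <> 0%C) by (apply Cmod_pos_neq; lra).
  assert (HKc : (RtoC K <> 0)%C) by (intro E; apply RtoC_inj in E; lra).
  set (v := (s * w)%C) in *.
  assert (Hlow : K / 2 <= Cmod (/ v)).
  { pose proof (Cmod_lower K (/ v)) as T. rewrite (Cmod_sub_sym K (/ v)) in T.
    rewrite Cmod_R, Rabs_right in T by lra. nra. }
  assert (Hvn : Cmod (K * v - 1) < d2).
  { replace (K * v - 1)%C with (- ((/ v - K) / / v))%C by (field; auto).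
    rewrite Cmod_opp. eapply Rle_lt_trans.
    - apply (Cmod_div_le _ _ (K / 2) (kappa * K)); auto. lra.
    - replace (kappa * K / (K / 2)) with (2 * kappa) by (field; lra). lra. }
  specialize (H2 _ Hvn). specialize (H1 w Dw Hw). fold v in H1.
  rewrite Clog_scale in H2 by auto.
  replace (phi w + / w + (1 - a) * ln K)%C with
    ((phi w - (- / w + (1 - a) * Clog v)) + (1 - a) * (ln K + Clog v))%C by ring.
  eapply Rle_lt_trans; [apply Cmod_triangle|]. rewrite (Cmod_mult (1 - a)).
  assert (Cmod (1 - a) * Cmod (ln K + Clog v) <= eta / 2).
  { apply Rle_trans with (Cmod (1 - a) * (eta / (2 * (1 + Cmod (1 - a))))).
    - apply Rmult_le_compat_l; lra.
    - apply Rmult_le_reg_r with (2 * (1 + Cmod (1 - a))); [lra|].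
      replace (Cmod (1 - a) * (eta / (2 * (1 + Cmod (1 - a)))) * (2 * (1 + Cmod (1 - a))))
        with (eta * Cmod (1 - a)) by (field; lra). lra. }
  lra.
Qed.

Lemma ln_sublinear (A kappa : R) : 0 <= A -> 0 < kappa ->
  exists N, forall m, (N <= m)%nat -> A * ln (INR m) + A <= kappa * INR m.
Proof.
  intros HA Hk. destruct (Clog_sublinear A kappa HA Hk) as [d [Hd H]].
  destruct (nat_above (1 + / d)) as [N HN].
  exists N. intros m Hm. specialize (HN m Hm).
  assert (Hid : 0 < / d) by (apply Rinv_0_lt_compat; auto).
  assert (Him : 0 < / INR m) by (apply Rinv_0_lt_compat; lra).
  specialize (H (RtoC (/ INR m))). rewrite Cmod_R, Rabs_right in H by lra.
  rewrite Rinv_inv in H.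
  assert (Hn : (RtoC (/ INR m) <> 0)%C) by (intro E; apply RtoC_inj in E; lra).
  assert (Hlt : / INR m < d) by (rewrite <- (Rinv_inv d); apply Rinv_lt_contravar; nra).
  specialize (H Hn Hlt).
  assert (Hl : ln (INR m) <= Cmod (Clog (/ INR m)%R)).
  { pose proof (re_le_Cmod (Clog (/ INR m)%R)) as T. unfold Clog in T at 1. unfold Re in T. simpl in T.
    rewrite Cmod_R, (Rabs_right (/ INR m)), ln_Rinv, Rabs_Ropp in T by lra.
    pose proof (Rle_abs (ln (INR m))). lra. }
  apply Rmult_le_compat_l with (r := A) in Hl; auto. lra.
Qed.

(** * Dynamics in the petals and preimages under the repelling coordinate *)

(** In the coordinate [1 / w] the map is the translation by [-1] up to [1 / 4], so [Re (1 / w)]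
    drops by an amount between [3 / 4] and [5 / 4]. The lemmas on orbits in the petals use the
    expansion of [f] only in this form. *)
Definition near_translation (f : C -> C) (r : R) : Prop :=
  forall w : C, w <> 0%C -> Cmod w < 2 * r ->
    f w <> 0%C /\ Cmod (/ f w - / w + 1) <= 1 / 4.

Lemma Re_le_Cmod_dist (z w : C) : Re z <= Re w + Cmod (z - w).
Proof.
  pose proof (re_le_Cmod (z - w)) as H. destruct z as [x y], w as [x' y']. unfold Re in *. simpl in *.
  apply Rabs_le_between in H. lra.
Qed.

Lemma near_translation_Re (f : C -> C) (r : R) (w : C) :
  near_translation f r -> w <> 0%C -> Cmod w < 2 * r ->
  Re (/ w) - 5 / 4 <= Re (/ f w) <= Re (/ w) - 3 / 4.
Proof.
  intros H H0 Hw. destruct (H w H0 Hw) as [_ Hd].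
  pose proof (Re_le_Cmod_dist (/ f w) (/ w - 1)) as T1.
  pose proof (Re_le_Cmod_dist (/ w - 1) (/ f w)) as T2.
  rewrite (Cmod_sub_sym (/ w - 1) (/ f w)) in T2.
  replace (/ f w - (/ w - 1))%C with (/ f w - / w + 1)%C in * by ring.
  replace (Re (/ w - 1)) with (Re (/ w) - 1) in * by reflexivity. lra.
Qed.

Lemma attracting_petal_forward (f : C -> C) (r : R) (w : C) : 0 < r ->
  near_translation f r -> attracting_petal r w ->
  attracting_petal r (f w) /\ Re (/ f w) <= Re (/ w) - 3 / 4.
Proof.
  intros Hr Hn Hw. pose proof (Cmod_petal_lt r w (or_introl Hw)) as Hm.
  apply attracting_petal_iff in Hw; auto. destruct Hw as [Hw0 Hw].
  pose proof (near_translation_Re f r w Hn Hw0 Hm) as HR.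
  split; [|lra]. apply attracting_petal_iff; auto. split; [|lra].
  apply (Hn w Hw0 Hm).
Qed.

Lemma attracting_petal_iter (f : C -> C) (r : R) (w : C) (k : nat) : 0 < r ->
  near_translation f r -> attracting_petal r w ->
  attracting_petal r (Nat.iter k f w) /\ Re (/ Nat.iter k f w) <= Re (/ w) - 3 / 4 * INR k.
Proof.
  intros Hr Hn Hw. induction k as [|k [IH1 IH2]].
  - simpl. split; [exact Hw | lra].
  - destruct (attracting_petal_forward f r _ Hr Hn IH1) as [H1 H2].
    change (Nat.iter (S k) f w) with (f (Nat.iter k f w)).
    split; [exact H1|]. rewrite S_INR. lra.
Qed.

Lemma Cmod_inv_ge_Re (w : C) (X : R) : 0 < X -> w <> 0%C -> X <= Rabs (Re (/ w)) -> Cmod w <= / X.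
Proof.
  intros HX Hw H. pose proof (re_le_Cmod (/ w)) as T. rewrite Cmod_inv in T by auto.
  assert (Hm : 0 < Cmod w) by (apply Cmod_gt_0; auto).
  rewrite <- (Rinv_inv (Cmod w)). apply Rinv_le_contravar; lra.
Qed.

Lemma attracting_iter_small (f : C -> C) (r : R) (m : nat) (w : C) (k : nat) : 0 < r ->
  near_translation f r -> attracting_petal r (Nat.iter m f w) -> (m < k)%nat ->
  attracting_petal r (Nat.iter k f w) /\ Nat.iter k f w <> 0%C /\
  Cmod (Nat.iter k f w) <= / (3 / 4 * (INR k - INR m)).
Proof.
  intros Hr Hn Hw Hk.
  destruct (attracting_petal_iter f r _ (k - m) Hr Hn Hw) as [H1 H2].
  rewrite <- Nat.iter_add in *. replace (k - m + m)%nat with k in * by lia.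
  rewrite minus_INR in H2 by lia.
  split; [exact H1|]. 
  pose proof (proj1 (attracting_petal_iff r _ Hr) H1) as [H0 _].
  split; [exact H0|].
  pose proof (proj1 (attracting_petal_iff r _ Hr) Hw) as [_ Hre].
  assert (0 < / (2 * r)) by (apply Rinv_0_lt_compat; lra).
  apply lt_INR in Hk.
  apply Cmod_inv_ge_Re; auto; [lra|]. rewrite Rabs_left; lra.
Qed.

(** Two rounds. [phi] gains exactly [1] per step and differs from [- 1 / w] by a small proportion of
    it, which locates [- 1 / f^k w] near [k] up to a small proportion. This is what the logarithmic
    asymptotics needs to improve the error to [o(1)]. *)
Lemma attracting_iter_asymptotics (f : C -> C) (a : C) (r B : R) (m : nat) (phi Phi : C -> C) (A : C -> Prop) :
  0 < r -> near_translation f r ->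
  (forall e, 0 < e -> exists d, 0 < d /\ forall w, attracting_petal r w -> Cmod w < d ->
     Cmod (phi w - (- / w + (1 - a) * Clog (- (1) * w))) < e) ->
  (forall w, A w -> attracting_petal r (Nat.iter m f w)) ->
  (forall w k, A w -> (m <= k)%nat -> phi (Nat.iter k f w) = (Phi w + INR k)%C) ->
  0 <= B -> (forall w, A w -> Cmod (Phi w) <= B) ->
  (forall kappa, 0 < kappa -> exists K0, forall k w, (K0 <= k)%nat -> A w ->
     Cmod (/ Nat.iter k f w + INR k) <= kappa * INR k) /\
  (forall eta, 0 < eta -> exists K0, forall k w, (K0 <= k)%nat -> A w ->
     Cmod (- / Nat.iter k f w - INR k - (Phi w + (1 - a) * ln (INR k))) < eta).
Proof.
  intros Hr Hn Has HA Hphi HB HPhi.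
  assert (Hs : Cmod (- (1)) = 1) by apply Cmod_m1.
  assert (HD : forall w, attracting_petal r w -> w <> 0%C).
  { intros w Hw. apply (attracting_petal_iff r w Hr) in Hw. tauto. }
  assert (Hsmall : forall d, 0 < d -> exists K0, forall k w, (K0 <= k)%nat -> A w ->
     attracting_petal r (Nat.iter k f w) /\ Nat.iter k f w <> 0%C /\ Cmod (Nat.iter k f w) < d /\ (m <= k)%nat).
  { intros d Hd. destruct (nat_above (INR m + 2 * / d)) as [K0 HK0].
    assert (Hid : 0 < / d) by (apply Rinv_0_lt_compat; auto).
    exists (K0 + S m)%nat. intros k w Hk Aw. specialize (HK0 k ltac:(lia)).
    destruct (attracting_iter_small f r m w k Hr Hn (HA w Aw) ltac:(lia)) as [H1 [H2 H3]].
    repeat split; auto; [|lia].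
    eapply Rle_lt_trans; [exact H3|]. rewrite <- (Rinv_inv d). apply Rinv_lt_contravar; nra. }
  assert (Hlin : forall kappa, 0 < kappa -> exists K0, forall k w, (K0 <= k)%nat -> A w ->
     Cmod (/ Nat.iter k f w + INR k) <= kappa * INR k).
  { intros kappa Hk.
    set (k1 := Rmin (1 / 2) (kappa / 8)). assert (Hk1 : 0 < k1) by (apply Rmin_pos; lra).
    assert (Hk1a : k1 <= 1 / 2) by apply Rmin_l. assert (Hk1b : k1 <= kappa / 8) by apply Rmin_r.
    destruct (fatou_sublinear (attracting_petal r) phi a (- (1))%C HD Hs Has k1 Hk1) as [d [Hd H]].
    destruct (Hsmall d Hd) as [K0 HK0].
    destruct (nat_above (B + 2 * B / kappa)) as [K1 HK1].
    exists (K0 + K1)%nat. intros k w Hkk Aw.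
    destruct (HK0 k w ltac:(lia) Aw) as [H1 [H2 [H3 H4]]]. specialize (HK1 k ltac:(lia)).
    specialize (H _ H1 H3). rewrite (Hphi w k Aw H4) in H. specialize (HPhi w Aw).
    rewrite <- Cmod_inv in H by auto. set (v := (/ Nat.iter k f w)%C) in *.
    assert (HBk : 0 <= 2 * B / kappa) by (apply Rdiv_le_0_compat; lra).
    assert (HBk2 : B <= kappa / 2 * INR k).
    { apply Rle_trans with (kappa / 2 * (2 * B / kappa)); [right; field; lra|].
      apply Rmult_le_compat_l; lra. }
    assert (Hpk : Cmod (Phi w + INR k) <= B + INR k).
    { apply Cmod_plus_le; auto. rewrite Cmod_R, Rabs_right; lra. }
    assert (Hv : Cmod v <= 4 * INR k).
    (* [|v|] appears on both sides; the factor [k1 <= 1 / 2] lets it be absorbed. *)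
    { pose proof (Cmod_sub_le (Phi w + INR k + v) (Phi w + INR k)) as T.
      replace (Phi w + INR k + v - (Phi w + INR k))%C with v in T by ring.
      pose proof (Cmod_ge_0 v). nra. }
    replace (v + INR k)%C with ((Phi w + INR k + v) - Phi w)%C by ring.
    eapply Rle_trans; [apply Cmod_sub_le|]. nra. }
  split; [exact Hlin|].
  intros eta Heta.
  destruct (fatou_log_asymptotics (attracting_petal r) phi a (- (1))%C HD Hs Has eta Heta) as [d [kappa [Hd [Hk H]]]].
  destruct (Hsmall d Hd) as [K0 HK0]. destruct (Hlin kappa Hk) as [K1 HK1].
  exists (K0 + K1 + 1)%nat. intros k w Hkk Aw.
  destruct (HK0 k w ltac:(lia) Aw) as [H1 [H2 [H3 H4]]]. specialize (HK1 k w ltac:(lia) Aw).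
  assert (Hk0 : 0 < INR k) by (apply lt_0_INR; lia).
  specialize (H _ (INR k) H1 H3 Hk0).
  replace (/ (- (1) * Nat.iter k f w) - INR k)%C with (- (/ Nat.iter k f w + INR k))%C in H.
  2: { field. exact H2. }
  rewrite Cmod_opp in H. specialize (H HK1). rewrite (Hphi w k Aw H4) in H.
  rewrite <- Cmod_opp.
  replace (- (- / Nat.iter k f w - INR k - (Phi w + (1 - a) * ln (INR k))))%C with
    (Phi w + INR k + / Nat.iter k f w + (1 - a) * ln (INR k))%C by ring. exact H.
Qed.

(** The disc of radius [j / 4] about [j] in the coordinate [1 / w]; multiplying by
    [Cmod w] makes the condition visibly closed and excludes [w = 0]. *)
Definition repelling_cell (j : nat) (w : C) : Prop :=
  Cmod (1 - INR j * w) <= INR j / 4 * Cmod w.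

Lemma repelling_cell_neq (j : nat) (w : C) : repelling_cell j w -> w <> 0%C.
Proof.
  unfold repelling_cell. intros H E. rewrite E, Cmod_0 in H.
  replace (1 - INR j * 0)%C with (RtoC 1) in H by ring. rewrite Cmod_1 in H. lra.
Qed.

Lemma repelling_cell_iff (j : nat) (w : C) : w <> 0%C ->
  (repelling_cell j w <-> Cmod (/ w - INR j) <= INR j / 4).
Proof.
  intros Hw. unfold repelling_cell. assert (Hm : 0 < Cmod w) by (apply Cmod_gt_0; auto).
  replace (1 - INR j * w)%C with ((/ w - INR j) * w)%C by (field; auto).
  rewrite Cmod_mult. split; intros H.
  - apply Rmult_le_reg_r with (Cmod w); auto.
  - apply Rmult_le_compat_r; lra.
Qed.

Lemma repelling_cell_bounds (j : nat) (w : C) : repelling_cell j w ->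
  w <> 0%C /\ 3 / 4 * INR j <= Re (/ w) /\ 3 / 4 * INR j <= Cmod (/ w) <= 5 / 4 * INR j.
Proof.
  intros H. pose proof (repelling_cell_neq j w H) as H0. split; [exact H0|].
  apply repelling_cell_iff in H; auto.
  pose proof (Re_le_Cmod_dist (INR j) (/ w)) as T. rewrite (Cmod_sub_sym (INR j) (/ w)) in T.
  rewrite re_RtoC in T.
  pose proof (Cmod_lower (/ w) (INR j)) as T2. rewrite Cmod_R, Rabs_right in T2 by (apply Rle_ge, pos_INR).
  pose proof (re_le_Cmod (/ w)) as T3. pose proof (Rle_abs (Re (/ w))). lra.
Qed.

Lemma repelling_cell_small (j : nat) (w : C) : (0 < j)%nat -> repelling_cell j w -> Cmod w <= / (3 / 4 * INR j).
Proof.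
  intros Hj H. apply repelling_cell_bounds in H. destruct H as [H0 [H1 _]].
  apply lt_0_INR in Hj. apply Cmod_inv_ge_Re; auto; [lra|]. rewrite Rabs_right; lra.
Qed.

Lemma repelling_cell_closed (j : nat) (x : C) : (0 < j)%nat -> ~ repelling_cell j x ->
  exists d, 0 < d /\ forall y, Cmod (y - x) < d -> ~ repelling_cell j y.
Proof.
  intros Hj Hx. unfold repelling_cell in *. apply Rnot_le_lt in Hx.
  apply lt_0_INR in Hj.
  set (gap := Cmod (1 - INR j * x) - INR j / 4 * Cmod x) in *.
  exists (gap / (2 * INR j)). split.
  { apply Rdiv_lt_0_compat; unfold gap; lra. }
  intros y Hy Hc.
  apply Rmult_lt_compat_r with (r := 2 * INR j) in Hy; [|lra].
  replace (gap / (2 * INR j) * (2 * INR j)) with gap in Hy by (field; lra).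
  pose proof (Cmod_lower (1 - INR j * x) (1 - INR j * y)) as T1.
  replace (1 - INR j * x - (1 - INR j * y))%C with (INR j * (y - x))%C in T1 by ring.
  rewrite Cmod_mult, Cmod_R, Rabs_right in T1 by lra.
  pose proof (Cmod_lower y x) as T2.
  assert (INR j / 4 * Cmod y <= INR j / 4 * (Cmod x + Cmod (y - x))) by (apply Rmult_le_compat_l; lra).
  pose proof (Cmod_ge_0 (y - x)).
  assert (0 <= INR j * Cmod (y - x)) by (apply Rmult_le_pos; lra).
  unfold gap in Hy. lra.
Qed.

Lemma repelling_cell_compact (j : nat) : (0 < j)%nat -> lebesgue_compact (repelling_cell j).
Proof.
  intros Hj. apply bounded_closed_compact with (B := / (3 / 4 * INR j)).
  - intros w. apply repelling_cell_small; auto.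
  - intros x. apply repelling_cell_closed; auto.
Qed.

(** With [near_translation] alone the error [1 / 4] would accumulate at each step. Instead the exact
    value [zeta - j] of [phi] relocates every iterate: [phi w + 1 / w] is small compared with
    [1 / w], so [1 / w] is near [j - zeta] at each stage. *)
Lemma repelling_descent (f : C -> C) (r BZ : R) (phi : C -> C) :
  0 < r -> near_translation f r -> 0 <= BZ ->
  (forall w, repelling_petal r w -> repelling_petal r (f w) -> phi (f w) = (phi w + 1)%C) ->
  (exists d, 0 < d /\ forall w, repelling_petal r w -> Cmod w < d ->
    Cmod (phi w + / w) <= 1 / 16 * / Cmod w) ->
  exists j0, (0 < j0)%nat /\
    (forall j w, (j0 <= j)%nat -> repelling_cell j w -> repelling_petal r w) /\
    forall t m zeta x, Cmod zeta <= BZ -> (j0 + t <= m)%nat ->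
      repelling_cell m x -> phi x = (zeta - INR m)%C ->
      repelling_cell (m - t) (Nat.iter t f x) /\
      phi (Nat.iter t f x) = (zeta - INR (m - t))%C.
Proof.
  intros Hr Hn HBZ Hphi [d [Hd Has]].
  assert (Hir : 0 < / (2 * r)) by (apply Rinv_0_lt_compat; lra).
  assert (Hid : 0 < / d) by (apply Rinv_0_lt_compat; lra).
  (* Large enough for the iterates to stay in the petal and within [d] of [0], and for
     [BZ + i / 8 <= (i - 1) / 4]. *)
  destruct (nat_above (2 * / (2 * r) + 2 * / d + 8 * BZ + 10)) as [j0 Hj0].
  assert (Hpet : forall j w, (j0 <= j)%nat -> repelling_cell j w -> repelling_petal r w).
  { intros j w Hj Hw. specialize (Hj0 j Hj).
    apply repelling_cell_bounds in Hw. apply repelling_petal_iff; auto. split; [tauto|]. lra. }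
  exists (S j0). split; [lia|]. split; [intros j w Hj; apply Hpet; lia|].
  induction t as [|t IH]; intros m zeta x Hz Hm Hx Hpx.
  - rewrite Nat.sub_0_r. auto.
  - destruct (IH m zeta x Hz ltac:(lia) Hx Hpx) as [Hc Hp].
    set (w := Nat.iter t f x) in *. change (Nat.iter (S t) f x) with (f w).
    pose proof (Hj0 (m - t)%nat ltac:(lia)) as Hi.
    assert (Hpr : INR (m - S t) = INR (m - t) - 1).
    { replace (m - t)%nat with (S (m - S t)) by lia. rewrite S_INR. ring. }
    set (i := INR (m - t)) in *.
    pose proof (Hpet (m - t)%nat w ltac:(lia) Hc) as Hw.
    destruct (repelling_cell_bounds _ _ Hc) as [Hw0 [Hw1 Hw2]]. fold i in Hw1, Hw2.
    pose proof (Cmod_petal_lt r w (or_intror Hw)) as Hwm.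
    destruct (Hn w Hw0 Hwm) as [Hf0 Hf1].
    pose proof (near_translation_Re f r w Hn Hw0 Hwm) as HR.
    assert (Hfp : repelling_petal r (f w)).
    { apply repelling_petal_iff; auto. split; [auto|]. lra. }
    specialize (Hphi w Hw Hfp). rewrite Hp in Hphi.
    assert (Hfm : Cmod (f w) < d).
    { eapply Rle_lt_trans.
      - apply (Cmod_inv_ge_Re (f w) (3 / 4 * i - 5 / 4)); auto; [lra|]. rewrite Rabs_right; lra.
      - rewrite <- (Rinv_inv d). apply Rinv_lt_contravar; [|lra].
        apply Rmult_lt_0_compat; lra. }
    specialize (Has (f w) Hfp Hfm). rewrite <- Cmod_inv in Has by auto.
    assert (Hfi : Cmod (/ f w) <= 2 * i).
    { pose proof (Cmod_lower (/ f w) (/ w - 1)) as T.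
      replace (/ f w - (/ w - 1))%C with (/ f w - / w + 1)%C in T by ring.
      pose proof (Cmod_sub_le (/ w) 1) as T2. rewrite Cmod_1 in T2. lra. }
    split.
    + apply repelling_cell_iff; auto. rewrite Hpr.
      replace (/ f w - (i - 1)%R)%C with ((phi (f w) + / f w) - zeta)%C.
      2: { rewrite Hphi, RtoC_minus. ring. }
      eapply Rle_trans; [apply Cmod_sub_le|]. lra.
    + rewrite Hphi, Hpr, RtoC_minus. ring.
Qed.

Lemma repelling_preimage (f : C -> C) (a : C) (r BZ : R) (phi : C -> C) :
  0 < r -> near_translation f r -> 0 <= BZ ->
  (forall w, repelling_petal r w -> repelling_petal r (f w) -> phi (f w) = (phi w + 1)%C) ->
  holomorphic_on (repelling_petal r) phi ->
  (forall e, 0 < e -> exists d, 0 < d /\ forall w, repelling_petal r w -> Cmod w < d ->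
     Cmod (phi w - (- / w + (1 - a) * Clog (1 * w))) < e) ->
  exists j0, (0 < j0)%nat /\
    (forall j w, (j0 <= j)%nat -> repelling_cell j w -> repelling_petal r w) /\
    (forall t m zeta x, Cmod zeta <= BZ -> (j0 + t <= m)%nat ->
      repelling_cell m x -> phi x = (zeta - INR m)%C ->
      repelling_cell (m - t) (Nat.iter t f x) /\
      phi (Nat.iter t f x) = (zeta - INR (m - t))%C) /\
    forall j zeta, (j0 <= j)%nat -> Cmod zeta <= BZ ->
      exists q, repelling_cell j q /\ phi q = (zeta - INR j)%C.
Proof.
  intros Hr Hn HBZ Hphi Hhol Has.
  assert (HD : forall w, repelling_petal r w -> w <> 0%C).
  { intros w Hw. apply (repelling_petal_iff r w Hr) in Hw. tauto. }
  assert (Hs : Cmod 1 = 1) by apply Cmod_1.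
  pose proof (fatou_sublinear (repelling_petal r) phi a 1 HD Hs Has (1 / 16) ltac:(lra)) as Hsub.
  (* One unit of slack: the descent is applied to [phi x + m], which is only close to [zeta]. *)
  destruct (repelling_descent f r (BZ + 1) phi Hr Hn ltac:(lra) Hphi Hsub) as [j0 [Hj0 [Hpet Hdesc]]].
  exists j0. split; [exact Hj0|]. split; [exact Hpet|]. split.
  { intros t m zeta x Hz. apply Hdesc. lra. }
  intros j zeta Hj Hz.
  apply value_attained.
  - apply repelling_cell_compact. lia.
  - intros w Hw. apply (holomorphic_continuous (repelling_petal r)); auto. apply (Hpet j); auto.
  - intros e He.
    destruct (fatou_log_asymptotics (repelling_petal r) phi a 1 HD Hs Has (Rmin e 1)) as [d [kappa [Hd [Hk H]]]].
    { apply Rmin_pos; lra. }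
    set (k1 := Rmin kappa (1 / 4)). assert (Hk1 : 0 < k1) by (apply Rmin_pos; lra).
    assert (Hk1a : k1 <= kappa) by apply Rmin_l. assert (Hk1b : k1 <= 1 / 4) by apply Rmin_r.
    set (A := BZ + Cmod (1 - a)). pose proof (Cmod_ge_0 (1 - a)) as Ha.
    assert (HA : 0 <= A) by (unfold A; lra).
    destruct (ln_sublinear A k1 HA Hk1) as [N1 HN1].
    destruct (nat_above (2 * / d)) as [N2 HN2].
    set (m := (N1 + N2 + j0 + j + 1)%nat).
    specialize (HN1 m ltac:(lia)). specialize (HN2 m ltac:(lia)).
    assert (Hm1 : 1 <= INR m) by (apply (le_INR 1); lia).
    assert (Hid : 0 < / d) by (apply Rinv_0_lt_compat; lra).
    assert (Hln : 0 <= ln (INR m)) by (rewrite <- ln_1; apply ln_le; lra).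
    (* [1 / x = m - c] solves the asymptotic equation [- 1 / x - (1 - a) ln m = zeta - m]. *)
    set (c := (zeta + (1 - a) * ln (INR m))%C).
    assert (Hc : Cmod c <= k1 * INR m).
    { unfold c. eapply Rle_trans; [apply Cmod_triangle|]. rewrite Cmod_mult, Cmod_R, Rabs_right by lra.
      assert (0 <= BZ * ln (INR m)) by (apply Rmult_le_pos; lra). unfold A in HN1. lra. }
    assert (Hmc : 3 / 4 * INR m <= Cmod (INR m - c)).
    { pose proof (Cmod_lower (INR m) (INR m - c)) as T. replace (INR m - (INR m - c))%C with c in T by ring.
      rewrite Cmod_R, Rabs_right in T by lra. nra. }
    assert (Hmc0 : (INR m - c <> 0)%C) by (apply Cmod_pos_neq; lra).
    set (x := (/ (INR m - c))%C).
    assert (Hx0 : x <> 0%C).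
    { intro E. assert (E2 : ((INR m - c) * x = 1)%C) by (unfold x; field; auto).
      rewrite E in E2. apply (f_equal Cmod) in E2. rewrite Cmult_0_r, Cmod_0, Cmod_1 in E2. lra. }
    assert (Hxi : (/ x = INR m - c)%C).
    { unfold x. field. auto. }
    assert (Hcell : repelling_cell m x).
    { apply repelling_cell_iff; auto. rewrite Hxi. replace (INR m - c - INR m)%C with (- c)%C by ring.
      rewrite Cmod_opp. nra. }
    pose proof (Hpet m x ltac:(lia) Hcell) as Hxp.
    assert (Hxd : Cmod x < d).
    { eapply Rle_lt_trans; [apply (repelling_cell_small m); auto; lia|].
      rewrite <- (Rinv_inv d). apply Rinv_lt_contravar; [|lra]. apply Rmult_lt_0_compat; lra. }
    specialize (H x (INR m) Hxp Hxd ltac:(lra)).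
    replace (1 * x)%C with x in H by ring. rewrite Hxi in H.
    replace (INR m - c - INR m)%C with (- c)%C in H by ring. rewrite Cmod_opp in H.
    assert (Hck : Cmod c <= kappa * INR m) by nra. specialize (H Hck).
    replace (phi x + (INR m - c) + (1 - a) * ln (INR m))%C with (phi x + INR m - zeta)%C in H
      by (unfold c; ring).
    destruct (Hdesc (m - j)%nat m (phi x + INR m)%C x) as [H1 H2].
    + pose proof (Cmod_lower (phi x + INR m) zeta) as T. pose proof (Rmin_r e 1). lra.
    + lia.
    + exact Hcell.
    + ring.
    + replace (m - (m - j))%nat with j in * by lia.
      exists (Nat.iter (m - j) f x). split; [exact H1|]. rewrite H2.
      replace (phi x + INR m - INR j - (zeta - INR j))%C with (phi x + INR m - zeta)%C by ring.
      pose proof (Rmin_l e 1). lra.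
Qed.

(** Existence of the extension provides, at a late index [N + J], a petal point with [N + J]
    admissible steps. Injectivity identifies it with a point of the cell and, after descent, its
    [N]-th iterate with [q]. Hence the remaining [J] steps from [q] are defined and end at the
    extension. *)
Lemma inverse_extension_value (U : C -> Prop) (f : C -> C) (r BZ : R) (phi : C -> C) (j0 J : nat) (zeta q : C) :
  injective_on (repelling_petal r) phi ->
  (forall j w, (j0 <= j)%nat -> repelling_cell j w -> repelling_petal r w) ->
  (forall t m zeta x, Cmod zeta <= BZ -> (j0 + t <= m)%nat ->
      repelling_cell m x -> phi x = (zeta - INR m)%C ->
      repelling_cell (m - t) (Nat.iter t f x) /\
      phi (Nat.iter t f x) = (zeta - INR (m - t))%C) ->
  (forall j zeta, (j0 <= j)%nat -> Cmod zeta <= BZ ->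
      exists q, repelling_cell j q /\ phi q = (zeta - INR j)%C) ->
  (exists z, is_inverse_extension U f r phi zeta z) ->
  (j0 <= J)%nat -> Cmod zeta <= BZ -> repelling_cell J q -> phi q = (zeta - INR J)%C ->
  iter_defined U f J q /\ inverse_extension U f r phi zeta = Nat.iter J f q.
Proof.
  intros Hi Hpet Hdesc Hsurj [z Hz] HJ Hzeta Hq Hpq.
  rewrite (inverse_extension_eq U f r phi zeta z Hi Hz).
  destruct Hz as [N HN]. destruct (HN (N + J)%nat ltac:(lia)) as [p [Hp [Ep [Dp Zp]]]].
  destruct (Hsurj (N + J)%nat zeta ltac:(lia) Hzeta) as [p' [Hp' Ep']].
  assert (E : p = p').
  { apply Hi; auto; [apply (Hpet (N + J)%nat); auto; lia | congruence]. }
  subst p'.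
  destruct (Hdesc N (N + J)%nat zeta p Hzeta ltac:(lia) Hp' Ep') as [H1 H2].
  replace (N + J - N)%nat with J in * by lia.
  assert (E : Nat.iter N f p = q).
  { apply Hi; [apply (Hpet J); auto | apply (Hpet J); auto | congruence]. }
  split.
  - intros j Hj. rewrite <- E, <- Nat.iter_add. apply Dp. lia.
  - rewrite Zp, <- E, <- Nat.iter_add. f_equal. lia.
Qed.

(** * Entering and leaving the gate *)

Lemma eventually_forall_le (P : nat -> nat -> Prop) (J K : nat) :
  (forall j, (J <= j <= K)%nat -> eventually (P j)) ->
  eventually (fun n => forall j, (J <= j <= K)%nat -> P j n).
Proof.
  induction K as [|K IH]; intros H.
  - destruct (Nat.eq_dec J 0) as [-> | HJ].
    + destruct (H 0%nat ltac:(lia)) as [N HN]. exists N. intros n Hn j Hj.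
      replace j with 0%nat by lia. auto.
    + exists 0%nat. intros; lia.
  - destruct (IH ltac:(intros; apply H; lia)) as [N1 HN1].
    destruct (Nat.le_gt_cases J (S K)) as [HJ | HJ].
    + destruct (H (S K) ltac:(lia)) as [N2 HN2].
      exists (N1 + N2)%nat. intros n Hn j Hj.
      destruct (Nat.eq_dec j (S K)) as [-> | Hne]; [apply HN2; lia | apply HN1; lia].
    + exists 0%nat. intros; lia.
Qed.

Lemma common_radius (P : nat -> R -> Prop) (J K : nat) :
  (forall j d d', P j d -> 0 < d' <= d -> P j d') ->
  (forall j, (J <= j <= K)%nat -> exists d, 0 < d /\ P j d) ->
  exists d, 0 < d /\ forall j, (J <= j <= K)%nat -> P j d.
Proof.
  intros Hm. induction K as [|K IH]; intros H.
  - destruct (Nat.eq_dec J 0) as [-> | HJ].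
    + destruct (H 0%nat ltac:(lia)) as [d [Hd HP]]. exists d. split; [auto|].
      intros j Hj. replace j with 0%nat by lia. auto.
    + exists 1. split; [lra|]. intros; lia.
  - destruct (IH ltac:(intros; apply H; lia)) as [d1 [Hd1 H1]].
    destruct (Nat.le_gt_cases J (S K)) as [HJ | HJ].
    + destruct (H (S K) ltac:(lia)) as [d2 [Hd2 H2]].
      exists (Rmin d1 d2). split; [apply Rmin_pos; auto|]. intros j Hj.
      pose proof (Rmin_l d1 d2). pose proof (Rmin_r d1 d2).
      assert (0 < Rmin d1 d2) by (apply Rmin_pos; auto).
      destruct (Nat.eq_dec j (S K)) as [-> | Hne].
      * apply (Hm _ d2); auto.
      * apply (Hm _ d1); auto. apply H1. lia.
    + exists 1. split; [lra|]. intros; lia.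
Qed.

Lemma gate_width_small (e : R) : 0 < e -> eventually (fun n => gate_width n ^ 2 < e).
Proof.
  intros He. destruct (eventually_div_lt 64 e He) as [N HN].
  exists (N + 8)%nat. intros n Hn. specialize (HN n ltac:(lia)).
  destruct (gate_width_bounds n ltac:(lia)) as [[_ H] _].
  pose proof (gate_width_pos n ltac:(lia)) as H0. pose proof PI_4. pose proof PI_RGT_0.
  assert (H8 : 8 <= INR n).
  { replace 8 with (INR 8) by (simpl; lra). apply le_INR. lia. }
  assert (Hd : gate_width n <= 8 / INR n).
  { eapply Rle_trans; [exact H|]. apply Rmult_le_reg_r with (INR n); [lra|].
    replace (2 * (PI / INR n) * INR n) with (2 * PI) by (field; lra).
    replace (8 / INR n * INR n) with 8 by (field; lra). lra. }
  assert (Hd1 : 8 / INR n <= 1).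
  { apply Rmult_le_reg_r with (INR n); [lra|]. replace (8 / INR n * INR n) with 8 by (field; lra). lra. }
  apply Rle_lt_trans with (8 * (8 / INR n)); [nra|]. replace (8 * (8 / INR n)) with (64 / INR n) by (field; lra). exact HN.
Qed.

(** The gate coordinate [y] and [v = 1 / w] satisfy the symmetric relation
    [d^2 v y + tau (v + y) = 1], so a single limit serves for entering the gate
    ([v] given) and, after reflection, for leaving it ([y] given). *)
Lemma mobius_limit (K : nat) (X eta : R) : (0 < K)%nat -> 0 < X -> 0 < eta ->
  eventually (fun n => forall v : C, Cmod v <= X ->
    (gate_width n ^ 2 * v + gate_point n K <> 0)%C /\
    Cmod ((1 - gate_point n K * v) / (gate_width n ^ 2 * v + gate_point n K) + INR K + v) < eta).
Proof.
  intros HK HX Heta. apply lt_INR in HK as HK0. simpl in HK0.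
  assert (Hi : 0 < / INR K) by (apply Rinv_0_lt_compat; lra).
  assert (E1 : 0 < Rmin (/ INR K / 2) (eta / (8 * INR K * INR K))).
  { apply Rmin_pos; [lra|]. apply Rdiv_lt_0_compat; nra. }
  assert (E2 : 0 < Rmin (/ INR K / (4 * X)) (eta / (16 * INR K * X * (INR K + X)))).
  { apply Rmin_pos; apply Rdiv_lt_0_compat; try lra. repeat apply Rmult_lt_0_compat; lra. }
  destruct (gate_point_limit K _ HK E1) as [N1 HN1]. destruct (gate_width_small _ E2) as [N2 HN2].
  exists (N1 + N2)%nat. intros n Hn v Hv. specialize (HN1 n ltac:(lia)). specialize (HN2 n ltac:(lia)).
  set (t := gate_point n K) in *. set (D := gate_width n ^ 2) in *.
  assert (T1 : Rabs (t + / INR K) < / INR K / 2) by (eapply Rlt_le_trans; [exact HN1 | apply Rmin_l]).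
  assert (T2 : Rabs (t + / INR K) < eta / (8 * INR K * INR K)) by (eapply Rlt_le_trans; [exact HN1 | apply Rmin_r]).
  assert (D1 : D < / INR K / (4 * X)) by (eapply Rlt_le_trans; [exact HN2 | apply Rmin_l]).
  assert (D2 : D < eta / (16 * INR K * X * (INR K + X))) by (eapply Rlt_le_trans; [exact HN2 | apply Rmin_r]).
  assert (D0 : 0 <= D) by apply pow2_ge_0.
  assert (HDc : (RtoC (gate_width n) ^ 2 = RtoC D)%C) by (unfold D; rewrite RtoC_pow; reflexivity).
  rewrite HDc.
  assert (HDv : Cmod (D * v) <= / INR K / 4).
  { rewrite Cmod_mult, Cmod_R, Rabs_right by lra.
    apply Rle_trans with (/ INR K / (4 * X) * X).
    - apply Rmult_le_compat; try lra. apply Cmod_ge_0.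
    - right. field. lra. }
  assert (Ht : / INR K / 2 <= Cmod t).
  { rewrite Cmod_R. apply Rabs_def2 in T1. rewrite Rabs_left; lra. }
  assert (Hden : / INR K / 4 <= Cmod (D * v + t)).
  { pose proof (Cmod_lower t (D * v + t)) as T. replace (t - (D * v + t))%C with (- (D * v))%C in T by ring.
    rewrite Cmod_opp in T. lra. }
  assert (Hden0 : (D * v + t <> 0)%C) by (apply Cmod_pos_neq; lra).
  split; [exact Hden0|].
  assert (HKc : (RtoC (INR K) <> 0)%C) by (intro E; apply RtoC_inj in E; lra).
  (* The new numerator visibly vanishes at the limiting values [t = - 1 / K] and [D = 0]. *)
  replace ((1 - t * v) / (D * v + t) + INR K + v)%C with
    ((INR K * (t + / INR K)%R + D * v * (INR K + v)) / (D * v + t))%C.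
  2: { rewrite RtoC_plus, RtoC_inv by lra. field. auto. }
  eapply Rle_lt_trans.
  - apply (Cmod_div_le _ _ (/ INR K / 4) (INR K * Rabs (t + / INR K) + D * X * (INR K + X))); auto; [lra|].
    apply Cmod_plus_le.
    + rewrite Cmod_mult, !Cmod_R, (Rabs_right (INR K)) by lra. lra.
    + apply Cmod_mult_le; [apply Cmod_mult_le; auto; rewrite Cmod_R, Rabs_right; lra|].
      apply Cmod_plus_le; auto. rewrite Cmod_R, Rabs_right; lra.
  - replace ((INR K * Rabs (t + / INR K) + D * X * (INR K + X)) / (/ INR K / 4)) with
      (Rabs (t + / INR K) * (4 * INR K * INR K) + D * (4 * INR K * X * (INR K + X))) by (field; lra).
    assert (F1 : Rabs (t + / INR K) * (4 * INR K * INR K) < eta / 2).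
    { apply Rmult_lt_compat_r with (r := 4 * INR K * INR K) in T2; [|nra].
      replace (eta / (8 * INR K * INR K) * (4 * INR K * INR K)) with (eta / 2) in T2 by (field; lra). exact T2. }
    assert (F2 : D * (4 * INR K * X * (INR K + X)) < eta / 2).
    { apply Rmult_lt_compat_r with (r := 4 * INR K * X * (INR K + X)) in D2; [|repeat apply Rmult_lt_0_compat; lra].
      replace (eta / (16 * INR K * X * (INR K + X)) * (4 * INR K * X * (INR K + X))) with (eta / 4) in D2 by (field; lra). lra. }
    lra.
Qed.

(** Meant for [W = f^K (w0)] and [w] the perturbed point at time [K]. The bound on [1 / W] keeps [w]
    away from [0], where the coordinate [1 / w] would not be uniformly continuous. *)
Lemma gate_entry (K : nat) (X eta : R) : (0 < K)%nat -> 0 < X -> 0 < eta ->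
  exists d, 0 < d /\ eventually (fun n => forall w W : C,
    W <> 0%C -> Cmod (/ W) <= X -> Cmod (w - W) < d ->
    gate_rel n K w (gate_coord n K w) /\ Cmod (gate_coord n K w + INR K + / W) < eta).
Proof.
  intros HK HX Heta.
  assert (HiX : 0 < / (2 * X)) by (apply Rinv_0_lt_compat; lra).
  set (d := Rmin (/ (2 * X)) (eta / (4 * X * X))).
  assert (Hd : 0 < d) by (apply Rmin_pos; [lra | apply Rdiv_lt_0_compat; nra]).
  assert (Hda : d <= / (2 * X)) by apply Rmin_l. assert (Hdb : d <= eta / (4 * X * X)) by apply Rmin_r.
  exists d. split; [exact Hd|].
  destruct (mobius_limit K (2 * X) (eta / 2) HK ltac:(lra) ltac:(lra)) as [N HN].
  exists (N + 3)%nat. intros n Hn w W HW HWX Hw. specialize (HN n ltac:(lia)).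
  assert (HWm : / X <= Cmod W).
  { rewrite Cmod_inv in HWX by auto. assert (0 < Cmod W) by (apply Cmod_gt_0; auto).
    rewrite <- (Rinv_inv (Cmod W)). apply Rinv_le_contravar; [apply Rinv_0_lt_compat|]; auto. }
  assert (E2 : / X = 2 * / (2 * X)) by (field; lra).
  assert (Hwm : / (2 * X) <= Cmod w).
  { pose proof (Cmod_lower W w) as T. rewrite (Cmod_sub_sym W w) in T. lra. }
  assert (Hw0 : w <> 0%C) by (apply Cmod_pos_neq; lra).
  assert (Hv : Cmod (/ w) <= 2 * X).
  { rewrite Cmod_inv by auto. rewrite <- (Rinv_inv (2 * X)). apply Rinv_le_contravar; lra. }
  destruct (HN _ Hv) as [Hden Hlim].
  assert (Hvd : Cmod (/ W - / w) < eta / 2).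
  { replace (/ W - / w)%C with ((w - W) * / w * / W)%C by (field; auto).
    rewrite !Cmod_mult. apply Rle_lt_trans with (Cmod (w - W) * (2 * X) * X).
    - apply Rmult_le_compat; auto; try apply Cmod_ge_0.
      + apply Rmult_le_pos; apply Cmod_ge_0.
      + apply Rmult_le_compat_l; auto. apply Cmod_ge_0.
    - apply Rlt_le_trans with (eta / (4 * X * X) * (2 * X) * X); [|right; field; lra].
      apply Rmult_lt_compat_r; [lra|]. apply Rmult_lt_compat_r; lra. }
  set (t := gate_point n K) in *. set (D := (RtoC (gate_width n) ^ 2)%C) in *.
  assert (Hden2 : (D + t * w <> 0)%C).
  { intro E. apply Hden. replace (D * / w + t)%C with ((D + t * w) / w)%C by (field; auto). rewrite E. field. auto. }
  assert (Hc : gate_coord n K w = ((1 - t * / w) / (D * / w + t))%C).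
  { unfold gate_coord. fold t D.
    replace (D * / w + t)%C with ((D + t * w) / w)%C by (field; auto). field. auto. }
  assert (Hsq : (D + t ^ 2 <> 0)%C).
  { unfold D. rewrite <- !RtoC_pow, <- RtoC_plus. intro E. apply RtoC_inj in E.
    pose proof (gate_width_pos n ltac:(lia)). nra. }
  assert (Hb : (1 - t * gate_coord n K w = (D + t ^ 2) / (D + t * w))%C).
  { unfold gate_coord. fold t D. field. auto. }
  assert (Hb0 : (1 - t * gate_coord n K w <> 0)%C).
  { rewrite Hb. intro E. apply Hsq.
    replace (D + t ^ 2)%C with ((D + t ^ 2) / (D + t * w) * (D + t * w))%C by (field; auto). rewrite E. ring. }
  split.
  - split; [exact Hb0|]. fold t D. rewrite Hb. unfold gate_coord. fold t D. field. auto.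
  - rewrite <- Hc in Hlim.
    replace (gate_coord n K w + INR K + / W)%C with ((gate_coord n K w + INR K + / w) + (/ W - / w))%C by ring.
    eapply Rle_lt_trans; [apply Cmod_triangle|]. lra.
Qed.

Lemma gate_exit (K : nat) (X eta : R) : (0 < K)%nat -> 0 < X -> 0 < eta ->
  eventually (fun n => forall w y : C, gate_rel n (n - K) w y -> Cmod y <= X ->
    w <> 0%C /\ Cmod (/ w - (INR K - y)) < eta).
Proof.
  intros HK HX Heta.
  destruct (mobius_limit K X eta HK HX Heta) as [N HN].
  exists (N + K + 1)%nat. intros n Hn w y [H1 H2] Hy. specialize (HN n ltac:(lia) (- y)%C).
  rewrite Cmod_opp in HN. destruct (HN Hy) as [Hden Hlim].
  rewrite gate_point_reflect in H1, H2 by lia. rewrite RtoC_opp in H1, H2.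
  set (t := gate_point n K) in *. set (D := (RtoC (gate_width n) ^ 2)%C) in *.
  assert (Hn0 : (- t + D * y <> 0)%C).
  { intro E. apply Hden. replace (D * - y + t)%C with (- (- t + D * y))%C by ring. rewrite E. ring. }
  assert (H1' : (1 + t * y <> 0)%C) by (intro E; apply H1; rewrite <- E; ring).
  assert (Hw0 : w <> 0%C).
  { rewrite H2. intro E. apply Hn0.
    replace (- t + D * y)%C with ((- t + D * y) / (1 - - t * y) * (1 - - t * y))%C by (field; auto).
    rewrite E. ring. }
  split; [exact Hw0|].
  replace (/ w - (INR K - y))%C with (- ((1 - t * - y) / (D * - y + t) + INR K + - y))%C.
  - rewrite Cmod_opp. exact Hlim.
  - rewrite H2. field. auto.
Qed.

Lemma phase_bound (sigma : nat -> nat -> C) (Ms : R) (n : nat) : (0 < n)%nat -> 0 <= Ms ->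
  (forall k, (k < n)%nat -> Cmod (sigma k n) <= Ms) -> Cmod (phase sigma n) <= 2 * Ms.
Proof.
  intros Hn HMs Hs. rewrite phase_csum by auto.
  assert (Hn0 : 0 < INR n) by (apply lt_0_INR; auto).
  assert (Hi : 0 < / INR n) by (apply Rinv_0_lt_compat; auto).
  set (F := fun k => _).
  pose proof (csum_bound F (2 * Ms * / INR n) 0 n ltac:(lia)) as H.
  rewrite Nat.sub_0_r in H.
  replace (INR n * (2 * Ms * / INR n)) with (2 * Ms) in H by (field; lra).
  replace (csum F n) with (csum F n - csum F 0)%C by (simpl; ring).
  apply H. intros j Hj. unfold F. rewrite <- RtoC_inv by lra.
  replace (2 * Ms * / INR n) with (/ INR n * (Ms * 2)) by ring.
  apply Cmod_mult_le; [rewrite Cmod_R, Rabs_right; lra|]. apply Cmod_mult_le; [apply Hs; lia|].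
  rewrite Cmod_R. unfold G. pose proof (SIN_bound (PI * (INR (j + 1) / INR n))). rewrite Rabs_right; nra.
Qed.

Lemma closed_disc_compact (z : C) (R0 : R) : lebesgue_compact (fun w => Cmod (w - z) <= R0).
Proof.
  apply bounded_closed_compact with (B := Cmod z + R0).
  - intros w Hw. pose proof (Cmod_lower w z). lra.
  - intros x Hx. apply Rnot_le_lt in Hx. exists (Cmod (x - z) - R0). split; [lra|].
    intros y Hy Hc. pose proof (Cmod_sub_tri x y z) as T. rewrite (Cmod_sub_sym x y) in T. lra.
Qed.

Lemma compact_preimage (A : C -> Prop) (g : C -> C) (b : R) (c : C) (B : R) :
  (forall x, A x -> Cmod x <= B) ->
  (forall x, ~ A x -> exists d, 0 < d /\ forall y, Cmod (y - x) < d -> ~ A y) ->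
  (forall x, A x -> continuous_C g x) ->
  lebesgue_compact (fun x => A x /\ Cmod (g x + c) <= b).
Proof.
  intros HB Hcl Hg. apply bounded_closed_compact with (B := B).
  - intros x [Hx _]. auto.
  - intros x Hx. destruct (classic (A x)) as [Ax | Ax].
    + assert (Hb : b < Cmod (g x + c)) by (apply Rnot_le_lt; tauto).
      destruct (Hg x Ax (Cmod (g x + c) - b)) as [d [Hd H]]; [lra|].
      exists d. split; [exact Hd|]. intros y Hy [_ Hc]. specialize (H y Hy).
      pose proof (Cmod_lower (g x + c) (g y + c)) as T.
      replace (g x + c - (g y + c))%C with (- (g y - g x))%C in T by ring. rewrite Cmod_opp in T. lra.
    + destruct (Hcl x Ax) as [d [Hd H]]. exists d. split; [exact Hd|]. intros y Hy [Hc _]. exact (H y Hy Hc).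
Qed.

Lemma perturbation_small (eps sigma : nat -> nat -> C) (Ms : R) (e : nat -> R) :
  0 <= Ms ->
  (forall n k, (1 <= n)%nat -> (k < n)%nat -> Cmod (sigma k n) <= Ms) ->
  (forall x, 0 < x -> eventually (fun n => e n < x)) ->
  eventually (fun n => forall k, (k < n)%nat ->
    Cmod (eps k n ^ 2 / gate_width n ^ 2 - 1 - 2 * sigma k n / INR n) <= e n / INR n) ->
  forall x, 0 < x -> eventually (fun n => forall k, (k < n)%nat -> Cmod (eps k n ^ 2) < x).
Proof.
  intros HMs Hs He [N0 HN0] x Hx.
  destruct (He 1 ltac:(lra)) as [N1 HN1].
  destruct (gate_width_small (x / (2 + 2 * Ms))) as [N2 HN2]; [apply Rdiv_lt_0_compat; lra|].
  exists (N0 + N1 + N2 + 3)%nat. intros n Hn k Hk.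
  specialize (HN0 n ltac:(lia) k Hk). specialize (HN1 n ltac:(lia)). specialize (HN2 n ltac:(lia)).
  specialize (Hs n k ltac:(lia) Hk). pose proof (INR_ge_3 n ltac:(lia)) as Hn3.
  pose proof (gate_width_pos n ltac:(lia)) as Hd. set (d := gate_width n) in *.
  assert (Hdc : RtoC d <> 0%C) by (intro E; apply RtoC_inj in E; lra).
  assert (Hi : 0 < / INR n <= 1).
  { split; [apply Rinv_0_lt_compat; lra|]. rewrite <- Rinv_1. apply Rinv_le_contravar; lra. }
  set (c := (eps k n ^ 2 / d ^ 2 - 1 - 2 * sigma k n / INR n)%C) in *.
  assert (Hc : Cmod c <= 1).
  { eapply Rle_trans; [exact HN0|]. unfold Rdiv. nra. }
  assert (H2s : Cmod (2 * sigma k n / INR n) <= 2 * Ms).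
  { replace (2 * Ms) with (2 * Ms / 1) by field. apply Cmod_div_le; [lra | rewrite Cmod_R, Rabs_right; lra|].
    apply Cmod_mult_le; auto. rewrite Cmod_R, Rabs_right; lra. }
  replace (eps k n ^ 2)%C with (d ^ 2 * (c + 1 + 2 * sigma k n / INR n))%C by (unfold c; field; split; auto; intro E; apply RtoC_inj in E; lra).
  rewrite Cmod_mult, Cmod_RtoC_sq.
  apply Rle_lt_trans with (d ^ 2 * (2 + 2 * Ms)).
  - apply Rmult_le_compat_l; [nra|]. replace (2 + 2 * Ms) with (1 + 1 + 2 * Ms) by ring.
    apply Cmod_plus_le; auto. apply Cmod_plus_le; auto. rewrite Cmod_1. lra.
  - apply Rmult_lt_compat_r with (r := 2 + 2 * Ms) in HN2; [|lra].
    replace (x / (2 + 2 * Ms) * (2 + 2 * Ms)) with x in HN2 by (field; lra). exact HN2.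
Qed.

Lemma local_expansion (U : C -> Prop) (f : C -> C) (a : C) :
  open (T := C_UniformSpace) U -> U (RtoC 0) -> parabolic_expansion f a ->
  exists rr M, 0 < rr /\ 0 <= M /\ (forall w, Cmod w < rr -> U w) /\
    forall w, Cmod w < rr -> Cmod (f w - (w + w ^ 2 + a * w ^ 3)) <= M * Cmod w ^ 4.
Proof.
  intros HU U0 [M HM]. apply locally_Cmod in HM. destruct HM as [d1 [Hd1 H1]].
  destruct (proj1 (locally_Cmod _ _) (HU _ U0)) as [d2 [Hd2 H2]].
  exists (Rmin d1 d2), (Rmax M 0). split; [apply Rmin_pos; auto|]. split; [apply Rmax_r|].
  assert (E : forall w : C, (w - 0)%C = w) by (intro; ring).
  split; intros w Hw.
  - apply H2. rewrite E. eapply Rlt_le_trans; [exact Hw | apply Rmin_r].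
  - eapply Rle_trans; [apply H1; rewrite E; eapply Rlt_le_trans; [exact Hw | apply Rmin_l]|].
    apply Rmult_le_compat_r; [apply pow_le, Cmod_ge_0 | apply Rmax_l].
Qed.

(** One entry time [m] serves a whole disc. Before [m] the iterates stay in [U] by continuity; from
    [m] on they lie in the petal, which is contained in [U]. *)
Lemma basin_neighbourhood (U : C -> Prop) (f : C -> C) (r : R) (phi : C -> C) (z : C) :
  open (T := C_UniformSpace) U -> holomorphic_on U f -> 0 < r -> near_translation f r ->
  (forall w, Cmod w < 2 * r -> U w) ->
  holomorphic_on (attracting_petal r) phi ->
  (forall w, attracting_petal r w -> phi (f w) = (phi w + 1)%C) ->
  basin U f r z ->
  exists (d B : R) (m : nat), 0 < d /\ 0 <= B /\
    forall w, Cmod (w - z) <= d ->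
      (forall j, iter_defined U f j w) /\ attracting_petal r (Nat.iter m f w) /\
      (forall k, (m <= k)%nat -> phi (Nat.iter k f w) = (attracting_extension f r phi w + INR k)%C) /\
      Cmod (attracting_extension f r phi w) <= B.
Proof.
  intros HU Hf Hr Hn HUr Hhol Hphi [m [Hdef Hpet]].
  destruct (holomorphic_continuous _ phi _ Hhol Hpet 1 ltac:(lra)) as [e1 [He1 H1]].
  destruct (proj1 (locally_Cmod _ _) (attracting_petal_open r _ Hpet)) as [e2 [He2 H2]].
  destruct (perturbed_orbit_continuity U f m z HU Hf Hdef (Rmin e1 e2)) as [d [Hd H]].
  { apply Rmin_pos; auto. }
  exists (d / 2), (Cmod (phi (Nat.iter m f z)) + 1 + INR m), m.
  pose proof (pos_INR m) as Hm0. pose proof (Cmod_ge_0 (phi (Nat.iter m f z))) as HB0.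
  split; [lra|]. split; [lra|]. intros w Hw.
  destruct (H w (fun _ => 0%C) ltac:(lra)) as [H3 H4].
  { intros j Hj. simpl. rewrite Cmult_0_l, Cmod_0. exact Hd. }
  rewrite perturbed_orbit_zero in H4.
  assert (Hp : attracting_petal r (Nat.iter m f w)).
  { apply H2. eapply Rlt_le_trans; [exact H4 | apply Rmin_r]. }
  assert (Hph : Cmod (phi (Nat.iter m f w) - phi (Nat.iter m f z)) < 1).
  { apply H1. eapply Rlt_le_trans; [exact H4 | apply Rmin_l]. }
  assert (Hk : forall k, (m <= k)%nat -> attracting_petal r (Nat.iter k f w)).
  { intros k Hk. destruct (attracting_petal_iter f r _ (k - m) Hr Hn Hp) as [Hk1 _].
    rewrite <- Nat.iter_add in Hk1. replace (k - m + m)%nat with k in Hk1 by lia. exact Hk1. }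
  pose proof (attracting_extension_eq f r phi w m Hk Hphi) as Hext.
  split; [|split; [exact Hp|split]].
  - intros j i Hi. destruct (Nat.lt_ge_cases i m) as [Him | Him].
    + specialize (H3 i Him). rewrite perturbed_orbit_zero in H3. exact H3.
    + apply HUr, Cmod_petal_lt. left. apply Hk. exact Him.
  - intros k Hkk. rewrite (Hext k Hkk). ring.
  - rewrite (Hext m (Nat.le_refl m)).
    eapply Rle_trans; [apply Cmod_sub_le|]. rewrite Cmod_R, Rabs_right by lra.
    pose proof (Cmod_lower (phi (Nat.iter m f w)) (phi (Nat.iter m f z))). lra.
Qed.

Lemma sqrt_sublinear (A : R) (c : R) : 0 <= A -> 0 < c ->
  exists N, forall n, (N <= n)%nat -> A * (1 + sqrt (INR n)) <= c * INR n.
Proof.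
  intros HA Hc. destruct (nat_above ((2 * A / c) ^ 2 + 1)) as [N HN].
  exists N. intros n Hn. specialize (HN n Hn).
  assert (H0 : 0 <= 2 * A / c) by (apply Rdiv_le_0_compat; lra).
  assert (Hs : 2 * A / c <= sqrt (INR n)) by (apply le_sqrt; lra).
  assert (Hs1 : 1 <= sqrt (INR n)) by (apply le_sqrt; [lra|]; pose proof (pow2_ge_0 (2 * A / c)); lra).
  pose proof (pow2_ge_0 (2 * A / c)).
  pose proof (sqrt_sqrt (INR n) ltac:(lra)) as E. set (s := sqrt (INR n)) in *.
  rewrite <- E. apply Rmult_le_compat_l with (r := c) in Hs; [|lra].
  replace (c * (2 * A / c)) with (2 * A) in Hs by (field; lra).
  apply Rle_trans with (2 * A * s); [nra|]. replace (c * (s * s)) with (c * s * s) by ring.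
  apply Rmult_le_compat_r; lra.
Qed.

(** * Choice of the constants and conclusion *)

Theorem theorem1p1 (U : C -> Prop) (f : C -> C) (a : C)
  (U_open : open (T := C_UniformSpace) U) (U_0 : U (RtoC 0))
  (f_holomorphic : holomorphic_on U f)
  (f_expansion : parabolic_expansion f a) :
  exists r0 : R, (0 < r0)%R /\
  forall r : R, (0 < r < r0)%R ->
  forall phi_i phi_o : C -> C,
  attracting_fatou_coordinate f a r phi_i ->
  repelling_fatou_coordinate f a r phi_o ->
  (forall zeta : C, exists z : C, is_inverse_extension U f r phi_o zeta z) ->
  forall (eps sigma : nat -> nat -> C) (alpha : R),
  (0 < alpha < 1)%R ->
  (exists M : R, eventually (fun n => forall k, (k < n)%nat ->
     (Cmod (eps k n - (PI / INR n + PI / INR n ^ 2 * sigma k n))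
        <= M / Rpower (INR n) (2 + alpha))%R)) ->
  (exists M : R, forall n k, (1 <= n)%nat -> (k < n)%nat ->
     (Cmod (sigma k n) <= M)%R) ->
  forall z : C, basin U f r z ->
  exists V : C -> Prop, locally (T := C_UniformSpace) z V /\
  forall eta : posreal, eventually (fun n => forall w0 : C,
    V w0 -> basin U f r w0 ->
    (forall k, (k < n)%nat ->
       U (perturbed_orbit f (fun j => eps j n) w0 k)) /\
    (Cmod (perturbed_orbit f (fun j => eps j n) w0 n
           - lavaurs U f r phi_i phi_o (phase sigma n) w0) < eta)%R).
Proof.
  destruct (local_expansion U f a U_open U_0 f_expansion) as [rr [M [Hrr [HM [HUrr Hexp]]]]].
  destruct (inverse_coordinate_step f a rr M Hrr HM Hexp) as [rho [C0 [Hrho [HC0 Hinv]]]].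
  assert (Hi8 : 0 < / (8 * C0)) by (apply Rinv_0_lt_compat; lra).
  (* The halves keep both petals where the expansion and the estimate in [1 / w] hold; the last term
     brings the deviation from a translation down to [1 / 4]. *)
  exists (Rmin (rr / 2) (Rmin (rho / 2) (/ (8 * C0)))).
  split; [repeat apply Rmin_pos; lra|].
  intros r [Hr Hr0] phi_i phi_o [[Hi_hol _] [Hi_eq Hi_lim]] [[Ho_hol Ho_inj] [Ho_eq Ho_lim]]
    Hext eps sigma alpha [Halpha _] [M1 Heps] [M2 Hsig] z Hz.
  assert (Hr1 : 2 * r < rr).
  { assert (r < rr / 2) by (eapply Rlt_le_trans; [exact Hr0 | apply Rmin_l]). lra. }
  assert (Hr2 : 2 * r < rho).
  { assert (r < rho / 2) by (eapply Rlt_le_trans; [exact Hr0 | eapply Rle_trans; [apply Rmin_r | apply Rmin_l]]). lra. }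
  assert (Hr3 : r < / (8 * C0)).
  { eapply Rlt_le_trans; [exact Hr0 | eapply Rle_trans; [apply Rmin_r | apply Rmin_r]]. }
  assert (Hnt : near_translation f r).
  { intros w Hw0 Hw. destruct (Hinv w Hw0 ltac:(lra)) as [H1 H2]. split; [exact H1|].
    eapply Rle_trans; [exact H2|]. apply Rle_trans with (C0 * (2 * / (8 * C0))).
    - apply Rmult_le_compat_l; lra.
    - right. field. lra. }
  assert (HUr : forall w, Cmod w < 2 * r -> U w) by (intros; apply HUrr; lra).
  assert (Hi_as : forall e, 0 < e -> exists d, 0 < d /\ forall w, attracting_petal r w -> Cmod w < d ->
     Cmod (phi_i w - (- / w + (1 - a) * Clog (- (1) * w))) < e).
  { intros e He. destruct (within_limit _ _ Hi_lim e He) as [d [Hd H]]. exists d. split; [exact Hd|].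
    intros w Hw Hwd. replace (- (1) * w)%C with (- w)%C by ring. auto. }
  assert (Ho_as : forall e, 0 < e -> exists d, 0 < d /\ forall w, repelling_petal r w -> Cmod w < d ->
     Cmod (phi_o w - (- / w + (1 - a) * Clog (1 * w))) < e).
  { intros e He. destruct (within_limit _ _ Ho_lim e He) as [d [Hd H]]. exists d. split; [exact Hd|].
    intros w Hw Hwd. replace (1 * w)%C with w by ring. auto. }
  destruct (basin_neighbourhood U f r phi_i z U_open f_holomorphic Hr Hnt HUr Hi_hol Hi_eq Hz)
    as [dz [B [m [Hdz [HB HD]]]]].
  set (D := fun w => Cmod (w - z) <= dz) in *.
  set (Phi := attracting_extension f r phi_i) in *.
  set (Ms := Rmax M2 0). assert (HMs : 0 <= Ms) by apply Rmax_r.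
  assert (HsigM : forall n k, (1 <= n)%nat -> (k < n)%nat -> Cmod (sigma k n) <= Ms).
  { intros n k Hn Hk. eapply Rle_trans; [apply Hsig; auto | apply Rmax_l]. }
  (* A bound for [Phi w0 + u_n], since [0 <= G <= 2]. *)
  set (BZ := B + 2 * Ms).
  destruct (perturbation_size eps sigma alpha (Rmax M1 0) Ms Halpha (Rmax_r _ _) HMs) as [Cc [HCc Hchi]]; auto.
  { destruct Heps as [N HN]. exists N. intros n Hn k Hk. eapply Rle_trans; [apply HN; auto|].
    apply Rmult_le_compat_r; [left; apply Rinv_0_lt_compat, exp_pos | apply Rmax_l]. }
  set (e := fun n => Cc / INR n + Cc / Rpower (INR n) alpha).
  assert (He : forall x, 0 < x -> eventually (fun n => e n < x)).
  { intros x Hx. destruct (eventually_div_lt Cc (x / 2) ltac:(lra)) as [N1 HN1].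
    destruct (eventually_inv_Rpower Cc (x / 2) alpha Halpha ltac:(lra)) as [N2 HN2].
    exists (N1 + N2)%nat. intros n Hn. specialize (HN1 n ltac:(lia)). specialize (HN2 n ltac:(lia)).
    unfold e. lra. }
  pose proof (perturbation_small eps sigma Ms e HMs HsigM He Hchi) as Heps2.
  destruct (gate_passage f a rr M Ms eps sigma e Hrr HM HMs Hexp HsigM He Hchi)
    as [c1 [A1 [J1 [Hc1 [HA1 Hgate]]]]].
  destruct (repelling_preimage f a r BZ phi_o Hr Hnt ltac:(unfold BZ; lra) Ho_eq Ho_hol Ho_as)
    as [j0 [Hj0 [Hcell [Hdesc Hsurj]]]].
  destruct (attracting_iter_asymptotics f a r B m phi_i Phi D Hr Hnt Hi_as) as [Hlin Hlog]; auto.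
  { intros w Hw. apply HD. exact Hw. }
  { intros w k Hw. apply HD. exact Hw. }
  { intros w Hw. apply HD. exact Hw. }
  (* [c1 / 2] makes the initial lag admissible for the passage; [1 / 32] helps to keep the lag at
     exit below [j / 8], so that the orbit leaves through [repelling_cell j]. *)
  set (kap := Rmin (c1 / 2) (1 / 32)).
  assert (Hkap : 0 < kap) by (apply Rmin_pos; lra).
  assert (Hkap1 : kap <= c1 / 2) by apply Rmin_l. assert (Hkap2 : kap <= 1 / 32) by apply Rmin_r.
  destruct (Hlin kap Hkap) as [J2 HJ2].
  destruct (sqrt_sublinear A1 (1 / 32) ltac:(lra) ltac:(lra)) as [J3 HJ3].
  destruct (nat_above (4 / c1 + 64)) as [J4 HJ4].
  (* Fixed before [eta] is introduced, so that the last [J] steps take place near a compact set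
     independent of the precision. *)
  set (J := (J1 + j0 + J2 + J3 + J4 + m + 1)%nat).
  assert (HJ64 : 4 / c1 + 64 < INR J) by (apply HJ4; unfold J; lia).
  assert (Hc1J : 4 < c1 * INR J).
  { assert (0 < 4 / c1) by (apply Rdiv_lt_0_compat; lra).
    replace 4 with (c1 * (4 / c1)) at 1 by (field; lra). apply Rmult_lt_compat_l; lra. }
  assert (HJ0 : 0 < 4 / c1) by (apply Rdiv_lt_0_compat; lra).
  (* At time [J] the lag is [- 1 / f^J w0 - J] up to [1], and that main part has modulus at most
     [kap J]. *)
  set (Y0 := kap * INR J + 1).
  assert (HY0 : 0 <= Y0) by (unfold Y0; nra).
  assert (HY0c : 1 + Y0 <= c1 * INR J).
  { unfold Y0. assert (kap * INR J <= c1 / 2 * INR J) by (apply Rmult_le_compat_r; lra). lra. }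
  assert (HY0j : forall j, (J <= j)%nat -> Y0 + A1 * (1 + sqrt (INR j)) <= INR j / 8 - 1).
  { intros j Hj. specialize (HJ3 j ltac:(unfold J in *; lia)).
    assert (INR J <= INR j) by (apply le_INR; auto).
    assert (kap * INR J <= 1 / 32 * INR J) by (apply Rmult_le_compat_r; lra).
    unfold Y0. lra. }
  specialize (Hgate J Y0 ltac:(unfold J; lia) HY0 HY0c).
  exists (fun w => Cmod (w - z) < dz). split; [apply locally_Cmod; exists dz; auto|].
  intros [eta Heta]. simpl.
  assert (HJpos : (0 < J)%nat) by (unfold J; lia).
  assert (Hphio_c : forall j w, (J <= j)%nat -> repelling_cell j w -> continuous_C phi_o w).
  { intros j w Hj Hw. apply (holomorphic_continuous (repelling_petal r)); auto.
    apply (Hcell j); auto. unfold J in Hj; lia. }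
  (* The points of the cell from which [J] steps of [f] lead to the inverse extension at some [zeta]
     with [|zeta| <= BZ]. *)
  set (Qs := fun q => repelling_cell J q /\ Cmod (phi_o q + INR J) <= BZ).
  assert (HQval : forall q zeta, repelling_cell J q -> phi_o q = (zeta - INR J)%C -> Cmod zeta <= BZ ->
     iter_defined U f J q /\ inverse_extension U f r phi_o zeta = Nat.iter J f q).
  { intros q zeta Hq Hpq Hzeta.
    apply (inverse_extension_value U f r BZ phi_o j0); auto. unfold J; lia. }
  assert (HQc : lebesgue_compact Qs).
  { apply compact_preimage with (B := / (3 / 4 * INR J)).
    - intros x. apply repelling_cell_small; auto.
    - intros x. apply repelling_cell_closed; auto.
    - intros x. apply Hphio_c; auto. }
  (* Tolerances are chosen backwards from [eta]: [d1] for the distance at time [n - J], then [d2]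
     for the difference of the values of [phi_o] there. *)
  destruct (perturbed_orbit_uniform U Qs f J U_open f_holomorphic HQc) with (eta := eta) as [d1 [Hd1 Hlast]]; auto.
  { intros q [Hq1 Hq2]. apply (HQval q (phi_o q + INR J)%C); auto. ring. }
  destruct (uniform_injectivity (repelling_cell J) phi_o (repelling_cell_compact J HJpos)) with (e := d1) as [d2 [Hd2 Hinj]]; auto.
  { intros x. apply Hphio_c. auto. }
  { intros x y Hx Hy. apply Ho_inj; apply (Hcell J); auto; unfold J; lia. }
  (* The budget: [6 h] at time [n - K] and [h] more until [n - J], which is less than [d2 = 8 h]. *)
  set (h := d2 / 8). assert (Hh : 0 < h) by (unfold h; lra).
  destruct (Hlog h Hh) as [K1 HK1].
  assert (Ho_neq : forall w, repelling_petal r w -> w <> 0%C).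
  { intros w Hw. apply (repelling_petal_iff r w Hr) in Hw. tauto. }
  destruct (fatou_log_asymptotics (repelling_petal r) phi_o a 1 Ho_neq Cmod_1 Ho_as h Hh)
    as [dl [kl [Hdl [Hkl Hlogo]]]].
  destruct (sqrt_sublinear (Y0 + A1 + 1) kl ltac:(lra) Hkl) as [K2 HK2].
  destruct (nat_above (2 * / dl)) as [K3 HK3].
  destruct (nat_above (1 + 2 * A1 * (1 + Y0) / h + (2 * A1 / h) ^ 2)) as [K4 HK4].
  set (K := (J + K1 + K2 + K3 + K4)%nat).
  specialize (HK2 K ltac:(unfold K; lia)). specialize (HK3 K ltac:(unfold K; lia)).
  specialize (HK4 K ltac:(unfold K; lia)).
  assert (HJK : (J <= K)%nat) by (unfold K; lia).
  assert (HKJr : INR J <= INR K) by (apply le_INR; auto).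
  assert (HKpos : (0 < K)%nat) by lia.
  assert (Hpass : A1 * (1 + Y0) / (INR K - 1) + A1 / sqrt (INR K - 1) <= h).
  { assert (T0 : 0 <= A1 * (1 + Y0)) by (apply Rmult_le_pos; lra).
    assert (T1 : 0 <= 2 * A1 * (1 + Y0) / h) by (apply Rdiv_le_0_compat; lra).
    assert (T2 : 0 <= 2 * A1 / h) by (apply Rdiv_le_0_compat; lra).
    pose proof (pow2_ge_0 (2 * A1 / h)) as T3.
    assert (Hs : 2 * A1 / h <= sqrt (INR K - 1)) by (apply le_sqrt; lra).
    assert (Hs0 : 0 < sqrt (INR K - 1)) by (apply sqrt_lt_R0; lra).
    assert (F1 : A1 * (1 + Y0) / (INR K - 1) <= h / 2).
    { apply Rmult_le_reg_r with (INR K - 1); [lra|].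
      replace (A1 * (1 + Y0) / (INR K - 1) * (INR K - 1)) with (h / 2 * (2 * A1 * (1 + Y0) / h)) by (field; lra).
      apply Rmult_le_compat_l; lra. }
    assert (F2 : A1 / sqrt (INR K - 1) <= h / 2).
    { apply Rmult_le_reg_r with (sqrt (INR K - 1)); [lra|].
      replace (A1 / sqrt (INR K - 1) * sqrt (INR K - 1)) with (h / 2 * (2 * A1 / h)) by (field; lra).
      apply Rmult_le_compat_l; lra. }
    lra. }
  (* The share of each of the [K - J] steps from [n - K] to [n - J]. *)
  set (h3 := h / (INR K + 1)). assert (Hh3 : 0 < h3) by (apply Rdiv_lt_0_compat; lra).
  destruct (common_radius (fun j d => forall x y, repelling_cell j x -> Cmod (y - x) < d ->
      repelling_petal r y /\ Cmod (phi_o y - phi_o x) < h3) J K) as [d3 [Hd3 Hcont]].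
  { intros j d d' H Hdd x y Hx Hy. apply H; auto. lra. }
  { intros j Hj. apply (uniform_continuity (repelling_cell j) (repelling_petal r) phi_o); auto.
    - apply repelling_cell_compact. lia.
    - apply repelling_petal_open.
    - intros x. apply Hcell. unfold J in Hj; lia.
    - intros x. apply Hphio_c. lia. }
  destruct (gate_entry J (2 * INR J) 1 HJpos ltac:(lra) ltac:(lra)) as [d4 [Hd4 [N1 HN1]]].
  destruct (gate_entry K (2 * INR K) h HKpos ltac:(lra) Hh) as [d5 [Hd5 [N2 HN2]]].
  assert (HDc : lebesgue_compact D) by apply closed_disc_compact.
  assert (HDdef : forall k w, D w -> iter_defined U f k w) by (intros k w Hw; apply (HD w Hw)).
  destruct (perturbed_orbit_uniform U D f J U_open f_holomorphic HDc (HDdef J) d4 Hd4) as [d6 [Hd6 HfirstJ]].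
  destruct (perturbed_orbit_uniform U D f K U_open f_holomorphic HDc (HDdef K) d5 Hd5) as [d7 [Hd7 HfirstK]].
  set (dmin := Rmin (Rmin d1 d3) (Rmin d6 d7)).
  assert (Hdm : 0 < dmin) by (repeat apply Rmin_pos; auto).
  assert (Hdm1 : dmin <= d1 /\ dmin <= d3 /\ dmin <= d6 /\ dmin <= d7).
  { unfold dmin. pose proof (Rmin_l (Rmin d1 d3) (Rmin d6 d7)). pose proof (Rmin_r (Rmin d1 d3) (Rmin d6 d7)).
    pose proof (Rmin_l d1 d3). pose proof (Rmin_r d1 d3). pose proof (Rmin_l d6 d7). pose proof (Rmin_r d6 d7). lra. }
  destruct (Heps2 dmin Hdm) as [N3 HN3].
  (* The bound [1] serves the membership in the cells, the bound [h] the value of [phi_o]. *)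
  set (h' := Rmin h 1). assert (Hh' : 0 < h') by (apply Rmin_pos; lra).
  assert (Hh'1 : h' <= h) by apply Rmin_l. assert (Hh'2 : h' <= 1) by apply Rmin_r.
  destruct (eventually_forall_le (fun j n => forall w y : C, gate_rel n (n - j) w y -> Cmod y <= INR K ->
    w <> 0%C /\ Cmod (/ w - (INR j - y)) < h') J K) as [N4 HN4].
  { intros j Hj. apply gate_exit; auto; [lia|lra]. }
  destruct (eventually_div_lt (A1 * INR K) (h / 2) ltac:(lra)) as [N5 HN5].
  destruct (He (h / 2) ltac:(lra)) as [N6 HN6].
  destruct Hgate as [N7 HN7].
  exists (N1 + N2 + N3 + N4 + N5 + N6 + N7 + 2 * K + 3)%nat. intros n Hn w0 HV _.
  specialize (HN1 n ltac:(lia)). specialize (HN2 n ltac:(lia)). specialize (HN3 n ltac:(lia)).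
  specialize (HN4 n ltac:(lia)). specialize (HN5 n ltac:(lia)). specialize (HN6 n ltac:(lia)).
  specialize (HN7 n ltac:(lia)). cbv beta in HN4.
  assert (Hn3 : (3 <= n)%nat) by lia.
  assert (HDw : D w0) by (unfold D; lra).
  destruct (HD w0 HDw) as [_ [_ [_ HPhi]]].
  set (u := phase sigma n).
  assert (Hu : Cmod u <= 2 * Ms) by (apply phase_bound; auto; [lia|]; intros; apply HsigM; auto; lia).
  set (en := fun j => eps j n). set (w := perturbed_orbit f en w0).
  assert (Hw00 : Cmod (w0 - w0) = 0) by (replace (w0 - w0)%C with (RtoC 0) by ring; apply Cmod_0).
  destruct (HfirstJ w0 w0 en HDw ltac:(lra)) as [HUJ HwJ].
  { intros j Hj. eapply Rlt_le_trans; [apply HN3; lia | lra]. }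
  destruct (HfirstK w0 w0 en HDw ltac:(lra)) as [_ HwK].
  { intros j Hj. eapply Rlt_le_trans; [apply HN3; lia | lra]. }
  fold w in HUJ, HwJ, HwK.
  assert (HWJ : forall k, (J <= k)%nat -> Nat.iter k f w0 <> 0%C /\ Cmod (/ Nat.iter k f w0 + INR k) <= kap * INR k
                /\ Cmod (/ Nat.iter k f w0) <= 2 * INR k).
  { intros k Hk. assert (Hkr : INR J <= INR k) by (apply le_INR; auto).
    pose proof (HJ2 k w0 ltac:(unfold J in Hk; lia) HDw) as H1.
    destruct (attracting_iter_small f r m w0 k Hr Hnt (proj1 (proj2 (HD w0 HDw)))) as [_ [H2 _]].
    { unfold J in Hk; lia. }
    split; [exact H2|]. split; [exact H1|].
    pose proof (Cmod_sub_le (/ Nat.iter k f w0 + INR k) (INR k)) as T.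
    replace (/ Nat.iter k f w0 + INR k - INR k)%C with (/ Nat.iter k f w0)%C in T by ring.
    rewrite Cmod_R, Rabs_right in T by lra.
    assert (kap * INR k <= 1 / 32 * INR k) by (apply Rmult_le_compat_r; lra). lra. }
  destruct (HWJ J (Nat.le_refl J)) as [HWJ0 [HWJ1 HWJ2]].
  destruct (HN1 (w J) _ HWJ0 HWJ2 HwJ) as [HrelJ HyJ].
  assert (HyJ0 : Cmod (gate_coord n J (w J)) <= Y0).
  { unfold Y0. pose proof (Cmod_sub_le (gate_coord n J (w J) + INR J + / Nat.iter J f w0) (/ Nat.iter J f w0 + INR J)) as T.
    replace (gate_coord n J (w J) + INR J + / Nat.iter J f w0 - (/ Nat.iter J f w0 + INR J))%C
      with (gate_coord n J (w J)) in T by ring. lra. }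
  destruct (HN7 w) with (y0 := gate_coord n J (w J)) as [Hmid Hend]; auto.
  specialize (Hend K HJK ltac:(lia)). fold u in Hend.
  destruct (HWJ K HJK) as [HWK0 [HWK1 HWK2]].
  destruct (HN2 (w K) _ HWK0 HWK2 HwK) as [_ HyK].
  assert (Hexit : forall j, (J <= j <= K)%nat ->
     w (n - j)%nat <> 0%C /\ Cmod (gate_coord n (n - j) (w (n - j)%nat)) <= INR j / 8 - 1 /\
     Cmod (/ w (n - j)%nat - (INR j - gate_coord n (n - j) (w (n - j)%nat))) < h' /\
     repelling_cell j (w (n - j)%nat)).
  { intros j Hj. destruct (Hmid (n - j)%nat ltac:(lia)) as [H1 [H2 _]].
    rewrite Nat.min_r in H2 by lia. replace (n - (n - j))%nat with j in H2 by lia.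
    specialize (HY0j j ltac:(lia)).
    assert (HjK : INR j <= INR K) by (apply le_INR; lia).
    assert (HjJ : INR J <= INR j) by (apply le_INR; lia).
    destruct (HN4 j Hj _ _ H1) as [H3 H4]; [lra|].
    split; [exact H3|]. split; [lra|]. split; [exact H4|].
    apply repelling_cell_iff; auto.
    pose proof (Cmod_sub_le (/ w (n - j)%nat - (INR j - gate_coord n (n - j) (w (n - j)%nat)))
       (gate_coord n (n - j) (w (n - j)%nat))) as T.
    replace (/ w (n - j)%nat - (INR j - gate_coord n (n - j) (w (n - j)%nat)) - gate_coord n (n - j) (w (n - j)%nat))%C
      with (/ w (n - j)%nat - INR j)%C in T by ring. lra. }
  destruct (Hexit K ltac:(lia)) as [HeK0 [_ [HeK1 HeK2]]].
  (* One [h] each for the asymptotics of [phi_o], the exit, the entry and the asymptotics of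
     [phi_i], and [2 h] for the passage. The term [l], which is [(1 - a) ln K], cancels between the
     two Fatou coordinates. *)
  assert (HphiK : Cmod (phi_o (w (n - K)%nat) - (Phi w0 + u - INR K)) < 6 * h).
  { assert (HpK : repelling_petal r (w (n - K)%nat)) by (apply (Hcell K); auto; unfold K, J; lia).
    assert (Hsm : Cmod (w (n - K)%nat) < dl).
    { eapply Rle_lt_trans; [apply (repelling_cell_small K); auto|].
      assert (0 < / dl) by (apply Rinv_0_lt_compat; lra).
      rewrite <- (Rinv_inv dl). apply Rinv_lt_contravar; [|lra]. apply Rmult_lt_0_compat; lra. }
    assert (Hkk : Cmod (/ (1 * w (n - K)%nat) - INR K) <= kl * INR K).
    { replace (1 * w (n - K)%nat)%C with (w (n - K)%nat) by ring.
      destruct (Hmid (n - K)%nat ltac:(lia)) as [_ [H2 _]].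
      rewrite Nat.min_r in H2 by lia. replace (n - (n - K))%nat with K in H2 by lia.
      pose proof (Cmod_sub_le (/ w (n - K)%nat - (INR K - gate_coord n (n - K) (w (n - K)%nat)))
         (gate_coord n (n - K) (w (n - K)%nat))) as T.
      replace (/ w (n - K)%nat - (INR K - gate_coord n (n - K) (w (n - K)%nat)) - gate_coord n (n - K) (w (n - K)%nat))%C
        with (/ w (n - K)%nat - INR K)%C in T by ring.
      pose proof (sqrt_pos (INR K)) as Hsq.
      assert (0 <= Y0 * sqrt (INR K)) by (apply Rmult_le_pos; lra). lra. }
    pose proof (Hlogo (w (n - K)%nat) (INR K) HpK Hsm ltac:(lra) Hkk) as G1.
    pose proof (HK1 K w0 ltac:(unfold K; lia) HDw) as G2.
    assert (G3 : Cmod (gate_coord n (n - K) (w (n - K)%nat) - gate_coord n K (w K) - u) < 2 * h) by (unfold e in *; lra).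
    set (yK := gate_coord n K (w K)) in *. set (yE := gate_coord n (n - K) (w (n - K)%nat)) in *.
    set (v := (/ w (n - K)%nat)%C) in *. set (V := (/ Nat.iter K f w0)%C) in *.
    set (l := ((1 - a) * ln (INR K))%C) in *.
    replace (phi_o (w (n - K)%nat) - (Phi w0 + u - INR K))%C with
      ((phi_o (w (n - K)%nat) + v + l) - (v - (INR K - yE)) + (yE - yK - u) + (yK + INR K + V)
        + (- V - INR K - (Phi w0 + l)))%C by ring.
    eapply Rle_lt_trans.
    { apply Cmod_plus_le; [apply Cmod_plus_le; [apply Cmod_plus_le; [apply Cmod_minus_le|]|]|]; apply Rle_refl. }
    lra. }
  (* An unperturbed step would raise [phi_o] by exactly [1]; the perturbation moves its result by
     less than [d3], at a cost below [h3]. *)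
  assert (Hback : forall t, (t <= K - J)%nat ->
     Cmod (phi_o (w (n - (K - t))%nat) - (Phi w0 + u - INR (K - t))) < 6 * h + INR t * h3).
  { induction t as [|t IH]; intros Ht.
    - rewrite Nat.sub_0_r. simpl. lra.
    - specialize (IH ltac:(lia)). rewrite S_INR.
      set (j := (K - S t)%nat). replace (K - t)%nat with (S j) in IH by (unfold j; lia).
      assert (Hj1 : (J <= j <= K)%nat) by (unfold j; lia).
      assert (Hj2 : (S j <= K)%nat) by (unfold j; lia).
      destruct (Hexit j Hj1) as [_ [_ [_ Hc1']]].
      destruct (Hexit (S j) ltac:(lia)) as [_ [_ [_ Hc2]]].
      replace (n - j)%nat with (S (n - S j)) in * by lia.
      set (i := (n - S j)%nat) in *.
      assert (Hws : w (S i) = (f (w i) + eps i n ^ 2)%C) by reflexivity.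
      assert (Hnear : Cmod (f (w i) - w (S i)) < d3).
      { rewrite Hws. replace (f (w i) - (f (w i) + eps i n ^ 2))%C with (- eps i n ^ 2)%C by (simpl; ring).
        replace (- eps i n ^ 2)%C with (- (eps i n ^ 2))%C by (simpl; ring).
        rewrite Cmod_opp. eapply Rlt_le_trans; [apply HN3; unfold i; lia | lra]. }
      destruct (Hcont j Hj1 (w (S i)) (f (w i)) Hc1' Hnear) as [Hp1 Hp2].
      assert (Hp3 : repelling_petal r (w i)) by (apply (Hcell (S j)); auto; unfold J in Hj1; lia).
      rewrite (Ho_eq _ Hp3 Hp1) in Hp2. rewrite S_INR, RtoC_plus in IH.
      replace (phi_o (w (S i)) - (Phi w0 + u - INR j))%C with
        ((phi_o (w i) - (Phi w0 + u - (INR j + 1))) - (phi_o (w i) + 1 - phi_o (w (S i))))%C by ring.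
      eapply Rle_lt_trans; [apply Cmod_sub_le|]. lra. }
  specialize (Hback (K - J)%nat (Nat.le_refl _)). replace (K - (K - J))%nat with J in Hback by lia.
  assert (Hh3K : INR (K - J) * h3 <= h).
  { assert (INR (K - J) <= INR K) by (apply le_INR; lia).
    apply Rle_trans with (INR K * h3); [apply Rmult_le_compat_r; lra|].
    unfold h3. apply Rmult_le_reg_r with (INR K + 1); [lra|].
    replace (INR K * (h / (INR K + 1)) * (INR K + 1)) with (h * INR K) by (field; lra).
    apply Rmult_le_compat_l; lra. }
  set (zeta := (Phi w0 + u)%C) in *.
  assert (Hzeta : Cmod zeta <= BZ) by (unfold zeta, BZ; apply Cmod_plus_le; auto).
  destruct (Hsurj J zeta ltac:(unfold J; lia) Hzeta) as [q [Hq1 Hq2]].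
  destruct (HQval q zeta Hq1 Hq2 Hzeta) as [_ HL].
  destruct (Hexit J ltac:(lia)) as [_ [_ [_ HeJ]]].
  (* The orbit point and the ideal point [q] lie in the same cell with nearby values of [phi_o];
     quantitative injectivity makes the points themselves close. *)
  assert (Hclose : Cmod (w (n - J)%nat - q) < d1).
  { apply Hinj; auto. rewrite Hq2. unfold h in *. lra. }
  assert (HQq : Qs q).
  { split; auto. rewrite Hq2. replace (zeta - INR J + INR J)%C with zeta by ring. exact Hzeta. }
  destruct (Hlast q (w (n - J)%nat) (fun i => en (n - J + i)%nat) HQq Hclose) as [HUl Hfin].
  { intros j Hj. eapply Rlt_le_trans; [apply HN3; lia | lra]. }
  split.
  (* The orbit stays in [U] by closeness to the unperturbed orbit at first, by the disc of radius
     [rr] inside the gate, and by closeness to the orbit of [q] at the end. *)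
  - intros k Hk. destruct (Nat.lt_ge_cases k J) as [H1 | H1]; [apply HUJ; auto|].
    destruct (Nat.le_gt_cases k (n - J)) as [H2 | H2].
    + apply HUrr. apply Hmid. lia.
    + specialize (HUl (k - (n - J))%nat ltac:(lia)). unfold w in HUl.
      rewrite <- perturbed_orbit_add in HUl. replace (n - J + (k - (n - J)))%nat with k in HUl by lia. exact HUl.
  - unfold lavaurs. fold Phi u zeta. rewrite HL. unfold w in Hfin. rewrite <- perturbed_orbit_add in Hfin.
    replace (n - J + J)%nat with n in Hfin by lia. exact Hfin.
Qed.
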